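(* Suppose $V$ is bounded or $b-a\le\sqrt{\frac{m}{32c_2}}$. Let $h_N>0$ with $h_N\to0$ as $N\to\infty$. Let $\mu_a$ and $\mu_b$ be compactly supported absolutely continuous probability measures on $\mathbb{R}^n$. For each $N\in\mathbb{N}$ let $\mu_a^{(N)}=\frac1N\sum_{i=1}^N\delta_{x_i}$ and $\mu_b^{(N)}=\frac1N\sum_{i=1}^N\delta_{y_i}$ with points $x_i=x_i^{(N)},y_i=y_i^{(N)}\in\mathbb{R}^n$ and $x_i\ne x_j$ for $i\ne j$, and assume that there is a compact set in $\mathbb{R}^n$ supporting all the measures $\mu_a^{(N)},\mu_b^{(N)}$, $N\in\mathbb{N}$. If $\mu_a^{(N)}\rightharpoonup\mu_a$ and $\mu_b^{(N)}\rightharpoonup\mu_b$ weakly, then $\mathbb{A}^{[h_N]}_{\mu_a^{(N)},\mu_b^{(N)}}$ $\Gamma$-converges to $\mathbb{A}_{\mu_a,\mu_b}$ on $\mathcal{P}(C([a,b];\mathbb{R}^n))$ with respect to weak convergence, i.e.: (i) whenever $\pi^{(N)}\rightharpoonup\pi$ in $\mathcal{P}(C([a,b];\mathbb{R}^n))$, then $\liminf_{N\to\infty}\mathbb{A}^{[h_N]}_{\mu_a^{(N)},\mu_b^{(N)}}(\pi^{(N)})\ge\mathbb{A}_{\mu_a,\mu_b}(\pi)$; and (ii) for any $\pi\in\mathcal{P}(C([a,b];\mathbb{R}^n))$ there exists a sequence $\pi^{(N)}\rightharpoonup\pi$ in $\mathcal{P}(C([a,b];\mathbb{R}^n))$ such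 that $\lim_{N\to\infty}\mathbb{A}^{[h_N]}_{\mu_a^{(N)},\mu_b^{(N)}}(\pi^{(N)})=\mathbb{A}_{\mu_a,\mu_b}(\pi)$.
   Context: Let $L:\mathbb{R}^n\times\mathbb{R}^n\to\mathbb{R}$, $L(x,v)=\frac m2|v|^2-V(x)$, with $m>0$ and $V\in C^\infty(\mathbb{R}^n)$ satisfying $|V(x)|\le c_2(1+|x|^2)$ for some $c_2>0$. Fix $[a,b]\subset\mathbb{R}$, $a<b$. For $\gamma\in C([a,b];\mathbb{R}^n)$ set $\mathcal{A}(\gamma)=\int_a^bL(\gamma(t),\dot\gamma(t))\,dt$ if $\gamma$ is absolutely continuous and $\mathcal{A}(\gamma)=+\infty$ otherwise. For $h>0$ let a triangulation $\mathcal{T}_h=\{(\tau_{j-1},\tau_j):j=1,\dots,l\}$ of $(a,b)$ be given, where $a=\tau_0<\tau_1<\dots<\tau_l=b$ and $|\tau_j-\tau_{j-1}|\le h$. The time-discretized action (midpoint rule) is, for continuous $\gamma$ that is piecewise affine subordinate to $\mathcal{T}_h$ (affine on each $[\tau_{j-1},\tau_j]$), $$\mathcal{A}^{[h]}(\gamma)=\sum_{j=1}^l\left[\frac m2\frac{|\gamma(\tau_j)-\gamma(\tau_{j-1})|^2}{\tau_j-\tau_{j-1}}-V\left(\frac{\gamma(\tau_j)+\gamma(\tau_{j-1})}2\right)(\tau_j-\tau_{j-1})\right],$$ and $\mathcal{A}^{[h]}(\gamma)=+\infty$ for all other $\gamma\in C([a,b];\mathbb{R}^n)$. $C([a,b];\mathbb{R}^n)$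 carries the uniform metric, $\mathcal{P}(C([a,b];\mathbb{R}^n))$ is the set of its Borel probability measures, and $\rightharpoonup$ denotes weak convergence (testing against bounded continuous functions). Set $\mathbb{A}(\pi)=\int\mathcal{A}\,d\pi$ and $\mathbb{A}^{[h]}(\pi)=\int\mathcal{A}^{[h]}\,d\pi$. With $\mathrm{pr}_t(\gamma)=\gamma(t)$ and $\#$ denoting push-forward, for probability measures $\nu_a,\nu_b$ on $\mathbb{R}^n$ set $\mathbb{A}_{\nu_a,\nu_b}(\pi)=\mathbb{A}(\pi)$ and $\mathbb{A}^{[h]}_{\nu_a,\nu_b}(\pi)=\mathbb{A}^{[h]}(\pi)$ if $\mathrm{pr}_a\#\pi=\nu_a$ and $\mathrm{pr}_b\#\pi=\nu_b$, and set both equal to $\infty$ otherwise. *)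

(* Defs.v *)
From HB Require Import structures.
From mathcomp Require Import all_boot all_order all_algebra.
From mathcomp Require Import interval_inference.
From mathcomp Require Import all_classical all_reals all_analysis.

Set Implicit Arguments.
Unset Strict Implicit.
Unset Printing Implicit Defensive.

Import Order.TTheory GRing.Theory Num.Theory.
Import numFieldNormedType.Exports.

Local Open Scope classical_set_scope.
Local Open Scope ring_scope.

Notation borel X := (g_sigma_algebraType (@open X)).

Definition weak_cvg (R : realType) (X : ptopologicalType)
    (mu_ : nat -> {measure set (borel X) -> \bar R})
    (mu : {measure set (borel X) -> \bar R}) : Prop :=
  forall f : X -> R, continuous f -> bounded_fun f ->
    (\int[mu_ N]_x (f x)%:E)%E @[N --> \oo] --> (\int[mu]_x (f x)%:E)%E.

Section euclidean.
Variables (R : realType) (n : nat).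

(* The library norm on 'rV[R]_n is the sup norm, hence the Euclidean norm is
   written out. Both norms induce the same topology on 'rV[R]_n, and equivalent
   uniform metrics on the path space below. *)
Definition sqnorm (x : 'rV[R]_n) : R := \sum_i x ord0 i ^+ 2.
Definition enorm (x : 'rV[R]_n) : R := Num.sqrt (sqnorm x).

Definition partials (s : seq 'I_n) (V : 'rV[R]_n -> R) : 'rV[R]_n -> R :=
  foldr (fun i f => fun x => 'D_(delta_mx ord0 i) f x) V s.

(* C^oo: partial derivatives of all orders exist and are continuous. *)
Definition smooth (V : 'rV[R]_n -> R) : Prop :=
  forall s : seq 'I_n, continuous (partials s V) /\
    forall (i : 'I_n) x, derivable (partials s V) x (delta_mx ord0 i).

(* n-dimensional Lebesgue outer measure: infimum of the total volume of the
   countable covers by closed boxes. On Borel sets it is Lebesgue measure. *)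
Definition lebesgue_outer (A : set (borel 'rV[R]_n)) : \bar R :=
  ereal_inf [set v | exists lo hi : nat -> 'rV[R]_n,
    [/\ forall k i, lo k ord0 i <= hi k ord0 i,
        A `<=` \bigcup_k [set x | forall i,
                 lo k ord0 i <= x ord0 i <= hi k ord0 i] &
        v = (\sum_(0 <= k <oo)
               (\prod_(i < n) (hi k ord0 i - lo k ord0 i))%:E)%E]].

Definition empirical (N : nat) (x : nat -> 'rV[R]_n) :
    {measure set (borel 'rV[R]_n) -> \bar R} :=
  mscale (N%:R^-1)%:nng (msum (fun i => \d_(x i : borel 'rV[R]_n)) N).

End euclidean.

(* C([a, b]; R^n) with the uniform metric *)
Definition paths (R : realType) (n : nat) (a b : R) :=
  continuousType (`[a, b]%classic : Type) 'rV[R]_n.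

HB.instance Definition _ (R : realType) (n : nat) (a b : R) :=
  Choice.on (paths n a b).
HB.instance Definition _ (R : realType) (n : nat) (a b : R) :=
  PseudoMetric.copy (paths n a b)
    (initial_topology (id : paths n a b ->
       arrow_uniform_type (`[a, b]%classic : Type) 'rV[R]_n)).
HB.instance Definition _ (R : realType) (n : nat) (a b : R) :=
  isPointed.Build (paths n a b) (cst (0 : 'rV[R]_n) : continuousType _ _).

Section action.
Variables (R : realType) (n : nat) (m : R) (V : 'rV[R]_n -> R) (a b : R).
Implicit Type g : paths n a b.

(* pr t g = g t for t in [a, b]; the junk value for other t is 0. *)
Definition pr (t : R) g : 'rV[R]_n := valL_ 0 (g : `[a, b]%classic -> _) t.

Definition lagrangian (x v : 'rV[R]_n) : R := m / 2 * sqnorm v - V x.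

Definition abs_continuous (f : R -> 'rV[R]_n) : Prop :=
  forall e : R, 0 < e -> exists2 d : R, 0 < d &
    forall (k : nat) (s t : 'I_k -> R),
      (forall i, [/\ a <= s i, s i <= t i & t i <= b]) ->
      trivIset setT (fun i => `]s i, t i[%classic) ->
      \sum_i (t i - s i) < d ->
      \sum_i enorm (f (t i) - f (s i)) < e.

(* The derivative of an absolutely continuous path exists almost everywhere
   on [a, b]; its junk values elsewhere do not affect the integral. *)
Definition action g : \bar R :=
  let q t := pr t g in
  if `[< abs_continuous q >]
  then (\int[lebesgue_measure]_(t in `[a, b])
          (lagrangian (q t) (derive1 q t))%:E)%E
  else +oo%E.

(* With a = tau_0 < ... < tau_l = b encoded as s = [:: tau_1; ...; tau_l],
   node s j is tau_j for j <= l. *)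
Definition node (s : seq R) (j : nat) : R := nth b (a :: s) j.

Definition triangulation (h : R) (s : seq R) : Prop :=
  itv_partition a b s /\
  forall j, (j < size s)%N -> node s j.+1 - node s j <= h.

Definition piecewise_affine (s : seq R) g : Prop :=
  forall j, (j < size s)%N -> exists c v : 'rV[R]_n,
    forall t, node s j <= t <= node s j.+1 -> pr t g = c + t *: v.

Definition discrete_action (s : seq R) g : \bar R :=
  let q j := pr (node s j) g in
  let dt j := node s j.+1 - node s j in
  if `[< piecewise_affine s g >]
  then (\sum_(0 <= j < size s)
          (m / 2 * (sqnorm (q j.+1 - q j) / dt j)
           - V (2^-1 *: (q j.+1 + q j)) * dt j))%:E
  else +oo%E.

(* The library integral is the integral of the positive part minus that of the
   negative part. When V is bounded, or b - a is small as in the theorem, F is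
   action or discrete_action and nu_a has compact support, the latter is finite
   on the first branch, so no indeterminate difference occurs there. *)
Definition constrained_mean (F : paths n a b -> \bar R)
    (nu_a nu_b : {measure set (borel 'rV[R]_n) -> \bar R})
    (pi : probability (borel (paths n a b)) R) : \bar R :=
  let push t : set (borel 'rV[R]_n) -> \bar R :=
    pushforward pi (pr t : borel (paths n a b) -> borel 'rV[R]_n) in
  if `[< forall B : set (borel 'rV[R]_n), measurable B ->
           push a B = nu_a B /\ push b B = nu_b B >]
  then (\int[pi]_g F g)%E
  else +oo%E.

End action.

Arguments action {R n} m V {a b} g.

(* Main.v *)
Require Import Defs.
From HB Require Import structures.
From mathcomp Require Import all_boot all_order all_algebra.
From mathcomp Require Import interval_inference ring lra.
From mathcomp Require Import all_classical all_reals all_analysis.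
From mathcomp Require Import measurable_realfun.

Set Implicit Arguments.
Unset Strict Implicit.
Unset Printing Implicit Defensive.

Import Order.TTheory GRing.Theory Num.Theory.
Import numFieldNormedType.Exports.

Local Open Scope classical_set_scope.
Local Open Scope ring_scope.

(** For a path g and a partition s let Q_s(g) be the sum of the quotients
    |g(t') - g(t)|^2 / (t' - t) over the intervals of s ([penergy]), and let E(g)
    be the supremum of Q_s(g) over all s ([path_energy]). A path of finite energy
    is absolutely continuous, and then E(g) is the integral of |g'|^2. Hence the
    action is m/2 E(g) minus the integral of V along g ([actionE]), whereas the
    discrete action of a piecewise affine path is m/2 Q_s(g) minus a midpoint sum.
    The basic fact about the energy is that interpolation does not increase it
    ([penergy_path_interp]); therefore Q_s(g) tends to E(g) as s becomes fine
    ([cvg_penergy]). The hypothesis on V and b - a makes the discrete action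
    coercive: it is at least m/4 Q_s(g) - C for paths that start in a bounded set
    ([daction_coercive]).

    For the lower bound, truncate m/2 Q_s(g) minus the potential of g from above
    and from below. The resulting functions are bounded and continuous, they
    converge to the action as s becomes fine and the truncation is removed, and
    each of them is, up to a small error and uniformly in the path, below the
    discrete action on all sufficiently fine triangulations ([minorant_le]). Testing
    weak convergence against them and letting the truncation go gives the
    inequality, by Fatou's lemma ([lower_bound_constrained]). The marginals pass to
    the limit, so a violated constraint is violated eventually.

    For the recovery sequence it suffices to treat measures pi of finite action:
    otherwise the constant sequence does, by the lower bound. The energy is then
    pi-integrable ([energy_integrable]). Weak convergence of the empirical measures
    to mu_a yields couplings in which almost all mass travels a short distance;
    they are given by continuous weights w_i with sum 1 and mean 1/N, concentrated
    near x_i ([good_weights_ex]), and likewise by weights u_j near y_j. Replace a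
    random path g, with probability w_i(g(a)) u_j(g(b)), by its interpolation plus
    the affine path that moves its end points to x_i and y_j ([relink]). The law of
    the new path has the prescribed marginals, its discrete action is finite, and
    the affine correction changes the energy by a quadratic function of the
    displacement of the end points. Almost surely the averages of test functions
    and of the discrete action converge, with a majorant of the form A E(g) + B, and
    dominated convergence concludes ([averages_cvg], [recovery_sequence]). *)

(** * Partitions of an interval and absolutely continuous functions *)

Section partition_nodes.
Variables (R : realType).
Implicit Types (a b : R) (s : seq R).

Lemma node0 a b s : node a b s 0 = a.
Proof. by []. Qed.

Lemma node_size a b s : itv_partition a b s -> node a b s (size s) = b.
Proof. by rewrite /node => /itv_partition_nth_size; exact. Qed.

Lemma node_ltS a b s j : itv_partition a b s -> (j < size s)%N ->
  node a b s j < node a b s j.+1.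
Proof. by move=> [+ _] js => /(pathP b)/(_ _ js). Qed.

Lemma node_le a b s i j : itv_partition a b s -> (i <= j)%N -> (j <= size s)%N ->
  node a b s i <= node a b s j.
Proof.
move=> abs; elim: j => [|j IH]; first by rewrite leqn0 => /eqP ->.
rewrite leq_eqVlt => /predU1P[->//|]; rewrite ltnS => ij js.
by rewrite (le_trans (IH ij (ltnW js)))// ltW// node_ltS.
Qed.

Lemma node_itv a b s j : itv_partition a b s -> (j <= size s)%N ->
  a <= node a b s j <= b.
Proof.
move=> abs js; apply/andP; split; first exact: (node_le abs (leq0n j) js).
by rewrite -[leRHS](node_size abs) node_le.
Qed.

Lemma node_trivIset a b s : itv_partition a b s ->
  trivIset setT (fun j : 'I_(size s) => `]node a b s j, node a b s j.+1[%classic).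
Proof.
move=> abs i j _ _ [x []] /=; rewrite !in_itv/= => /andP[ix xi] /andP[jx xj].
apply/val_inj/eqP; rewrite eqn_leq; apply/andP; split; rewrite leqNgt;
  apply/negP => ij; have := node_le abs ij (ltnW (ltn_ord _)); lra.
Qed.

Lemma node_telescope a b s (F : R -> R) : itv_partition a b s ->
  \sum_(0 <= j < size s) (F (node a b s j.+1) - F (node a b s j)) = F b - F a.
Proof.
by move=> abs; rewrite telescope_sumr// node_size.
Qed.

End partition_nodes.

Section absolute_continuity.
Variables (R : realType) (a b : R).
Implicit Types f g : R -> R.

(** Densities are constructed one coordinate at a time, hence this version of
    [abs_continuous] for real functions. *)
Definition ac f := forall e : R, 0 < e -> exists2 d : R, 0 < d &
  forall (k : nat) (s t : 'I_k -> R),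
    (forall i, [/\ a <= s i, s i <= t i & t i <= b]) ->
    trivIset setT (fun i => `]s i, t i[%classic) ->
    \sum_i (t i - s i) < d -> \sum_i `|f (t i) - f (s i)| < e.

(** Refining a family of intervals yields a family indexed by a sigma type,
    so arbitrary finite index types are convenient. *)
Lemma ac_fin f : ac f -> forall e : R, 0 < e -> exists2 d : R, 0 < d &
  forall (T : finType) (s t : T -> R),
    (forall i, [/\ a <= s i, s i <= t i & t i <= b]) ->
    trivIset setT (fun i => `]s i, t i[%classic) ->
    \sum_i (t i - s i) < d -> \sum_i `|f (t i) - f (s i)| < e.
Proof.
move=> acf e /acf[d d0 H]; exists d => // T s t st tst std.
have E (F : T -> R) : \sum_(i : 'I_#|T|) F (enum_val i) = \sum_i F i.
  by rewrite -(big_enum_val (A := T)).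
rewrite -E; apply: (H _ (s \o enum_val) (t \o enum_val)).
- by move=> i; exact: st.
- by move=> i j _ _ /(tst _ _ Logic.I Logic.I) /enum_val_inj.
- by rewrite (E (fun i => t i - s i)).
Qed.

Lemma acN f : ac f -> ac (\- f).
Proof.
move=> acf e /acf[d d0 H]; exists d => // k s t st tst std.
rewrite (eq_bigr (fun i => `|f (t i) - f (s i)|)) ?H// => i _ /=.
by rewrite -opprD normrN.
Qed.

Lemma acD f g : ac f -> ac g -> ac (f \+ g).
Proof.
move=> acf acg e e0; have e20 : 0 < e / 2 by lra.
have [d d0 Hf] := acf _ e20; have [d' d'0 Hg] := acg _ e20.
exists (Num.min d d'); first by rewrite lt_min d0.
move=> k s t st tst; rewrite lt_min => /andP[sd sd'].
rewrite (@le_lt_trans _ _ (\sum_i `|f (t i) - f (s i)| +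
  \sum_i `|g (t i) - g (s i)|))//; last first.
  by rewrite [e]splitr ltrD// ?Hf ?Hg.
rewrite -big_split/= ler_sum// => i _; rewrite opprD addrACA.
exact: ler_normD.
Qed.

Lemma ac_dist f e : ac f -> 0 < e -> exists2 d : R, 0 < d &
  forall x y, a <= x -> x <= y -> y <= b -> y - x < d -> `|f y - f x| < e.
Proof.
move=> acf /acf[d d0 H]; exists d => // x y ax xy yb yxd.
have := H 1%N (fun=> x) (fun=> y) (fun=> And3 ax xy yb).
rewrite !big_ord1; apply => //.
by move=> i j _ _ _; rewrite !ord1.
Qed.

Lemma ac_variation f e : ac f -> 0 < e -> exists2 d : R, 0 < d &
  forall x y s, a <= x -> y <= b -> y - x < d -> itv_partition x y s ->
    variation x y f s < e.
Proof.
move=> acf /acf[d d0 H]; exists d => // x y s ax yb yxd xys.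
rewrite /variation big_mkord.
apply: (H _ (fun j => node x y s j) (fun j => node x y s j.+1)).
- move=> i; have /andP[x1 y1] := node_itv xys (ltnW (ltn_ord i)).
  have /andP[x2 y2] := node_itv xys (ltn_ord i).
  by have := node_ltS xys (ltn_ord i); split; lra.
- exact: node_trivIset.
- by rewrite -(big_mkord xpredT (fun i => node x y s i.+1 - node x y s i))
    (node_telescope id).
Qed.

(** The variation over an interval of length at most [d / 2] is at most 1, and
    finitely many such intervals fill [[a, b]]. *)
Lemma ac_bounded_variation f : a <= b -> ac f -> bounded_variation a b f.
Proof.
move=> ab acf; have [d d0 Hd] := ac_variation acf ltr01.
have key k y : a <= y <= b -> y - a <= k%:R * (d / 2) ->
    (total_variation a y f <= k%:R%:E)%E.
  elim: k y => [|k IH] y /andP[ay yb] yk.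
    have -> : y = a by rewrite mul0r in yk; lra.
    by rewrite total_variationxx.
  have H1 x : a <= x -> x <= y -> y - x <= d / 2 ->
      (total_variation x y f <= 1%:E)%E.
    move=> ax xy yx; apply: ge_ereal_sup => _ [_ [s xys <-] <-].
    by rewrite lee_fin ltW// (Hd x y)//; lra.
  have [yd|yd] := leP (y - d / 2) a.
    by rewrite (le_trans (H1 _ _ _ _))//; [lra|rewrite lee_fin ler1n].
  rewrite (@total_variationD _ a y (y - d / 2))//; [|lra|lra].
  rewrite -(natr1 k) EFinD leeD//.
    by apply: IH; [apply/andP; split; lra|rewrite -(natr1 k) mulrDl in yk; lra].
  by apply: H1; lra.
pose k := Num.bound ((b - a) / (d / 2)).
apply/bounded_variationP => //.
have bk : (total_variation a b f <= k%:R%:E)%E.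
  apply: key; first by rewrite ab lexx.
  rewrite -ler_pdivrMr; last by rewrite divr_gt0.
  by apply/ltW/archi_boundP; rewrite divr_ge0 ?subr_ge0// divr_ge0// ltW.
by rewrite ge0_fin_numE ?total_variation_ge0//; exact: le_lt_trans bk (ltry _).
Qed.

Definition tv f (x : R) : R := fine (total_variation a x f).

Lemma tvE f x y : ac f -> a <= x -> x <= y -> y <= b ->
  (tv f y - tv f x)%:E = total_variation x y f.
Proof.
move=> acf ax xy yb; have ab : a <= b by lra.
have bv := ac_bounded_variation ab acf.
have bvy : bounded_variation a y f.
  by apply: bounded_variationl bv => //; lra.
have bvx : bounded_variation a x f.
  by apply: bounded_variationl bvy => //; lra.
have bvxy : bounded_variation x y f.
  by apply: bounded_variationr bvy => //; lra.
rewrite EFinB /tv !fineK; try (by apply/bounded_variationP => //; lra).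
rewrite (@total_variationD _ a y x)// addeAC subee ?add0e//.
by apply/bounded_variationP.
Qed.

Lemma tv_ge f x y : ac f -> a <= x -> x <= y -> y <= b ->
  `|f y - f x| <= tv f y - tv f x.
Proof.
move=> acf ax xy yb; rewrite -lee_fin tvE//.
exact: total_variation_ge.
Qed.

(** A partition of each interval that almost attains its variation turns the
    variations of a family of intervals into the increments of [f] over a finer
    family of disjoint intervals with the same total length. *)
Lemma ac_tv f : ac f -> ac (tv f).
Proof.
move=> acf e e0; have e20 : 0 < e / 2 by lra.
have [d d0 H] := ac_fin acf e20; exists d => // k s t st tst std.
(* The partitions may lose eta on each of the k intervals. *)
pose eta := e / 2 / k.+1%:R.
have eta0 : 0 < eta by rewrite divr_gt0// ltr0n.
have ex i : exists l, itv_partition (s i) (t i) l /\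
    tv f (t i) - tv f (s i) < variation (s i) (t i) f l + eta.
  have [as_ sti tb] := st i.
  have : ((tv f (t i) - tv f (s i) - eta)%:E < total_variation (s i) (t i) f)%E.
    by rewrite -tvE// lte_fin; lra.
  rewrite /total_variation => /ereal_sup_gt[_ [_ [l stl <-] <-]].
  by rewrite lte_fin => ?; exists l; split => //; lra.
have {ex} [l Hl] := choice ex.
pose T := {i : 'I_k & 'I_(size (l i))}.
pose s' (u : T) := node (s (tag u)) (t (tag u)) (l (tag u)) (tagged u).
pose t' (u : T) := node (s (tag u)) (t (tag u)) (l (tag u)) (tagged u).+1.
have sub u : s (tag u) <= s' u /\ t' u <= t (tag u) /\ s' u <= t' u.
  case: u => i j; rewrite /s' /t' /=.
  have [P _] := Hl i.
  have /andP[x1 y1] := node_itv P (ltnW (ltn_ord j)).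
  have /andP[x2 y2] := node_itv P (ltn_ord j).
  by have := node_ltS P (ltn_ord j); repeat split; lra.
have sigE (F : forall i, 'I_(size (l i)) -> R) :
    \sum_(u : T) F (tag u) (tagged u) = \sum_i \sum_j F i j.
  by rewrite sig_big_dep//.
have HT : \sum_(u : T) `|f (t' u) - f (s' u)| < e / 2.
  apply: H.
  - by move=> u; have [? [? ?]] := sub u; have [? ? ?] := st (tag u); split; lra.
  - move=> [i j] [i' j'] _ _ [x [/= hx hx']].
    have ii' : i = i'.
      apply: (tst i i') => //; exists x; split.
        have [/= h1 [h2 h3]] := sub (existT _ i j).
        by move: hx; rewrite /= !in_itv/= => /andP[? ?]; apply/andP; split; lra.
      have [/= h1 [h2 h3]] := sub (existT _ i' j').
      by move: hx'; rewrite /= !in_itv/= => /andP[? ?]; apply/andP; split; lra.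
    move: ii' j' hx' => <- j' hx'; congr existT.
    have [P _] := Hl i.
    by apply: (node_trivIset P) => //; exists x.
  - rewrite /s' /t' (sigE (fun i j => node (s i) (t i) (l i) j.+1 -
      node (s i) (t i) (l i) j)).
    rewrite (eq_bigr (fun i => t i - s i))// => i _.
    have [P _] := Hl i.
    by rewrite -(big_mkord xpredT (fun j => node (s i) (t i) (l i) j.+1 -
      node (s i) (t i) (l i) j)) (node_telescope id).
have HE : \sum_(u : T) `|f (t' u) - f (s' u)| =
    \sum_i variation (s i) (t i) f (l i).
  rewrite /s' /t' (sigE (fun i j => `|f (node (s i) (t i) (l i) j.+1) -
      f (node (s i) (t i) (l i) j)|)).
  by apply: eq_bigr => i _; rewrite /variation big_mkord.
apply: (@le_lt_trans _ _ (\sum_(i < k) (variation (s i) (t i) f (l i) + eta))).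
  apply: ler_sum => i _; have [as_ sti tb] := st i.
  rewrite ger0_norm; first by have [_ /ltW] := Hl i.
  by apply: le_trans (tv_ge acf as_ sti tb).
rewrite big_split/= sumr_const card_ord -HE.
have : eta *+ k <= e / 2.
  rewrite /eta -mulr_natr -mulrA ler_piMr//; first lra.
  by rewrite mulrC ler_pdivrMr ?ltr0n// mul1r ler_nat.
by lra.
Qed.

End absolute_continuity.

(** * The fundamental theorem of calculus for absolutely continuous functions *)

Section clamping.
Variables (R : realType) (a b : R).

(** The nearest point of [[a, b]]. It extends functions on [[a, b]] to the line,
    and the increment of [clamp] over an interval is the length of the part of
    that interval that lies in [[a, b]]. *)
Definition clamp (x : R) : R := Num.max a (Num.min b x).

Lemma clamp_itv x : a <= b -> a <= clamp x <= b.
Proof.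
by move=> ab; rewrite /clamp le_max lexx /= ge_max ab ge_min lexx.
Qed.

Lemma clamp_id x : a <= x <= b -> clamp x = x.
Proof. by move=> /andP[ax xb]; rewrite /clamp (min_idPr xb) (max_idPr ax). Qed.

Lemma clamp_homo : {homo clamp : x y / x <= y}.
Proof.
move=> x y xy; rewrite /clamp ge_max !le_max lexx/=.
by apply/orP; right; rewrite le_min !ge_min lexx xy/= orbT.
Qed.

Lemma clamp_lip x y : x <= y -> clamp y - clamp x <= y - x.
Proof.
rewrite /clamp => xy; case: (leP b x) => bx; case: (leP b y) => by_.
- by rewrite subrr subr_ge0.
- lra.
- by case: (leP a b) => ab; case: (leP a x) => ax; lra.
- by case: (leP a y) => ay; case: (leP a x) => ax; lra.
Qed.

Lemma clamp_lip_norm x y : `|clamp y - clamp x| <= `|y - x|.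
Proof.
wlog xy : x y / x <= y.
  move=> H; have [/H//|/ltW/H] := leP x y.
  by rewrite distrC (distrC x).
rewrite !ger0_norm ?subr_ge0//; first exact: clamp_lip.
exact: clamp_homo.
Qed.

Lemma continuous_clamp : continuous clamp.
Proof.
move=> x; apply/cvgrPdist_lt => e e0; near=> y.
by rewrite (le_lt_trans (clamp_lip_norm _ _))//.
Unshelve. all: by end_near. Qed.

End clamping.

Section monotone_density.
Variables (R : realType) (a b : R) (F : R -> R).
Hypotheses (ab : a < b) (acF : ac a b F).
Hypothesis ndF : forall x y, a <= x -> x <= y -> y <= b -> F x <= F y.
Local Notation lambda := (@lebesgue_measure R).

Let G x := F (clamp a b x).

Let clampab x : a <= clamp a b x <= b := clamp_itv x (ltW ab).

Let G_nd : nondecreasing G.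
Proof.
move=> x y xy; have /andP[? ?] := clampab x; have /andP[? ?] := clampab y.
by apply: ndF => //; exact: clamp_homo.
Qed.

Let G_rc : right_continuous G.
Proof.
apply: right_continuousW => x; apply/cvgrPdist_lt => e e0.
have [d d0 H] := ac_dist acF e0; near=> y.
have : `|x - y| < d by near: y; exact: (@cvgr_dist_lt _ _ _ _ _ id).
move=> xyd; rewrite /G.
have [xy|/ltW yx] := leP x y.
  rewrite distrC H//; [by case/andP: (clampab x)|exact: clamp_homo|
    by case/andP: (clampab y)|].
  rewrite (le_lt_trans (clamp_lip _ _ xy))//.
  by rewrite distrC ger0_norm ?subr_ge0 in xyd.
rewrite H//; [by case/andP: (clampab y)|exact: clamp_homo|
  by case/andP: (clampab x)|].
rewrite (le_lt_trans (clamp_lip _ _ yx))//.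
by rewrite ger0_norm ?subr_ge0 in xyd.
Unshelve. all: by end_near. Qed.

HB.instance Definition _ := isCumulative.Build R _ R G G_nd G_rc.

Let mu : {measure set (measurableTypeR R) -> \bar R} :=
  lebesgue_stieltjes_measure (G : cumulative R R).

Let mu_itvoc s t : s <= t -> mu `]s, t]%classic = (G t - G s)%:E.
Proof.
move=> st; rewrite /mu/= /lebesgue_stieltjes_measure/= /measure_extension/=.
rewrite -(wlength_itv_bnd G false false st).
exact: (measurable_mu_extE (wlength G) (is_ocitv s t)).
Qed.

Let mD : measurable (`]a, b]%classic : set (measurableTypeR R)).
Proof. exact: measurable_itv. Qed.

Let mu_fin : (mu `]a, b]%classic < +oo)%E.
Proof. by rewrite mu_itvoc ?ltry// ltW. Qed.

Let nu : {finite_measure set (measurableTypeR R) -> \bar R} := mfrestr mD mu_fin.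

(** The infimum and the supremum of the part [J] of [I] in ]a, b] serve as end
    points: [J] lies in ]inf J, sup J], because [I] is open, and the open
    interval between them lies in [I]. *)
Let open_hull (I : set R) : open I -> is_interval I ->
  exists st : R * R, [/\ a <= st.1, st.1 <= st.2, st.2 <= b,
    `]st.1, st.2[%classic `<=` I &
    (mu (I `&` `]a, b]%classic) <= (F st.2 - F st.1)%:E)%E].
Proof.
move=> oI iI; pose J := I `&` `]a, b]%classic.
have [J0|/set0P[z Jz]] := eqVneq J set0.
  exists (a, a) => /=; rewrite -/J J0 measure0 subrr; split => //.
    exact: ltW.
  by move=> x /=; rewrite in_itv/= => /andP[/lt_trans h /h]; rewrite ltxx.
have lbJ : lbound J a by move=> x [_ /=]; rewrite in_itv/= => /andP[/ltW].
have ubJ : ubound J b by move=> x [_ /=]; rewrite in_itv/= => /andP[].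
have hi : has_inf J by split; [exists z|exists a].
have hs : has_sup J by split; [exists z|exists b].
have ai : a <= inf J by apply: lb_le_inf => //; exists z.
have sb : sup J <= b by apply: ge_sup => //; exists z.
have iz : inf J <= z by apply: ge_inf => //; exact: hi.2.
have zs : z <= sup J by apply: ub_le_sup => //; exact: hs.2.
have Jsub : J `<=` `]inf J, sup J]%classic.
  move=> x Jx; rewrite /= in_itv/=; apply/andP; split; last first.
    by apply: ub_le_sup => //; exact: hs.2.
  rewrite lt_neqAle ge_inf ?andbT//; last exact: hi.2.
  apply/eqP => xE; case: Jx => Ix /=; rewrite in_itv/= => /andP[ax xb].
  have /nbhs_ballP[e /= e0 He] := open_nbhs_nbhs (conj oI Ix).
  have ey : exists2 y, J y & y < x; last first.
    move: ey => [y Jy yx]; have : inf J <= y by apply: ge_inf => //; exact: hi.2.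
    by rewrite xE; lra.
  exists (Num.max (x - e / 2) ((a + x) / 2)).
    split.
      apply: He; rewrite /ball/= ger0_norm.
        have : x - e / 2 <= Num.max (x - e / 2) ((a + x) / 2) by rewrite le_max lexx.
        lra.
      by rewrite subr_ge0 ge_max; apply/andP; split; lra.
    rewrite /= in_itv/= lt_max; apply/andP; split.
      by apply/orP; right; lra.
    by rewrite ge_max; apply/andP; split; lra.
  by rewrite gt_max; apply/andP; split; lra.
exists (inf J, sup J) => /=; split => //; first exact: le_trans zs.
- move=> x /=; rewrite in_itv/= => /andP[ix xs].
  have [u Ju ux] := inf_lt hi.1 ix.
  have [v Jv xv] := sup_gt hs.1 xs.
  by apply: (iI u v _ _ x); [exact: Ju.1|exact: Jv.1|rewrite !ltW].
- have is_ : inf J <= sup J by exact: le_trans zs.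
  have -> : F (sup J) - F (inf J) = G (sup J) - G (inf J).
    by rewrite /G !clamp_id// ?sb ?ai ?andbT//=; [exact: le_trans sb|exact: le_trans is_].
  rewrite -(mu_itvoc is_) le_measure// inE; last exact: measurable_itv.
  apply: measurableI; last exact: measurable_itv.
  exact: measurable_realfun.open_measurable.
Qed.

(** A null set lies in an open set of small measure, that is, in a union of
    disjoint open intervals of small total length, over which the increments of
    [F] have a small sum. *)
Let nu_dom : nu `<< lambda.
Proof.
apply/null_content_dominatesP => A mA A0.
apply/eqP; rewrite eq_le measure_ge0 andbT.
apply/lee_addgt0Pr => e e0; rewrite add0e.
have [d d0 H] := acF e0.
have [|U [oU AU Ud]] := lebesgue_regularity_outer mA _ d0.
  by rewrite -[X in (X < _)%E]/(lambda A) A0 ltry.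
have mU : measurable U by exact: measurable_realfun.open_measurable.
have Ud' : (lambda U < d%:E)%E.
  have : (lambda U <= lambda A + lambda (U `\` A))%E.
    rewrite -{1}(setDUK AU).
    by rewrite (le_trans (measureU2 _ _ _))//; exact: measurableD.
  by rewrite A0 add0e => /le_lt_trans; apply.
pose I := open_disjoint_itv oU.
have oI j : open (I j) by exact: open_disjoint_itv_open.
have iI j : is_interval (I j) by exact: open_disjoint_itv_is_interval.
have [st Hst] := choice (fun j => open_hull (oI j) (iI j)).
have tI : trivIset setT I by exact: open_disjoint_itv_trivIset.
have mI j : measurable (I j) by exact: measurable_realfun.open_measurable.
have mID j : measurable (I j `&` `]a, b]%classic) by exact: measurableI.
apply: (@le_trans _ _ (\sum_(0 <= j <oo) mu (I j `&` `]a, b]%classic))%E).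
  apply: (@measure_sigma_subadditive _ _ _ mu) => //.
    by apply: measurableI.
  rewrite -setI_bigcupl; apply: setSI.
  by rewrite -open_disjoint_itv_bigcup.
apply: lime_le; first exact: is_cvg_nneseries.
near=> k; rewrite big_mkord.
apply: (@le_trans _ _ (\sum_(j < k) (F (st j).2 - F (st j).1))%:E).
  by rewrite -sumEFin; apply: lee_sum => j _; case: (Hst j).
rewrite lee_fin ltW//.
rewrite (le_lt_trans _ (H k (fun j => (st j).1) (fun j => (st j).2) _ _ _))//.
- by apply: ler_sum => j _; exact: ler_norm.
- by move=> j; case: (Hst j).
- move=> i j _ _ [x [/= xi xj]]; apply/val_inj.
  apply: (tI i j) => //; exists x; split.
    by have [_ _ _ + _] := Hst i; exact.
  by have [_ _ _ + _] := Hst j; exact.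
- rewrite -lte_fin (le_lt_trans _ Ud')// -sumEFin.
  rewrite (eq_bigr (fun j : 'I_k => lambda `](st j).1, (st j).2[%classic)); last first.
    move=> j _; rewrite lebesgue_measure_itv/= lte_fin.
    have [_ + _ _ _] := Hst j; rewrite le_eqVlt => /predU1P[->|->].
      by rewrite ltxx subrr.
    by rewrite EFinB.
  rewrite -measure_bigsetU_ord//; last first.
    move=> i j _ _ [x [/= xi xj]]; apply/val_inj.
    apply: (tI i j) => //; exists x; split.
      by have [_ _ _ + _] := Hst i; exact.
    by have [_ _ _ + _] := Hst j; exact.
  rewrite le_measure// ?inE//.
    by apply: bigsetU_measurable => j _; exact: measurable_itv.
  apply: (big_ind (fun X => X `<=` U)) => [x []|X Y XU YU x [/XU|/YU]//|j _ x xj].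
  rewrite (open_disjoint_itv_bigcup oU); exists j => //.
  by have [_ _ _ + _] := Hst j; apply.
Unshelve. all: by end_near. Qed.

(** The Stieltjes measure of [F] on ]a, b] is dominated by Lebesgue measure;
    the density is its Radon-Nikodym derivative. *)
Lemma nondecreasing_ac_density : exists g : R -> R,
  lambda.-integrable setT (EFin \o g) /\
  forall x, a <= x <= b -> F x - F a = \int[lambda]_(t in `[a, x]) g t.
Proof.
pose f := Radon_Nikodym_SigmaFinite.f nu lambda.
have ff x : f x \is a fin_num.
  exact: (Radon_Nikodym_SigmaFinite.f_fin_num nu_dom).
have fE : EFin \o (fine \o f) = f by apply/funext => x /=; rewrite fineK.
have fi : lambda.-integrable setT f.
  exact: (Radon_Nikodym_SigmaFinite.f_integrable nu_dom).
exists (fine \o f); split; first by rewrite fE.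
move=> x axb; have /andP[ax xb] := axb.
rewrite -Rintegral_itv_obnd_cbnd; last first.
  by rewrite fE; exact: integrableS fi.
rewrite /Rintegral.
under eq_integral do rewrite -[(_%:E)]/((EFin \o (fine \o f)) _) fE.
rewrite -Radon_Nikodym_SigmaFinite.f_integral//.
rewrite /nu /= /mfrestr /mrestr setIidl; last first.
  by move=> t /=; rewrite !in_itv/= => /andP[-> tx]; exact: le_trans xb.
have aab : a <= a <= b by rewrite lexx ltW.
by rewrite mu_itvoc//= /G !clamp_id.
Qed.

End monotone_density.

Section ftc_ac.
Variables (R : realType) (a b : R) (f : R -> R).
Hypotheses (ab : a < b) (acf : ac a b f).
Local Notation lambda := (@lebesgue_measure R).

(** [f] is the difference of [tv f] and [tv f - f], both of which are
    nondecreasing and absolutely continuous. *)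
Lemma ac_density : exists g : R -> R,
  lambda.-integrable setT (EFin \o g) /\
  forall x, a <= x <= b -> f x - f a = \int[lambda]_(t in `[a, x]) g t.
Proof.
have [|g1 [i1 H1]] := nondecreasing_ac_density ab (ac_tv acf).
  by move=> x y ax xy yb; rewrite -subr_ge0 (le_trans _ (tv_ge acf ax xy yb)).
have [|g2 [i2 H2]] := nondecreasing_ac_density ab (acD (ac_tv acf) (acN acf)).
  move=> x y ax xy yb /=; have := tv_ge acf ax xy yb.
  by have := ler_norm (f y - f x); lra.
exists (g1 \- g2); split.
  exact: (integrableB measurableT i1 i2).
move=> x xab.
rewrite RintegralB//; last 2 first.
  exact: integrableS i1.
  exact: integrableS i2.
rewrite -H1// -H2//=; lra.
Qed.

Lemma ac_ftc : exists g : R -> R,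
  [/\ lambda.-integrable setT (EFin \o g),
   forall x y, a <= x -> x <= y -> y <= b ->
     f y - f x = \int[lambda]_(t in `[x, y]) g t &
   {ae lambda, forall t, a < t < b -> derivable f t 1 /\ derive1 f t = g t}].
Proof.
have [g [ig Hg]] := ac_density; exists g; split => //.
  move=> x y ax xy yb.
  have -> : f y - f x = (f y - f a) - (f x - f a) by ring.
  rewrite !Hg//; try (by apply/andP; split; lra).
  rewrite (@Rintegral_itvB _ g (BLeft a) (BRight y) x)//.
  - rewrite Rintegral_itv_obnd_cbnd//.
    exact: integrableS ig.
  - exact: integrableS ig.
have lg : locally_integrable setT g.
  rewrite (_ : g = g \_ setT); last by rewrite patch_setT.
  exact: integrable_locally.
have igy y : lambda.-integrable `[a, y] (EFin \o g) by exact: integrableS ig.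
have := @FTC1 _ g (BLeft a) igy lg.
apply: filterS; first exact: (ae_filter_ringOfSetsType lambda).
move=> t /= H /andP[at_ tb].
have [|dF FE] := H; first by rewrite /= lte_fin.
pose F y := (\int[lambda]_(t in `[a, y]) g t).
have E : \forall z \near t, (F + cst (f a)) z = f z.
  near=> z; rewrite -[RHS](subrK (f a)) Hg//.
  apply/andP; split; apply: ltW; near: z.
    by apply: open_nbhs_nbhs; split; [exact: open_gt|].
  by apply: open_nbhs_nbhs; split; [exact: open_lt|].
have dc : derivable (cst (f a) : R -> R) t 1 by exact: derivable_cst.
have dF' : derivable (F + cst (f a)) t 1 by exact: derivableD.
split; first exact: near_eq_derivable dF'.
rewrite derive1E -(near_eq_derive _ E)//.
by rewrite deriveD// derive_cst addr0 -derive1E FE.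
Unshelve. all: by end_near. Qed.

End ftc_ac.

(** * Squared norms and the space of paths *)

Section heine_cantor.
Variables (R : realType) (X Y : pseudoMetricType R).

(** Stronger than the uniform continuity of the restriction of [f] to [K]: the
    second point may lie outside [K]. *)
Lemma heine_cantor (K : set X) (f : X -> Y) : compact K ->
  (forall x, K x -> {for x, continuous f}) ->
  forall e : R, 0 < e -> exists2 d : R, 0 < d &
    forall x y, K x -> ball x d y -> ball (f x) e (f y).
Proof.
move=> /compact_near_coveringP cK cf e e0.
have H := cK R 0^'+ (fun d x => forall y, ball x d y -> ball (f x) e (f y)) _ _.
have : \forall d \near 0^'+,
    K `<=` (fun x => forall y, ball x d y -> ball (f x) e (f y)).
  apply: H => x Kx.
  have e2 : 0 < e / 2 by rewrite divr_gt0.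
  have : nbhs x (f @^-1` ball (f x) (e / 2)).
    by apply: (cf x Kx); exact: nbhsx_ballx.
  move=> /nbhs_ballP[d /= d0 Hd].
  exists (ball x (d / 2), [set r | r < d / 2]) => /=.
    split; first by apply: nbhsx_ballx; rewrite divr_gt0.
    by apply: nbhs_right_lt; rewrite divr_gt0.
  move=> [x' r] /= [xx' rd] y x'y.
  apply: (@ball_splitr _ _ (f x)).
    by apply: Hd; apply: le_ball xx'; rewrite ler_pdivrMr// ler_peMr// ?ler1n// ltW.
  apply: Hd; apply: (ball_split xx').
  by apply: le_ball x'y; exact: ltW.
move=> Hn; near (0 : R)^'+ => d; exists d => // x y Kx.
by apply: (near Hn d).
Unshelve. all: by end_near. Qed.

End heine_cantor.

Lemma cvg_sum_ord (R : realType) (T : Type) (F : set_system T) (k : nat)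
  (f : 'I_k -> T -> R) (l : 'I_k -> R) : Filter F ->
  (forall i, f i x @[x --> F] --> l i) ->
  \sum_i f i x @[x --> F] --> \sum_i l i.
Proof.
elim: k f l => [|k IH] f l FF H.
  by under eq_cvg do rewrite big_ord0; rewrite big_ord0; exact: cvg_cst.
under eq_cvg do rewrite big_ord_recl; rewrite big_ord_recl.
by apply: cvgD; [exact: H|apply: IH => i; exact: H].
Qed.

Section squared_norm.
Variables (R : realType) (n : nat).
Implicit Types (x y z : 'rV[R]_n).

Lemma sqnorm_ge0 x : 0 <= sqnorm x.
Proof. by apply: sumr_ge0 => i _; exact: sqr_ge0. Qed.

Lemma sqnorm0 : sqnorm (0 : 'rV[R]_n) = 0.
Proof. by rewrite /sqnorm big1// => i _; rewrite mxE expr0n. Qed.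

Lemma sqnormZ (c : R) x : sqnorm (c *: x) = c ^+ 2 * sqnorm x.
Proof.
by rewrite /sqnorm mulr_sumr; apply: eq_bigr => i _; rewrite mxE exprMn.
Qed.

Lemma sqnormN x : sqnorm (- x) = sqnorm x.
Proof. by apply: eq_bigr => i _; rewrite mxE sqrrN. Qed.

Definition dotp x y : R := \sum_i x ord0 i * y ord0 i.

Lemma sqnormD x y : sqnorm (x + y) = sqnorm x + 2 * dotp x y + sqnorm y.
Proof.
rewrite /sqnorm /dotp mulr_sumr -!big_split/=; apply: eq_bigr => i _.
by rewrite mxE; ring.
Qed.

Lemma dotpZr (c : R) x y : dotp x (c *: y) = c * dotp x y.
Proof.
by rewrite /dotp mulr_sumr; apply: eq_bigr => i _; rewrite mxE; ring.
Qed.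

Lemma dotpDl x y z : dotp (x + y) z = dotp x z + dotp y z.
Proof.
by rewrite /dotp -big_split; apply: eq_bigr => i _; rewrite mxE mulrDl.
Qed.

Lemma dotp_suml (k : nat) (F : nat -> 'rV[R]_n) z :
  dotp (\sum_(0 <= j < k) F j) z = \sum_(0 <= j < k) dotp (F j) z.
Proof.
elim: k => [|k IH]; last by rewrite !big_nat_recr//= dotpDl IH.
by rewrite !big_geq// /dotp big1// => i _; rewrite mxE mul0r.
Qed.

Lemma sqnormD_le x y : sqnorm (x + y) <= 2 * sqnorm x + 2 * sqnorm y.
Proof.
rewrite /sqnorm !mulr_sumr -big_split/=; apply: ler_sum => i _.
rewrite mxE -subr_ge0.
have -> : 2 * x ord0 i ^+ 2 + 2 * y ord0 i ^+ 2 - (x ord0 i + y ord0 i) ^+ 2 =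
  (x ord0 i - y ord0 i) ^+ 2 by ring.
exact: sqr_ge0.
Qed.

Lemma dotp_le x y : `|2 * dotp x y| <= sqnorm x + sqnorm y.
Proof.
rewrite /sqnorm /dotp mulr_sumr -big_split/=.
rewrite (le_trans (ler_norm_sum _ _ _))//; apply: ler_sum => i _.
set u := x ord0 i; set v := y ord0 i.
rewrite ler_norml; apply/andP; split; rewrite -subr_ge0.
  have -> : 2 * (u * v) - - (u ^+ 2 + v ^+ 2) = (u + v) ^+ 2 by ring.
  exact: sqr_ge0.
have -> : u ^+ 2 + v ^+ 2 - 2 * (u * v) = (u - v) ^+ 2 by ring.
exact: sqr_ge0.
Qed.

Lemma norm_sqnorm x (r : R) : 0 <= r -> sqnorm x <= r ^+ 2 -> `|x| <= r.
Proof.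
move=> r0 xr; rewrite /Num.Def.normr/= mx_normrE.
apply: bigmax_le => // -[i j] _ /=; rewrite (ord1 i).
rewrite -(ler_pXn2r (ltn0Sn 1)) ?nnegrE// real_normK ?num_real//.
rewrite (le_trans _ xr)// /sqnorm (bigD1 j)//= lerDl.
by apply: sumr_ge0 => k _; exact: sqr_ge0.
Qed.

Lemma coord_le_norm x i : `|x ord0 i| <= `|x|.
Proof.
rewrite [leRHS]/Num.Def.normr/= mx_normrE.
exact: (le_bigmax _ (fun ij : 'I_1 * 'I_n => `|x ij.1 ij.2|) (ord0, i)).
Qed.

Lemma coord_le_enorm x i : `|x ord0 i| <= enorm x.
Proof.
rewrite /enorm -sqrtr_sqr ler_wsqrtr// /sqnorm (bigD1 i)//= lerDl.
by apply: sumr_ge0 => k _; exact: sqr_ge0.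
Qed.

Lemma sqnorm_norm x : sqnorm x <= n%:R * `|x| ^+ 2.
Proof.
rewrite /sqnorm (le_trans (_ : _ <= \sum_(i < n) `|x| ^+ 2))//.
  apply: ler_sum => i _.
  by rewrite -real_normK ?num_real// lerXn2r ?nnegrE// coord_le_norm.
by rewrite sumr_const card_ord mulr_natl.
Qed.

Lemma continuous_sqnorm : continuous (@sqnorm R n).
Proof.
move=> x; apply: (cvg_sum_ord (nbhs_filter x)) => i; apply: (@continuous_comp _ _ _ (fun y : 'rV[R]_n => y ord0 i) (fun r => r ^+ 2)).
  exact: coord_continuous.
exact: exprn_continuous.
Qed.

Lemma compact_norm_le (r : R) : compact [set x : 'rV[R]_n | `|x| <= r].
Proof.
apply: bounded_closed_compact.
  exists r; split; first exact: num_real.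
  by move=> M rM x /= xr; rewrite (le_trans xr)// ltW.
rewrite (_ : [set _ | _] = (fun x : 'rV[R]_n => `|x|) @^-1` [set y | y <= r])//.
by apply: preimage_closed; [move=> x _; exact: norm_continuous|exact: closed_le].
Qed.

Lemma compact_sqnorm_bounded (K : set 'rV[R]_n) : compact K ->
  exists2 r : R, 0 <= r & forall x, K x -> sqnorm x <= r.
Proof.
move=> /compact_bounded[M [_ HM]].
pose B := Num.max 0 (M + 1).
exists (n%:R * B ^+ 2); first by rewrite mulr_ge0// sqr_ge0.
move=> x Kx; rewrite (le_trans (sqnorm_norm _))// ler_wpM2l//.
rewrite lerXn2r ?nnegrE//; first by rewrite /B le_max lexx.
rewrite (le_trans (HM (M + 1) _ x Kx))//; first by rewrite ltrDl.
by rewrite /B le_max lexx orbT.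
Qed.

End squared_norm.

Section path_space.
Variables (R : realType) (n : nat) (a b : R).
Hypothesis ab : a <= b.
Implicit Types (g : paths n a b) (t : R).

Lemma pr_in g t (ht : t \in `[a, b]%classic) :
  pr t g = g (exist _ t ht : `[a, b]%classic).
Proof.
transitivity ((sigL `[a, b]%classic \o valL_ 0) (g : `[a, b]%classic -> 'rV[R]_n)
  (exist _ t ht)); first by [].
by rewrite sigL_valL.
Qed.

Lemma itv_mem t : a <= t <= b -> t \in `[a, b]%classic.
Proof. by move=> tab; apply/mem_set; rewrite /= in_itv. Qed.

Lemma pathsP g g' : (forall t, a <= t <= b -> pr t g = pr t g') -> g = g'.
Proof.
move=> H; apply/continuousEP => -[t ht].
by rewrite -!pr_in; apply: H; have := set_mem ht; rewrite /= in_itv.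
Qed.

Lemma paths_ballP g g' (e : R) :
  ball g e g' <-> forall t, a <= t <= b -> ball (pr t g) e (pr t g').
Proof.
have -> : ball g e g' = (forall t : `[a, b]%classic, ball (g t) e (g' t)) by [].
split=> [H t /itv_mem ht|H [t ht]].
  by rewrite !pr_in; exact: H.
by rewrite -!pr_in; apply: H; have := set_mem ht; rewrite /= in_itv.
Qed.

Lemma nbhs_pathsP g (U : set (paths n a b)) : nbhs g U <->
  exists2 e : R, 0 < e & forall g',
    (forall t, a <= t <= b -> `|pr t g - pr t g'| < e) -> U g'.
Proof.
split=> [/nbhs_ballP[e /= e0 H]|[e e0 H]];
  [exists e => //|apply/nbhs_ballP; exists e => //].
  move=> g' Hg'; apply: H; apply/paths_ballP => t tab.
  by rewrite -ball_normE; exact: Hg'.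
move=> g' /paths_ballP Hg'; apply: H => t /Hg'.
by rewrite -ball_normE.
Qed.

Lemma continuous_pathsP (Y : pseudoMetricType R) (f : paths n a b -> Y) g :
  {for g, continuous f} <->
  forall e : R, 0 < e -> exists2 d : R, 0 < d & forall g',
    (forall t, a <= t <= b -> `|pr t g - pr t g'| < d) -> ball (f g) e (f g').
Proof.
split=> [H e e0|H U].
  by have /nbhs_pathsP[d d0 Hd] := H _ (nbhsx_ballx (f g) _ e0); exists d.
move=> /nbhs_ballP[e /= e0 He]; apply/nbhs_pathsP.
by have [d d0 Hd] := H _ e0; exists d => // g' /Hd /He.
Qed.

Lemma continuous_pr t : a <= t <= b -> continuous (pr t : paths n a b -> _).
Proof.
move=> tab g; apply/continuous_pathsP => e e0; exists e => // g' H.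
by rewrite -ball_normE; exact: H.
Qed.

(** Composing with [clamp] makes the path a continuous function on the whole
    line, since [pr t g] jumps to 0 outside [[a, b]]. *)
Lemma path_continuous g : continuous (fun t => pr (clamp a b t) g).
Proof.
have cm t : clamp a b t \in `[a, b]%classic by apply/itv_mem/clamp_itv.
pose c t : `[a, b]%classic := exist _ (clamp a b t) (cm t).
rewrite (_ : (fun t => _) = (g : `[a, b]%classic -> 'rV[R]_n) \o c); last first.
  by apply/funext => t /=; rewrite (pr_in _ (cm t)).
have cc : continuous c.
  have := continuous_clamp (a := a) (b := b).
  by move=> ccl t; apply/(@continuous_comp_initial `[a, b]%classic R R set_val).
move=> t; apply: continuous_comp; first exact: cc.
exact: cts_fun.
Qed.

Lemma path_unif_continuous g (e : R) : 0 < e -> exists2 d : R, 0 < d &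
  forall s t, a <= s <= b -> a <= t <= b -> `|s - t| < d ->
    `|pr s g - pr t g| < e.
Proof.
move=> e0.
have [d d0 H] := heine_cantor (@segment_compact R a b)
  (fun x _ => path_continuous (g := g) (x := x)) e0.
exists d => // s t sab tab st.
have := H s t; rewrite -!ball_normE /= !clamp_id//; apply => //.
Qed.

Lemma path_image_compact g : compact [set pr t g | t in `[a, b]%classic].
Proof.
have -> : [set pr t g | t in `[a, b]%classic] =
    (fun t => pr (clamp a b t) g) @` `[a, b]%classic.
  by apply/seteqP; split=> x [t tab <-]; exists t => //;
    rewrite clamp_id//; move: tab; rewrite /= in_itv.
apply: continuous_compact; last exact: segment_compact.
by apply: continuous_subspaceT; exact: path_continuous.
Qed.

Lemma path_near_unif (f : 'rV[R]_n -> R) g (e : R) : continuous f -> 0 < e ->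
  exists2 d : R, 0 < d & forall t z, a <= t <= b -> `|pr t g - z| < d ->
    `|f (pr t g) - f z| < e.
Proof.
move=> cf e0.
have [d d0 H] := heine_cantor (@path_image_compact g) (fun x _ => cf x) e0.
exists d => // t z tab tz.
have := H (pr t g) z; rewrite -!ball_normE /=; apply => //.
by exists t => //=; rewrite in_itv.
Qed.

Section mk_path.
Variables (q : R -> 'rV[R]_n) (cq : continuous q).

Let restr (t : `[a, b]%classic) : 'rV[R]_n := q (set_val t).

Let crestr : continuous restr.
Proof.
move=> t; apply: (@continuous_comp _ _ _ set_val q); last exact: cq.
exact: initial_continuous.
Qed.

Definition mk_path : paths n a b := (mkcts crestr : continuousType _ _).

Lemma pr_mk_path t : a <= t <= b -> pr t mk_path = q t.
Proof. by move=> /itv_mem ht; rewrite (pr_in _ ht). Qed.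

End mk_path.

End path_space.

(** * Piecewise affine interpolation *)

Section interpolation.
Variables (R : realType) (n : nat) (a b : R) (s : seq R).
Hypothesis abs : itv_partition a b s.
Implicit Types (q : R -> 'rV[R]_n) (t : R).

Local Notation nd := (node a b s).

(** The length of the part of the j-th interval that precedes t. As a
    combination of ramps, the interpolation is visibly continuous and its
    increments over any interval have a closed form. *)
Definition ramp (j : nat) t : R := clamp (nd j) (nd j.+1) t - nd j.

Definition slope q (j : nat) : 'rV[R]_n :=
  (nd j.+1 - nd j)^-1 *: (q (nd j.+1) - q (nd j)).

Definition interp q t : 'rV[R]_n :=
  q a + \sum_(0 <= j < size s) ramp j t *: slope q j.

(** The integral of the squared speed of the interpolation of [q]. *)
Definition energy q : R :=
  \sum_(0 <= j < size s) sqnorm (q (nd j.+1) - q (nd j)) / (nd j.+1 - nd j).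

(** The part of the energy of the interpolation that is spent before t. *)
Definition cum_energy q t : R :=
  \sum_(0 <= j < size s) ramp j t * sqnorm (slope q j).

Lemma ramp_le j t : nd j <= nd j.+1 -> t <= nd j -> ramp j t = 0.
Proof.
move=> jj tj; rewrite /ramp /clamp (min_idPr (le_trans tj jj)).
by rewrite (max_idPl tj) subrr.
Qed.

Lemma ramp_ge j t : nd j <= nd j.+1 -> nd j.+1 <= t ->
  ramp j t = nd j.+1 - nd j.
Proof.
by move=> jj tj; rewrite /ramp /clamp (min_idPl tj) (max_idPr jj).
Qed.

Lemma ramp_in j t : nd j <= t <= nd j.+1 -> ramp j t = t - nd j.
Proof. by move=> tj; rewrite /ramp clamp_id. Qed.

Let ndS j : (j < size s)%N -> nd j <= nd j.+1.
Proof. by move=> js; exact/ltW/node_ltS. Qed.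

Lemma sum_ramp (V : lmodType R) (v : nat -> V) k t :
  (k < size s)%N -> nd k <= t <= nd k.+1 ->
  \sum_(0 <= j < size s) ramp j t *: v j =
  \sum_(0 <= j < k) (nd j.+1 - nd j) *: v j + (t - nd k) *: v k.
Proof.
move=> ks /[dup] tk /andP[kt tk1].
rewrite (big_cat_nat (leq0n k) (ltnW ks))/=; congr (_ + _).
  apply: eq_big_nat => j /andP[_ jk]; rewrite ramp_ge//.
    by apply: ndS; exact: ltn_trans ks.
  by apply: le_trans kt; apply: node_le => //; exact: ltnW.
rewrite big_ltn// ramp_in// big_nat big1 ?addr0// => j /andP[kj js].
rewrite ramp_le ?scale0r//; first exact: ndS.
by apply: (le_trans tk1); apply: node_le => //; exact: ltnW.
Qed.

Lemma slopeE q j : (j < size s)%N ->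
  (nd j.+1 - nd j) *: slope q j = q (nd j.+1) - q (nd j).
Proof.
move=> js; rewrite /slope scalerA divff ?scale1r// subr_eq0 gt_eqF//.
exact: node_ltS.
Qed.

Lemma interp_in q k t : (k < size s)%N -> nd k <= t <= nd k.+1 ->
  interp q t = q (nd k) + (t - nd k) *: slope q k.
Proof.
move=> ks tk; rewrite /interp (sum_ramp _ ks tk) addrA; congr (_ + _).
rewrite (eq_big_nat _ _ (F2 := fun j => q (nd j.+1) - q (nd j))); last first.
  by move=> j /andP[_ jk]; rewrite slopeE//; exact: ltn_trans ks.
by rewrite (telescope_sumr (fun j => q (nd j)) (leq0n k))// addrC subrK.
Qed.

Lemma interp_node q k : (k <= size s)%N -> interp q (nd k) = q (nd k).
Proof.
case: k => [_|k ks].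
  rewrite /interp big_nat big1 ?addr0// => j /andP[_ js].
  rewrite ramp_le ?scale0r//; first exact: ndS.
  by apply: node_le => //; exact: ltnW.
rewrite (interp_in q (k := k))//; last by rewrite lexx ndS.
by rewrite slopeE// addrC subrK.
Qed.

Lemma node_locate_oc t : a < b -> a < t <= b ->
  exists2 k, (k < size s)%N & nd k < t <= nd k.+1.
Proof.
move=> ab /andP[at_ tb].
have s0 : (0 < size s)%N.
  by rewrite lt0n; apply/eqP => /size0nil s0; move: abs;
    rewrite s0 => /itv_partition_nil ab0; move: ab; rewrite ab0 ltxx.
suff H k : (k < size s)%N -> t <= nd k.+1 ->
    exists2 j, (j < size s)%N & nd j < t <= nd j.+1.
  by apply: (H (size s).-1); rewrite prednK// node_size.
elim: k => [ks tk|k IH ks tk]; first by exists 0%N => //; rewrite at_.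
have [tk'|kt] := leP t (nd k.+1); first exact: IH (ltnW ks) tk'.
by exists k.+1 => //; rewrite kt.
Qed.

Lemma node_locate t : a < b -> a <= t <= b ->
  exists2 k, (k < size s)%N & nd k <= t <= nd k.+1.
Proof.
move=> ab /andP[]; rewrite le_eqVlt => /predU1P[<- _|at_ tb]; last first.
  by have [|k ks /andP[/ltW kt tk]] := @node_locate_oc t ab;
    [rewrite at_|exists k; rewrite ?kt].
have [|k ks _] := @node_locate_oc b ab; first by rewrite ab lexx.
have s0 := leq_ltn_trans (leq0n k) ks.
by exists 0%N => //; have /andP[-> _] := node_itv abs s0; rewrite lexx.
Qed.

Lemma continuous_interp q : continuous (interp q).
Proof.
move=> t; apply: cvgD; first exact: cvg_cst.
elim: (size s) => [|k IH].
  by under eq_cvg do rewrite big_geq//; rewrite big_geq//; exact: cvg_cst.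
under eq_cvg do rewrite big_nat_recr//=; rewrite big_nat_recr//=.
apply: cvgD => //; apply: cvgZr_tmp.
by apply: cvgB; [exact: continuous_clamp|exact: cvg_cst].
Qed.

Lemma ramp_homo j : {homo ramp j : x y / x <= y}.
Proof. by move=> x y xy; rewrite lerD2r clamp_homo. Qed.

Lemma sum_ramp1 t : a < b -> a <= t <= b ->
  \sum_(0 <= j < size s) ramp j t = t - a.
Proof.
move=> ab tab; have [k ks tk] := node_locate ab tab.
have := sum_ramp (fun=> 1 : R^o) ks tk.
under eq_bigr do rewrite /GRing.scale/= mulr1.
move=> ->; under eq_bigr do rewrite /GRing.scale/= mulr1.
by rewrite (telescope_sumr nd (leq0n k)) /GRing.scale/= mulr1 addrC subrKA.
Qed.

(** The Cauchy-Schwarz inequality with weights; the induction step needs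
    [2 * dotp S (v k) <= P * sqnorm (v k) + W], which is the inequality between
    the arithmetic and the geometric mean for [S / P] and [v k]. *)
Lemma weighted_cauchy (k : nat) (p : nat -> R) (v : nat -> 'rV[R]_n) :
  (forall j, 0 <= p j) ->
  sqnorm (\sum_(0 <= j < k) p j *: v j) <=
  (\sum_(0 <= j < k) p j) * (\sum_(0 <= j < k) p j * sqnorm (v j)).
Proof.
move=> p0; elim: k => [|k IH].
  by rewrite !big_geq// sqnorm0 mul0r.
rewrite !big_nat_recr//=.
set S := \sum_(0 <= j < k) p j *: v j in IH *.
set P := \sum_(0 <= j < k) p j in IH *.
set W := \sum_(0 <= j < k) _ in IH *.
have P0 : 0 <= P by apply: sumr_ge0.
have W0 : 0 <= W by apply: sumr_ge0 => j _; rewrite mulr_ge0// sqnorm_ge0.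
rewrite sqnormD sqnormZ dotpZr.
have H : 2 * dotp S (v k) <= P * sqnorm (v k) + W.
  have [P00|Pn0] := eqVneq P 0.
    have S0 : sqnorm S = 0.
      by apply/eqP; rewrite eq_le sqnorm_ge0 andbT (le_trans IH)// P00 mul0r.
    have : dotp S (v k) = 0.
      rewrite /dotp big1// => i _; apply/eqP; rewrite mulf_eq0; apply/orP; left.
      rewrite -sqrf_eq0; have /eqP := S0; rewrite psumr_eq0 => [/allP/(_ i)|j _].
        by apply; rewrite mem_index_enum.
      exact: sqr_ge0.
    by move=> ->; rewrite P00 mulr0 mul0r add0r.
  have Pgt : 0 < P by rewrite lt_neqAle eq_sym Pn0.
  have := dotp_le (P^-1 *: S) (v k).
  have -> : dotp (P^-1 *: S) (v k) = P^-1 * dotp S (v k).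
    by rewrite /dotp mulr_sumr; apply: eq_bigr => i _; rewrite mxE mulrA.
  rewrite sqnormZ => /(le_trans (ler_norm _)) h.
  have : P * (2 * (P^-1 * dotp S (v k))) <= P * (P^-1 ^+ 2 * sqnorm S + sqnorm (v k)).
    by rewrite ler_wpM2l.
  have -> : P * (2 * (P^-1 * dotp S (v k))) = 2 * dotp S (v k) by field.
  move=> /le_trans; apply.
  rewrite mulrDr addrC lerD2l.
  have -> : P * (P^-1 ^+ 2 * sqnorm S) = sqnorm S / P by field.
  by rewrite ler_pdivrMr// mulrC.
have := mulr_ge0 (p0 k) P0.
have := p0 k; have := sqnorm_ge0 (v k); nra.
Qed.

Lemma cum_energy_homo q : {homo cum_energy q : x y / x <= y}.
Proof.
move=> x y xy; apply: ler_sum => j _.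
by rewrite ler_wpM2r ?sqnorm_ge0// ramp_homo.
Qed.

Lemma cum_energyb q : cum_energy q b - cum_energy q a = energy q.
Proof.
rewrite /cum_energy /energy -sumrB; apply: eq_big_nat => j /andP[_ js].
have lt := node_ltS abs js.
have /andP[aj _] := node_itv abs (ltnW js).
have /andP[_ jb] := node_itv abs js.
have -> : ramp j b = nd j.+1 - nd j by apply: ramp_ge => //; exact: ltW.
have -> : ramp j a = 0 by apply: ramp_le => //; exact: ltW.
rewrite mul0r subr0 /slope sqnormZ.
by field; rewrite subr_eq0 gt_eqF.
Qed.

Lemma energy_ge0 q : 0 <= energy q.
Proof.
rewrite -cum_energyb subr_ge0 cum_energy_homo//.
exact: itv_partition_le abs.
Qed.

(** The increment is the sum of the slopes weighted by the lengths of the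
    parts of [[x, y]] in the intervals of the partition, and these lengths add
    up to [y - x]. *)
Lemma interp_lip q x y : a < b -> a <= x -> x <= y -> y <= b ->
  sqnorm (interp q y - interp q x) <=
  (y - x) * (cum_energy q y - cum_energy q x).
Proof.
move=> ab ax xy yb.
have -> : interp q y - interp q x =
    \sum_(0 <= j < size s) (ramp j y - ramp j x) *: slope q j.
  rewrite /interp opprD addrACA subrr add0r -sumrB.
  by apply: eq_bigr => j _; rewrite [RHS]scalerBl.
have -> : y - x = \sum_(0 <= j < size s) (ramp j y - ramp j x).
  rewrite sumrB !sum_ramp1//; [by ring|..]; by apply/andP; split; lra.
have -> : cum_energy q y - cum_energy q x =
    \sum_(0 <= j < size s) (ramp j y - ramp j x) * sqnorm (slope q j).
  by rewrite /cum_energy -sumrB; apply: eq_bigr => j _; rewrite [RHS]mulrBl.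
by apply: weighted_cauchy => j; rewrite subr_ge0 ramp_homo.
Qed.

Lemma node_lip q j k : a < b -> (j <= k)%N -> (k <= size s)%N ->
  sqnorm (q (nd k) - q (nd j)) <= (nd k - nd j) * energy q.
Proof.
move=> ab jk ks; have js := leq_trans jk ks.
rewrite -(interp_node q ks) -(interp_node q js).
have /andP[aj jb] := node_itv abs js; have /andP[ak kb] := node_itv abs ks.
have jk' := node_le abs jk ks.
apply: (le_trans (interp_lip q ab aj jk' kb)).
rewrite ler_wpM2l ?subr_ge0// -cum_energyb lerB// cum_energy_homo//.
Qed.

Lemma eq_energy q q' : (forall j, (j <= size s)%N -> q (nd j) = q' (nd j)) ->
  energy q = energy q'.
Proof.
move=> H; apply: eq_big_nat => j /andP[_ js].
by rewrite !H//; exact: ltnW.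
Qed.

(** The cross terms telescope, so that the change of the energy depends only
    on the end points of [q]. *)
Lemma energyD_affine q (c d : 'rV[R]_n) :
  energy (fun t => q t + (c + t *: d)) =
  energy q + 2 * dotp (q b - q a) d + (b - a) * sqnorm d.
Proof.
transitivity (\sum_(0 <= j < size s)
   (sqnorm (q (nd j.+1) - q (nd j)) / (nd j.+1 - nd j) +
    2 * dotp (q (nd j.+1) - q (nd j)) d + (nd j.+1 - nd j) * sqnorm d)).
  apply: eq_big_nat => j /andP[_ js].
  have -> : q (nd j.+1) + (c + nd j.+1 *: d) - (q (nd j) + (c + nd j *: d)) =
      q (nd j.+1) - q (nd j) + (nd j.+1 - nd j) *: d.
    rewrite scalerBl opprD opprD addrACA; congr (_ + _).
    by rewrite addrACA subrr add0r.
  rewrite sqnormD sqnormZ dotpZr; field.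
  by rewrite subr_eq0 gt_eqF// node_ltS.
rewrite !big_split/= -mulr_suml (node_telescope id)//; congr (_ + _ + _).
rewrite -mulr_sumr -dotp_suml.
by rewrite (telescope_sumr (fun j => q (nd j)))//= node_size.
Qed.

End interpolation.

(** * Integrals and null sets *)

Section integral_lemmas.
Context d (T : measurableType d) (R : realType).
Variable mu : {measure set T -> \bar R}.
Local Open Scope ereal_scope.
Import HBNNSimple.

(** For arbitrary functions: the Lagrangian along a path is only determined
    almost everywhere. A simple function below one of them, multiplied by
    the indicator of the complement of [N], is below the other and has the same
    integral. *)
Lemma ge0_integral_eq_off_null (N : set T) (f g : T -> \bar R) :
  measurable N -> mu N = 0 -> (forall x, 0 <= f x) -> (forall x, 0 <= g x) ->
  (forall x, ~ N x -> f x = g x) -> \int[mu]_x f x = \int[mu]_x g x.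
Proof.
move=> mN N0.
suff H (u v : T -> \bar R) : (forall x, 0 <= u x) -> (forall x, 0 <= v x) ->
    (forall x, ~ N x -> u x = v x) -> \int[mu]_x u x <= \int[mu]_x v x.
  move=> f0 g0 fg; apply/eqP; rewrite eq_le; apply/andP; split; apply: H => //.
  by move=> x Nx; rewrite fg.
move=> u0 v0 uv; rewrite !ge0_integralTE//.
apply: ge_ereal_sup => _ [h /= hu <-].
pose h' := mul_nnsfun h (indic_nnsfun R (measurableC mN)).
have -> : sintegral mu h = sintegral mu h'.
  rewrite -!integralT_nnsfun; apply: ge0_ae_eq_integral => //.
  - by apply/measurable_EFinP.
  - by apply/measurable_EFinP.
  - by move=> x _; rewrite lee_fin.
  - by move=> x _; rewrite lee_fin.
  - exists N; split => // x /= /not_implyP[_] hh; apply: contrapT => Nx.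
    apply: hh => /=; congr EFin.
    by rewrite -[RHS]/(h x * \1_(~` N) x)%R indicE mem_set ?mulr1.
apply: ereal_sup_ubound; exists h' => //= x.
rewrite -[X in (X%:E <= _)]/(h x * \1_(~` N) x)%R indicE.
have [Nx|Nx] := pselect (N x).
  by rewrite memNset ?mulr0//; exact.
by rewrite mem_set// mulr1 -uv.
Qed.

Lemma integral_eq_off_null (D N : set T) (f g : T -> \bar R) :
  measurable N -> mu N = 0 ->
  (forall x, D x -> ~ N x -> f x = g x) ->
  \int[mu]_(x in D) f x = \int[mu]_(x in D) g x.
Proof.
move=> mN N0 fg; rewrite integral_mkcond [RHS]integral_mkcond.
have fg' x : ~ N x -> (f \_ D) x = (g \_ D) x.
  move=> Nx; rewrite !patchE; case: ifPn => // /set_mem Dx; exact: fg.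
rewrite integralE [RHS]integralE; congr (_ - _);
  apply: (ge0_integral_eq_off_null mN N0) => // x /fg' e.
  by rewrite !funeposE e.
by rewrite !funenegE e.
Qed.

Lemma le_integral_ae (D : set T) (f g : T -> \bar R) : measurable D ->
  measurable_fun D f -> measurable_fun D g ->
  {ae mu, forall x, D x -> f x <= g x} ->
  \int[mu]_(x in D) f x <= \int[mu]_(x in D) g x.
Proof.
move=> mD mf mg fg; rewrite integralE [leRHS]integralE leeB//.
  apply: ae_ge0_le_integral => //; [exact: measurable_funepos..|].
  apply: filterS fg => x fg Dx; rewrite !funeposE.
  by rewrite ge_max !le_max fg// lexx orbT.
apply: ae_ge0_le_integral => //; [exact: measurable_funeneg..|].
apply: filterS fg => x fg Dx; rewrite !funenegE.
by rewrite ge_max !le_max leeN2 fg// lexx orbT.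
Qed.

(** Additivity when the integral of the nonnegative function may be infinite. *)
Lemma integralD_ge0_integrable (D : set T) (f h : T -> \bar R) : measurable D ->
  measurable_fun D f -> (forall x, D x -> 0 <= f x) -> mu.-integrable D h ->
  \int[mu]_(x in D) (f x + h x) = \int[mu]_(x in D) f x + \int[mu]_(x in D) h x.
Proof.
move=> mD mf f0 ih.
have mh : measurable_fun D h by exact: measurable_int ih.
have [foo|] := boolP (\int[mu]_(x in D) f x < +oo).
  apply: integralD => //; apply/integrableP; split => //.
  by under eq_integral => x /set_mem Dx do rewrite gee0_abs ?f0//.
rewrite -leNgt leye_eq => /eqP fE; rewrite fE addye; last first.
  by have /fin_numP[] := integrable_fin_num mD ih.
rewrite integralE.
have mfh : measurable_fun D (fun x => f x + h x) by exact: emeasurable_funD.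
have neg : \int[mu]_(x in D) (fun x => f x + h x)^\- x < +oo.
  have := integral_funeneg_lt_pinfty mD ih; apply: le_lt_trans.
  apply: ge0_le_integral => //; [exact: measurable_funeneg..|].
  move=> x Dx; rewrite !funenegE ge_max !le_max lexx orbT andbT.
  by rewrite leeN2 leeDr// f0.
have pos : \int[mu]_(x in D) (fun x => f x + h x)^\+ x = +oo.
  apply/eqP; rewrite -leye_eq -fE.
  have H : \int[mu]_(x in D) f x <=
      \int[mu]_(x in D) ((fun x => f x + h x)^\+ x + `|h x|).
    apply: ge0_le_integral => //.
      apply: emeasurable_funD; first exact: measurable_funepos.
      exact: measurableT_comp.
    move=> x Dx; have [hfin|] := boolP (h x \is a fin_num).
      rewrite (@le_trans _ _ (f x + h x + `|h x|))//.
        rewrite -addeA leeDl// -(fineK hfin) -EFinD lee_fin.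
        have := ler_norm (- fine (h x))%R; rewrite normrN /=; lra.
      by rewrite leeD2r// funeposE le_max lexx.
    rewrite fin_numE negb_and !negbK => /orP[/eqP->|/eqP->] /=.
      by rewrite addey ?leey// funeposE gt_eqF// (@lt_le_trans _ _ 0)// le_max lexx orbT.
    by rewrite addey ?leey// funeposE gt_eqF// (@lt_le_trans _ _ 0)// le_max lexx orbT.
  rewrite fE in H; move: H; rewrite leye_eq => /eqP H; rewrite fE leye_eq.
  rewrite ge0_integralD// in H; last 2 first.
  - exact: measurable_funepos.
  - exact: measurableT_comp.
  apply: contraT; rewrite -ltey => lt.
  have /integrableP[_ hlt] := ih.
  by have := lte_add_pinfty lt hlt; rewrite H ltxx.
by rewrite pos addye// eqe_oppLR/= lt_eqF.
Qed.

End integral_lemmas.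

(** * The energy of a path *)

Section path_energy.
Variables (R : realType) (n : nat) (a b : R).
Hypothesis ab : a < b.
Implicit Types (g : paths n a b) (s : seq R).

Let leab : a <= b := ltW ab.

Definition mesh_lt (d : R) s := itv_partition a b s /\
  forall j, (j < size s)%N -> node a b s j.+1 - node a b s j < d.

Definition fine_sequence (T : nat -> seq R) :=
  forall d : R, 0 < d -> \forall N \near \oo, mesh_lt d (T N).

Definition penergy s g : R := energy a b s (fun t => pr t g).

Definition path_interp s g : paths n a b :=
  mk_path a b (continuous_interp (a := a) (b := b) (s := s) (q := fun t => pr t g)).

Lemma continuous_sqnorm_sub x y : a <= x <= b -> a <= y <= b ->
  continuous (fun g => sqnorm (pr y g - pr x g)).
Proof.
move=> xab yab g.
apply: (@continuous_comp _ _ _ (fun g => pr y g - pr x g) (@sqnorm R n)).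
  apply: (@cvgB _ _ _ (nbhs g) (nbhs_filter g)).
    exact: (continuous_pr yab).
  exact: (continuous_pr xab).
exact: continuous_sqnorm.
Qed.

Lemma continuous_enorm_sub x y : a <= x <= b -> a <= y <= b ->
  continuous (fun g => enorm (pr y g - pr x g)).
Proof.
move=> xab yab g.
apply: (@continuous_comp _ _ _ (fun g => sqnorm (pr y g - pr x g)) Num.sqrt).
  exact: continuous_sqnorm_sub.
exact: sqrt_continuous.
Qed.

Lemma continuous_penergy s : itv_partition a b s -> continuous (penergy s).
Proof.
move=> abs.
rewrite (_ : penergy s = fun g => \sum_(j < size s)
    sqnorm (pr (node a b s j.+1) g - pr (node a b s j) g) /
    (node a b s j.+1 - node a b s j)); last first.
  by apply/funext => g; rewrite /penergy /energy big_mkord.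
move=> g; apply: (cvg_sum_ord (nbhs_filter g)) => j.
have h1 := node_itv abs (ltnW (ltn_ord j)); have h2 := node_itv abs (ltn_ord j).
by apply: cvgMr_tmp; exact: (continuous_sqnorm_sub h1 h2).
Qed.

Lemma path_interp_close g (e : R) : 0 < e -> exists2 d : R, 0 < d &
  forall s, mesh_lt d s -> forall t, a <= t <= b ->
    `|pr t g - pr t (path_interp s g)| < e.
Proof.
move=> e0; have e20 : 0 < e / 2 by rewrite divr_gt0.
have [d d0 H] := path_unif_continuous leab g e20.
exists d => // s [abs sd] t tab.
have [k ks /andP[kt tk]] := node_locate abs ab tab.
rewrite /path_interp pr_mk_path// (interp_in abs _ ks) ?kt//.
set u := node a b s k in kt *; set v := node a b s k.+1 in tk *.
have uv : u < v by exact: node_ltS.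
have vud : v - u < d by exact: sd.
have uab : a <= u <= b by apply: node_itv => //; exact: ltnW.
have vab : a <= v <= b by exact: node_itv.
rewrite /slope -/u -/v scalerA opprD addrA (le_lt_trans (ler_normB _ _))//.
rewrite [e]splitr ltrD//.
  by rewrite H// ger0_norm ?subr_ge0//; lra.
rewrite normrZ (@le_lt_trans _ _ `|pr v g - pr u g|)//.
  rewrite ler_piMl// ger0_norm; first by rewrite ler_pdivrMr ?subr_gt0// mul1r; lra.
  by rewrite divr_ge0// subr_ge0// ltW.
by rewrite H// ger0_norm ?subr_ge0// ltW.
Qed.

(** By [interp_lip], each term on the left is at most the energy that the
    interpolation spends between two consecutive nodes of [s]. *)
Lemma penergy_path_interp s s' g : itv_partition a b s -> itv_partition a b s' ->
  penergy s (path_interp s' g) <= penergy s' g.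
Proof.
move=> abs abs'; rewrite /penergy.
set q := fun t => pr t g.
have -> : energy a b s (fun t => pr t (path_interp s' g)) =
    energy a b s (interp a b s' q).
  apply: eq_energy => j js; rewrite /path_interp pr_mk_path//.
  exact: node_itv.
rewrite -(cum_energyb abs') -(node_telescope (cum_energy a b s' q) abs).
rewrite /energy big_nat [leRHS]big_nat; apply: ler_sum => j /andP[_ js].
rewrite ler_pdivrMr ?subr_gt0 ?node_ltS//.
rewrite mulrC; apply: interp_lip => //.
- by have /andP[] := node_itv abs (ltnW js).
- exact/ltW/node_ltS.
- by have /andP[] := node_itv abs js.
Qed.

(** The energy on [s] is continuous, the interpolation of [g] on a fine [s']
    is close to [g], and its energy on [s] is at most the energy of [g] on [s']. *)
Lemma penergy_lsc s g (e : R) : itv_partition a b s -> 0 < e ->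
  exists2 d : R, 0 < d & forall s', mesh_lt d s' -> penergy s g <= penergy s' g + e.
Proof.
move=> abs e0.
have [/(_ (continuous_penergy abs (x := g)) e e0)[d d0 H] _] :=
  continuous_pathsP (penergy s) g.
have [d' d'0 H'] := path_interp_close g d0.
exists d' => // s' ms'; have := H _ (H' _ ms').
rewrite /ball /= => /(le_lt_trans (ler_norm _)) h.
by have := penergy_path_interp g abs ms'.1; lra.
Qed.

(** For absolutely continuous paths this is the integral of the squared speed,
    for all others it is infinite; as a supremum of continuous functions it is
    well behaved on the whole path space. *)
Definition path_energy g : \bar R :=
  ereal_sup [set (penergy s g)%:E | s in [set s | itv_partition a b s]].

Lemma penergy_le g s : itv_partition a b s -> ((penergy s g)%:E <= path_energy g)%E.
Proof. by move=> abs; apply: ereal_sup_ubound; exists s. Qed.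

Lemma penergy_ge0 s g : itv_partition a b s -> 0 <= penergy s g.
Proof. by move=> abs; exact: energy_ge0. Qed.

Lemma path_energy_ge0 g : (0 <= path_energy g)%E.
Proof.
have p1 := itv_partition1 ab.
by rewrite (le_trans _ (penergy_le g p1))// lee_fin penergy_ge0.
Qed.

Lemma cvg_penergy T g : fine_sequence T ->
  (penergy (T N) g)%:E @[N --> \oo] --> path_energy g.
Proof.
move=> fT.
have lim x : (x%:E < path_energy g)%E -> \forall N \near \oo, x < penergy (T N) g.
  move=> /ereal_sup_gt[_ [s /= abs <-]]; rewrite lte_fin => xs.
  have e0 : 0 < penergy s g - x by rewrite subr_gt0.
  have e20 : 0 < (penergy s g - x) / 2 by rewrite divr_gt0.
  have [d d0 H] := penergy_lsc g abs e20.
  by apply: filterS (fT d d0) => N /H; lra.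
case E : (path_energy g) (path_energy_ge0 g) => [r| |] // _.
- apply: cvg_EFin; first by near=> N.
  apply/cvgrPdist_lt => e e0; near=> N; rewrite /=.
  have h1 : r - e < penergy (T N) g.
    by near: N; apply: lim; rewrite E lte_fin ltrBlDr ltrDl.
  have h2 : penergy (T N) g <= r.
    rewrite -lee_fin -E; apply: penergy_le.
    by have [] : mesh_lt 1 (T N) by near: N; exact: fT.
  by rewrite ger0_norm; lra.
- apply/cvgeyPgt => A; near=> N; rewrite lte_fin; near: N.
  by apply: lim; rewrite E ltry.
Unshelve. all: by end_near. Qed.

Lemma sum_disjoint_length (c d : R) (k : nat) (s t : 'I_k -> R) : c <= d ->
  (forall i, [/\ c <= s i, s i <= t i & t i <= d]) ->
  trivIset setT (fun i => `]s i, t i[%classic) ->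
  \sum_i (t i - s i) <= d - c.
Proof.
move=> cd st tst; rewrite -lee_fin -sumEFin.
rewrite (eq_bigr (fun i => (@lebesgue_measure R) `]s i, t i[%classic)); last first.
  move=> i _; rewrite lebesgue_measure_itv/= lte_fin.
  have [_ + _] := st i; rewrite le_eqVlt => /predU1P[->|->].
    by rewrite ltxx subrr.
  by rewrite EFinB.
rewrite -measure_bigsetU_ord//.
have -> : (d - c)%:E = (@lebesgue_measure R) `[c, d]%classic.
  rewrite lebesgue_measure_itv/= lte_fin.
  by move: cd; rewrite le_eqVlt => /predU1P[->|->]; rewrite ?ltxx ?subrr// EFinB.
rewrite le_measure// ?inE//.
  by apply: bigsetU_measurable => j _; exact: measurable_itv.
apply: (big_ind (fun X => X `<=` `[c, d]%classic)) => [x []|X Y XU YU x [/XU|/YU]//|i _ x].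
have [cs sti td] := st i.
by rewrite /= !in_itv/= => /andP[? ?]; apply/andP; split; lra.
Qed.

(** On the j-th interval of the partition the energy grows at constant rate,
    and the parts of the given intervals in it are disjoint. *)
Lemma sum_disjoint_cum_energy s q (k : nat) (u v : 'I_k -> R) :
  itv_partition a b s ->
  (forall i, [/\ a <= u i, u i <= v i & v i <= b]) ->
  trivIset setT (fun i => `]u i, v i[%classic) ->
  \sum_i (cum_energy a b s q (v i) - cum_energy a b s q (u i)) <=
  energy a b s (q : R -> 'rV[R]_n).
Proof.
move=> abs uv tuv; rewrite -(cum_energyb abs) /cum_energy.
under eq_bigr do rewrite -sumrB.
rewrite exchange_big/= -sumrB big_nat [leRHS]big_nat; apply: ler_sum => j /andP[_ js].
under eq_bigr do rewrite -mulrBl.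
rewrite -mulr_suml -mulrBl ler_wpM2r ?sqnorm_ge0//.
have lt := node_ltS abs js.
have /andP[aj _] := node_itv abs (ltnW js).
have /andP[_ jb] := node_itv abs js.
have -> : ramp a b s j b = node a b s j.+1 - node a b s j.
  by apply: ramp_ge => //; exact: ltW.
have -> : ramp a b s j a = 0 by apply: ramp_le => //; exact: ltW.
rewrite subr0.
under eq_bigr do rewrite /ramp opprD addrACA subrr addr0.
set c := node a b s j in lt *; set d := node a b s j.+1 in lt *.
apply: (sum_disjoint_length (s := fun i => clamp c d (u i))
  (t := fun i => clamp c d (v i))); first exact: ltW.
  move=> i; have [_ uvi _] := uv i.
  have /andP[? _] := clamp_itv (u i) (ltW lt).
  have /andP[_ ?] := clamp_itv (v i) (ltW lt).
  by split => //; exact: clamp_homo.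
have sub i : `]clamp c d (u i), clamp c d (v i)[%classic `<=` `]u i, v i[%classic.
  move=> x /=; rewrite !in_itv/= => /andP[ux xv].
  have /andP[cu du] := clamp_itv (u i) (ltW lt).
  have /andP[cv dv] := clamp_itv (v i) (ltW lt).
  have xE : clamp c d x = x by rewrite clamp_id//; apply/andP; split; lra.
  rewrite -xE in ux xv.
  rewrite !ltNge; apply/andP; split; apply/negP.
    by move=> /(clamp_homo c d); lra.
  by move=> /(clamp_homo c d); lra.
by move=> i i' _ _ [x [xi xi']]; apply: (tuv i i') => //; exists x; split; exact: sub.
Qed.

(** An increment of the interpolation over an interval of length p that carries
    the energy w is at most [sqrt (p * w) <= (l * p + w / l) / 2]. The total of w
    is at most [M], which fixes l; then the total length is made small against
    [1 / l]. *)
Lemma finite_energy_ac T g (M : R) : fine_sequence T ->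
  (path_energy g <= M%:E)%E -> abs_continuous a b (fun t => pr t g).
Proof.
move=> fT gM e e0.
have M0 : 0 <= M by rewrite -lee_fin (le_trans (path_energy_ge0 g)).
pose l := 2 * (M + 1) / e.
have l0 : 0 < l by rewrite divr_gt0// mulr_gt0//; lra.
exists (e / 2 / l); first by rewrite divr_gt0// divr_gt0.
move=> k u v uv tuv uvd.
(* The sum is continuous on the path space, so it may be estimated on the
   interpolations. *)
have Hlim : (\sum_i enorm (pr (v i) (path_interp (T N) g) - pr (u i) (path_interp (T N) g)))
    @[N --> \oo] --> \sum_i enorm (pr (v i) g - pr (u i) g).
  apply: cvg_sum_ord => i.
  have [au uvi vb] := uv i.
  have uab : a <= u i <= b by apply/andP; split; lra.
  have vab : a <= v i <= b by apply/andP; split; lra.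
  apply: (@cvg_comp _ _ _ (fun N => path_interp (T N) g)
    (fun g => enorm (pr (v i) g - pr (u i) g)) _ (nbhs g)); last first.
    exact: continuous_enorm_sub.
  move=> U /nbhs_pathsP[d d0 Hd]; have [d' d'0 H'] := path_interp_close g d0.
  change (\forall N \near \oo, U (path_interp (T N) g)).
  by apply: filterS (fT _ d'0) => N mN; apply: Hd; exact: H'.
apply: (@le_lt_trans _ _ (e / 2)); last by lra.
apply: (ler_cvg_to Hlim (cvg_cst (e / 2))).
near=> N; have mN : mesh_lt 1 (T N) by near: N; exact: fT.
set q := fun t => pr t g; set F := cum_energy a b (T N) q.
apply: (@le_trans _ _ (\sum_i (l * (v i - u i) + (F (v i) - F (u i)) / l) / 2)).
  apply: ler_sum => i _; have [au uvi vb] := uv i.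
  rewrite /path_interp !pr_mk_path; [|by apply/andP; split; lra..].
  have := interp_lip mN.1 q ab au uvi vb.
  rewrite -/F /enorm; set p := v i - u i; set w := F _ - F _ => Hp.
  have p0 : 0 <= p by rewrite subr_ge0.
  have w0 : 0 <= w by rewrite subr_ge0; exact: cum_energy_homo.
  have r0 : 0 <= (l * p + w / l) / 2.
    by rewrite divr_ge0// addr_ge0//; [rewrite mulr_ge0// ltW|rewrite divr_ge0// ltW].
  rewrite -(ler_pXn2r (ltn0Sn 1)) ?nnegrE// ?sqrtr_ge0// sqr_sqrtr ?sqnorm_ge0//.
  apply: (le_trans Hp); rewrite -subr_ge0.
  have -> : ((l * p + w / l) / 2) ^+ 2 - p * w = ((l * p - w / l) / 2) ^+ 2.
    by field; rewrite gt_eqF.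
  exact: sqr_ge0.
rewrite -mulr_suml big_split/= -mulr_sumr -mulr_suml.
have S1 : l * \sum_i (v i - u i) <= e / 2.
  by rewrite mulrC -ler_pdivlMr// ltW.
have S2 : (\sum_i (F (v i) - F (u i))) / l <= e / 2.
  rewrite ler_pdivrMr// (le_trans (sum_disjoint_cum_energy q mN.1 uv tuv))//.
  have : energy a b (T N) q <= M.
    by rewrite -lee_fin (le_trans (penergy_le g mN.1)).
  move=> /le_trans; apply; rewrite /l.
  have -> : e / 2 * (2 * (M + 1) / e) = M + 1 by field; rewrite gt_eqF.
  lra.
lra.
Unshelve. all: by end_near. Qed.

End path_energy.

(** * The action expressed by the energy *)

Section energy_of_density.
Variables (R : realType) (n : nat) (a b : R).
Hypothesis ab : a < b.
Local Notation lambda := (@lebesgue_measure R).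

(** The end points of [[a, b]] join the exceptional set, because two-sided
    derivatives say nothing there. *)
Lemma integral_eq_interior (N : set R) (f h : R -> \bar R) : measurable N ->
  lambda N = 0%E -> (forall t, a < t < b -> ~ N t -> f t = h t) ->
  (\int[lambda]_(t in `[a, b]) f t = \int[lambda]_(t in `[a, b]) h t)%E.
Proof.
move=> mN N0 fh; apply: (@integral_eq_off_null _ _ _ lambda _ (N `|` [set a] `|` [set b])).
- by do 2 apply: measurableU => //.
- apply/eqP; rewrite eq_le measure_ge0 andbT.
  rewrite (le_trans (measureU2 _ _ _))//; first exact: measurableU.
  rewrite [X in (_ + X)%E]lebesgue_measure_set1 adde0.
  rewrite (le_trans (measureU2 _ _ _))//.
  by rewrite [X in (_ + X)%E]lebesgue_measure_set1 adde0 le_eqVlt; apply/orP; left; apply/eqP.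
move=> t /= tab Nt; apply: fh => [|?]; last by apply: Nt; left; left.
move: tab; rewrite in_itv/= => /andP[at_ tb]; rewrite !lt_neqAle at_ tb !andbT.
by apply/andP; split; apply/eqP => e; apply: Nt; [left; right|right].
Qed.

Lemma ac_coord (q : R -> 'rV[R]_n) i : abs_continuous a b q ->
  ac a b (fun t => q t ord0 i).
Proof.
move=> acq e /acq[d d0 H]; exists d => // k s t st tst std.
apply: le_lt_trans (H _ _ _ st tst std); apply: ler_sum => j _.
by rewrite (le_trans _ (coord_le_enorm _ i))// !mxE.
Qed.

(** The slopes of all short chords around t, not only of those that start at
    t, approach the derivative. *)
Lemma derivable_slope (f : R -> R) t l e : derivable f t 1 -> derive1 f t = l ->
  0 < e -> exists2 d : R, 0 < d & forall u v, u <= t -> t <= v -> u < v ->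
    v - u < d -> `|(f v - f u) / (v - u) - l| <= e.
Proof.
move=> df fl e0.
have : h^-1 *: (f (h + t) - f t) @[h --> 0^'] --> l.
  rewrite -fl derive1E; have := df; rewrite /derive /=.
  move=> /cvg_ex[/= r Hr].
  have E : (fun h : R => h^-1 *: (f (h *: (1 : R) + t) - f t)) =
           (fun h => h^-1 *: (f (h + t) - f t)).
    by apply/funext => h; rewrite [h *: _]mulr1.
  rewrite /= in Hr; rewrite E in Hr *.
  by rewrite (cvg_lim _ Hr)//.
move=> /cvgrPdist_le/(_ e e0)[d /= d0 H].
exists d => //.
have near y : `|y - t| < d -> `|f y - f t - l * (y - t)| <= e * `|y - t|.
  move=> yt; have [->|yt0] := eqVneq y t.
    by rewrite !subrr mulr0 subr0 normr0 mulr0.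
  have := H (y - t); rewrite /ball_ /= sub0r normrN => /(_ yt).
  rewrite subr_eq0 => /(_ yt0); rewrite subrK => h.
  have yt1 : y - t != 0 by rewrite subr_eq0.
  have -> : f y - f t - l * (y - t) =
      - (l - (y - t)^-1 *: (f y - f t)) * (y - t).
    by rewrite /GRing.scale/=; field.
  by rewrite normrM normrN ler_wpM2r.
move=> u v ut tv uv vud.
have h1 : `|f v - f t - l * (v - t)| <= e * (v - t).
  by rewrite -{2}(@ger0_norm _ (v - t)) ?subr_ge0// near// ger0_norm; lra.
have h2 : `|f u - f t - l * (u - t)| <= e * (t - u).
  have -> : t - u = `|u - t| by rewrite ler0_norm ?opprB// subr_le0.
  by apply: near; rewrite distrC ger0_norm; lra.
have vu0 : 0 < v - u by rewrite subr_gt0.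
have -> : (f v - f u) / (v - u) - l =
    ((f v - f t - l * (v - t)) - (f u - f t - l * (u - t))) / (v - u).
  by field; rewrite gt_eqF.
rewrite normf_div (gtr0_norm vu0) ler_pdivrMr// (le_trans (ler_normB _ _))//.
lra.
Qed.

Section density.
Variables (g : paths n a b) (G : 'I_n -> R -> R).
Hypothesis iG : forall i, lambda.-integrable setT (EFin \o G i).
Hypothesis ftcG : forall i x y, a <= x -> x <= y -> y <= b ->
  pr y g ord0 i - pr x g ord0 i = \int[lambda]_(t in `[x, y]) G i t.

Let G2 t := \sum_i G i t ^+ 2.

Let mG i (D : set R) : measurable_fun D (G i).
Proof.
by apply: measurable_funTS; apply/measurable_EFinP; exact: measurable_int (iG i).
Qed.

Let mGsq i (D : set R) : measurable_fun D (fun t => (G i t ^+ 2)%:E).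
Proof. by apply/measurable_EFinP; apply: measurable_funX. Qed.

Lemma measurable_density (D : set R) : measurable_fun D (fun t => (G2 t)%:E).
Proof.
apply/measurable_EFinP; rewrite /G2.
by apply: measurable_sum => i; apply: measurable_funX.
Qed.

Lemma density_ge0 t : 0 <= G2 t.
Proof. by apply: sumr_ge0 => i _; exact: sqr_ge0. Qed.

(** Integrate [(G i t - c) ^+ 2 >= 0], where [c] is the mean slope. *)
Lemma jensen_coord i x y : a <= x -> x < y -> y <= b ->
  (((pr y g ord0 i - pr x g ord0 i) ^+ 2 / (y - x))%:E <=
   \int[lambda]_(t in `[x, y]) (G i t ^+ 2)%:E)%E.
Proof.
move=> ax xy yb; set D := pr y g ord0 i - pr x g ord0 i.
pose c := D / (y - x).
have yx0 : 0 < y - x by rewrite subr_gt0.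
have mI : measurable (`[x, y]%classic : set (measurableTypeR R)).
  exact: measurable_itv.
have iGxy : lambda.-integrable `[x, y] (EFin \o G i) by exact: integrableS (iG i).
have icst r : lambda.-integrable `[x, y] (EFin \o cst r).
  apply: continuous_compact_integrable; first exact: segment_compact.
  by move=> t; exact: cvg_cst.
have icG : lambda.-integrable `[x, y] (EFin \o (fun t => 2 * c * G i t)).
  exact: (integrableZl mI (2 * c) iGxy).
apply: (@le_trans _ _ (\int[lambda]_(t in `[x, y]) (2 * c * G i t - c ^+ 2)%:E)%E).
  rewrite le_eqVlt; apply/orP; left; apply/eqP.
  have ii : lambda.-integrable `[x, y] (EFin \o (fun t => 2 * c * G i t - c ^+ 2)).
    exact: (integrableB mI icG (icst (c ^+ 2))).
  rewrite -[RHS]fineK; last exact: (integrable_fin_num mI ii).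
  congr EFin; apply: etrans (esym (RintegralB mI icG (icst (c ^+ 2)))).
  rewrite (@RintegralZl _ _ _ _ _ _ (2 * c) mI iGxy).
  rewrite -ftcG//; last exact: ltW.
  have lxy : (lambda `[x, y]%classic = (y - x)%:E)%E.
    by rewrite lebesgue_measure_itv/= lte_fin xy EFinB.
  rewrite -/D Rintegral_cst// [X in fine X](_ : _ = (y - x)%:E)//=.
  by rewrite /c; field; rewrite gt_eqF.
apply: le_integral_ae => //.
  apply/measurable_EFinP; apply: measurable_funB => //.
  by apply: measurable_funM => //; exact: mG.
  exact: mGsq.
apply: aeW => t _; rewrite lee_fin -subr_ge0.
have -> : G i t ^+ 2 - (2 * c * G i t - c ^+ 2) = (G i t - c) ^+ 2 by ring.
exact: sqr_ge0.
Qed.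

Lemma jensen x y : a <= x -> x < y -> y <= b ->
  ((sqnorm (pr y g - pr x g) / (y - x))%:E <=
   \int[lambda]_(t in `[x, y]) (G2 t)%:E)%E.
Proof.
move=> ax xy yb; rewrite /G2.
under eq_integral do rewrite -sumEFin.
rewrite ge0_integral_sum; [|exact: measurable_itv|by move=> i; exact: mGsq|
  by move=> i t _; rewrite lee_fin sqr_ge0].
rewrite /sqnorm mulr_suml -sumEFin; apply: lee_sum => i _.
by rewrite !mxE; exact: jensen_coord.
Qed.

Lemma penergy_le_integral s : itv_partition a b s ->
  ((penergy s g)%:E <= \int[lambda]_(t in `[a, b]) (G2 t)%:E)%E.
Proof.
move=> abs; rewrite /penergy /energy.
suff H k : (k <= size s)%N ->
    ((\sum_(0 <= j < k) sqnorm (pr (node a b s j.+1) g - pr (node a b s j) g) /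
      (node a b s j.+1 - node a b s j))%:E <=
     \int[lambda]_(t in `[a, node a b s k]) (G2 t)%:E)%E.
  by have := H _ (leqnn _); rewrite node_size.
elim: k => [_|k IH ks].
  rewrite big_geq//; apply: integral_ge0 => t _.
  by rewrite lee_fin density_ge0.
rewrite big_nat_recr//= EFinD.
have lt := node_ltS abs ks.
have /andP[ak _] := node_itv abs (ltnW ks).
have /andP[_ kb] := node_itv abs ks.
rewrite (@itv_bndbnd_setU _ _ _ (BRight (node a b s k))); last 2 first.
- by rewrite bnd_simp.
- by rewrite bnd_simp ltW.
rewrite ge0_integral_setU//=; last 3 first.
- exact: measurable_density.
- by move=> t _; rewrite lee_fin density_ge0.
- apply/disj_setPS => t [/=]; rewrite !in_itv/= => /andP[_ tk] /andP[kt _].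
  by rewrite leNgt kt in tk.
rewrite leeD//; first exact: IH (ltnW ks).
rewrite integral_itv_obnd_cbnd; last exact: measurable_density.
exact: jensen.
Qed.

(** The squared speed of the interpolation of [g] on [s], as a step function;
    its intervals are half-open so that no point has two speeds. *)
Let slopes s t : R := \sum_(j < size s)
  sqnorm (slope a b s (fun t => pr t g) j) *
  \1_(`]node a b s j, node a b s j.+1]%classic) t.

Let slopesE s t k : itv_partition a b s -> (k < size s)%N ->
  node a b s k < t <= node a b s k.+1 ->
  slopes s t = sqnorm (slope a b s (fun t => pr t g) k).
Proof.
move=> abs ks /andP[kt tk]; rewrite /slopes (bigD1 (Ordinal ks))//=.
rewrite indicE mem_set ?mulr1; last by rewrite /= in_itv/= kt.
rewrite big1 ?addr0// => j /eqP jk.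
rewrite indicE memNset ?mulr0// => /=; rewrite in_itv/= => /andP[jt tj].
have [lt|lt|e] := ltngtP j k; last by apply: jk; exact: val_inj.
  have := node_le abs lt (ltnW ks); lra.
have := node_le abs lt (ltnW (ltn_ord j)); lra.
Qed.

Let slopes_ge0 s t : 0 <= slopes s t.
Proof.
by apply: sumr_ge0 => j _; rewrite mulr_ge0 ?sqnorm_ge0// indicE.
Qed.

Let mind (A D : set R) : measurable A -> measurable_fun D (fun t => \1_A t : R).
Proof.
by move=> mA; apply: measurable_funTS; exact: measurable_indic.
Qed.

Let mterm (c : R) (A D : set R) : measurable A ->
  measurable_fun D (fun t => c * \1_A t).
Proof.
by move=> mA; apply: measurable_funM => //; exact: mind.
Qed.

Let mslopes s (D : set R) : measurable_fun D (fun t => (slopes s t)%:E).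
Proof.
by apply/measurable_EFinP; apply: measurable_sum => j; exact: mterm.
Qed.

Let integral_slopes s : itv_partition a b s ->
  (\int[lambda]_(t in `[a, b]) (slopes s t)%:E = (penergy s g)%:E)%E.
Proof.
move=> abs; rewrite /slopes.
under eq_integral do rewrite -sumEFin.
rewrite ge0_integral_sum//; last 2 first.
- by move=> j; apply/measurable_EFinP; exact: mterm.
- by move=> j t _; rewrite lee_fin mulr_ge0 ?sqnorm_ge0// indicE.
rewrite /penergy /energy big_mkord -sumEFin; apply: eq_bigr => j _.
under eq_integral do rewrite EFinM.
rewrite ge0_integralZl_EFin; [|exact: measurable_itv|
  by move=> t _; rewrite lee_fin indicE| |exact: sqnorm_ge0]; last first.
  by apply/measurable_EFinP; apply: mind; exact: measurable_itv.
rewrite integral_indic// setIidl; last first.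
  move=> t /=; rewrite !in_itv/= => /andP[? ?].
  have /andP[? _] := node_itv abs (ltnW (ltn_ord j)).
  have /andP[_ ?] := node_itv abs (ltn_ord j).
  by apply/andP; split; lra.
have lt := node_ltS abs (ltn_ord j).
have lj : (lambda `]node a b s j, node a b s j.+1]%classic =
    (node a b s j.+1 - node a b s j)%:E)%E.
  by rewrite lebesgue_measure_itv/= lte_fin lt EFinB.
rewrite [X in (_ * X)%E](_ : _ = (node a b s j.+1 - node a b s j)%:E)//.
rewrite -EFinM /slope sqnormZ.
by congr EFin; field; rewrite subr_eq0 gt_eqF.
Qed.

(** The speeds of the interpolations converge almost everywhere to the speed of
    [g], and Fatou's lemma applies. *)
Lemma integral_le_path_energy T : fine_sequence a b T ->
  (forall N, itv_partition a b (T N)) ->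
  (forall i, {ae lambda, forall t, a < t < b ->
     derivable (fun t => pr t g ord0 i) t 1 /\
     derive1 (fun t => pr t g ord0 i) t = G i t}) ->
  (\int[lambda]_(t in `[a, b]) (G2 t)%:E <= path_energy g)%E.
Proof.
move=> fT pT dG.
have F := @fatou _ _ _ lambda `[a, b]%classic (measurable_itv _)
  (fun N t => (slopes (T N) t)%:E) (fun N => @mslopes (T N) _).
have {}F := F (fun N t _ => slopes_ge0 (T N) t).
have E : (limn_einf (fun N => \int[lambda]_(t in `[a, b]) (slopes (T N) t)%:E) =
    path_energy g)%E.
  under eq_fun do rewrite integral_slopes//.
  by have [-> _] := cvg_limn_einf_sup (@cvg_penergy _ _ _ _ ab T g fT).
rewrite -E; apply: le_trans F.
rewrite le_eqVlt; apply/orP; left; apply/eqP.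
have Hae : {ae lambda, forall t i, a < t < b ->
     derivable (fun t => pr t g ord0 i) t 1 /\
     derive1 (fun t => pr t g ord0 i) t = G i t}.
  apply: filter_forall => i; exact: dG.
have [N [mN N0 HN]] := Hae.
apply: (integral_eq_interior mN N0) => t tab Nt.
have Dt i : derivable (fun t => pr t g ord0 i) t 1 /\
     derive1 (fun t => pr t g ord0 i) t = G i t.
  have := contrapT (fun h => Nt (HN t h)).
  by move=> /(_ i tab).
have loc N' := node_locate_oc (pT N') ab (_ : a < t <= b).
have ex N' : exists k : nat, (k < size (T N'))%N /\
    node a b (T N') k < t <= node a b (T N') k.+1.
  have tab' : a < t <= b by case/andP: tab => -> /ltW.
  by have [k ks tk] := loc tab' N'; exists k.
have {ex loc}[k Hk] := choice ex.
symmetry.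
have C : (slopes (T N') t)%:E @[N' --> \oo] --> (G2 t)%:E.
  apply: cvg_EFin; first exact: nearW.
  have -> : (fine \o (fun N' => (slopes (T N') t)%:E)) = (fun N' =>
      \sum_i (slope a b (T N') (fun t => pr t g) (k N') ord0 i) ^+ 2).
    by apply/funext => N' /=; have [ks tk] := Hk N'; rewrite (slopesE (pT N') ks tk).
  apply: cvg_sum_ord => i.
  apply: (@cvg_comp _ _ _ (fun N' => slope a b (T N') (fun t => pr t g) (k N')
    ord0 i) (fun r : R => r ^+ 2) _ (nbhs (G i t))); last exact: exprn_continuous.
  apply/cvgrPdist_le => e e0.
  have [d1 d2] := Dt i.
  have [d d0 Hd] := derivable_slope d1 d2 e0.
  near=> N'.
  have [ks /andP[kt tk]] := Hk N'.
  have mN' : mesh_lt a b d (T N') by near: N'; exact: fT.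
  rewrite distrC /slope !mxE mulrC; apply: Hd => //; first exact: ltW.
    exact: node_ltS.
  exact: mN'.2.
by have [-> _] := cvg_limn_einf_sup C.
Unshelve. all: by end_near. Qed.

Lemma integral_density T : fine_sequence a b T ->
  (forall N, itv_partition a b (T N)) ->
  (forall i, {ae lambda, forall t, a < t < b ->
     derivable (fun t => pr t g ord0 i) t 1 /\
     derive1 (fun t => pr t g ord0 i) t = G i t}) ->
  (\int[lambda]_(t in `[a, b]) (G2 t)%:E = path_energy g)%E.
Proof.
move=> fT pT dG; apply/eqP; rewrite eq_le (integral_le_path_energy fT)//=.
by apply: ge_ereal_sup => _ [s /= abs <-]; exact: penergy_le_integral.
Qed.

End density.

End energy_of_density.

Section action_formula.
Variables (R : realType) (n : nat) (m : R) (V : 'rV[R]_n -> R) (a b : R).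
Hypotheses (ab : a < b) (m0 : 0 < m) (cV : continuous V).
Variable T : nat -> seq R.
Hypotheses (fT : fine_sequence a b T) (pT : forall N, itv_partition a b (T N)).
Local Notation lambda := (@lebesgue_measure R).

Definition potential (g : paths n a b) : R :=
  \int[lambda]_(t in `[a, b]) V (pr t g).

Lemma potential_integrable (g : paths n a b) :
  lambda.-integrable `[a, b] (fun t => (V (pr t g))%:E).
Proof.
suff H : lambda.-integrable `[a, b] (EFin \o (fun t => V (pr (clamp a b t) g))).
  apply: eq_integrable H => //.
  by move=> t; rewrite inE/= in_itv/= => tab; rewrite clamp_id.
apply: continuous_compact_integrable; first exact: segment_compact.
apply: continuous_subspaceT => t.
apply: (@continuous_comp _ _ _ (fun t => pr (clamp a b t) g) V); last exact: cV.
exact: (path_continuous (ltW ab)).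
Qed.

(** For absolutely continuous [g] this is [integral_density]. Otherwise the
    energy is infinite by
    [finite_energy_ac], and both sides are +oo. *)
Lemma actionE (g : paths n a b) :
  action m V g = ((m / 2)%:E * path_energy g - (potential g)%:E)%E.
Proof.
rewrite /action; case: asboolP => [acg|nac].
  have mab : measurable (`[a, b]%classic : set (measurableTypeR R)).
    exact: measurable_itv.
  have iN : lambda.-integrable `[a, b] (fun t => - (V (pr t g))%:E)%E.
    exact: (integrableN (potential_integrable g)).
  have [G HG] := choice (fun i => ac_ftc ab (ac_coord i acg)).
  have iG i : lambda.-integrable setT (EFin \o G i) by case: (HG i).
  have ftcG i x y : a <= x -> x <= y -> y <= b ->
      pr y g ord0 i - pr x g ord0 i = \int[lambda]_(t in `[x, y]) G i t.
    by case: (HG i) => _ + _; exact.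
  have dG i : {ae lambda, forall t, a < t < b ->
         derivable (fun t => pr t g ord0 i) t 1 /\
         derive1 (fun t => pr t g ord0 i) t = G i t} by case: (HG i).
  have Hae : {ae lambda, forall t i, a < t < b ->
       derivable (fun t => pr t g ord0 i) t 1 /\
       derive1 (fun t => pr t g ord0 i) t = G i t}.
    apply: filter_forall => i; exact: dG.
  have [N [mN N0 HN]] := Hae.
  rewrite (@integral_eq_interior R a b N _ (fun t => (m / 2)%:E *
    (\sum_i G i t ^+ 2)%:E + - (V (pr t g))%:E)%E mN N0); last first.
    move=> t tab Nt.
    have Dt i : derivable (fun t => pr t g ord0 i) t 1 /\
         derive1 (fun t => pr t g ord0 i) t = G i t.
      have := contrapT (fun h => Nt (HN t h)).
      by move=> /(_ i tab).
    rewrite /lagrangian -EFinM -EFinB; congr (_ * _ - _)%:E.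
    apply: eq_bigr => i _; congr (_ ^+ 2).
    have dq : derivable (fun t => pr t g) t 1.
      by apply/derivable_mxP => i' j; rewrite (ord1 i'); case: (Dt j).
    by rewrite derive1E derive_mx// mxE -derive1E; case: (Dt i).
  rewrite integralD_ge0_integrable//.
  - rewrite ge0_integralZl_EFin//.
    + rewrite (integral_density ab iG ftcG fT pT dG); congr (_ + _)%E.
      rewrite /potential /Rintegral -EFinN -[LHS]fineK; last first.
        exact: (integrable_fin_num mab iN).
      congr EFin; rewrite -fineN; congr fine.
      rewrite integralN// fin_num_adde_defl// fin_numN.
      exact: (integrable_neg_fin_num mab (potential_integrable g)).
    + by move=> t _; rewrite lee_fin; exact: density_ge0.
    + exact: measurable_density.
    + by rewrite divr_ge0// ltW.
  - by apply: emeasurable_funM => //; exact: measurable_density.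
  - move=> t _; rewrite -EFinM lee_fin mulr_ge0 ?divr_ge0 ?density_ge0//.
    exact: ltW.
have -> : path_energy g = +oo%E.
  apply/eqP; rewrite -leye_eq leNgt; apply/negP => fin.
  apply: nac; apply: (finite_energy_ac (M := fine (path_energy g)) ab fT).
  rewrite fineK// ge0_fin_numE//; exact: path_energy_ge0.
by rewrite mulry gtr0_sg ?divr_gt0// mul1e addye.
Qed.

End action_formula.

Arguments potential {R n} V {a b} g.

(** * The discrete action *)

Section riemann_sums.
Variables (R : realType) (a b : R).
Local Notation lambda := (@lebesgue_measure R).

Lemma Rintegral_close (x y : R) (f g : R -> R) (e : R) : x <= y ->
  lambda.-integrable `[x, y] (EFin \o f) ->
  lambda.-integrable `[x, y] (EFin \o g) ->
  (forall t, x <= t <= y -> `|f t - g t| <= e) ->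
  `|\int[lambda]_(t in `[x, y]) f t - \int[lambda]_(t in `[x, y]) g t|
     <= e * (y - x).
Proof.
move=> xy fi gi fg.
have mI : measurable (`[x, y]%classic : set (measurableTypeR R)).
  exact: measurable_itv.
have ci (r : R) : lambda.-integrable `[x, y] (EFin \o cst r).
  apply: continuous_compact_integrable; first exact: segment_compact.
  by move=> t; exact: cvg_cst.
have lxy : (lambda `[x, y]%classic = (y - x)%:E)%E.
  rewrite lebesgue_measure_itv/= lte_fin.
  by move: xy; rewrite le_eqVlt => /predU1P[->|->]; rewrite ?ltxx ?subrr// EFinB.
have Hc r : \int[lambda]_(t in `[x, y]) (cst r) t = r * (y - x).
  by rewrite Rintegral_cst// [X in fine X](_ : _ = (y - x)%:E).
have H (u v : R -> R) : lambda.-integrable `[x, y] (EFin \o u) ->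
    lambda.-integrable `[x, y] (EFin \o v) ->
    (forall t, x <= t <= y -> u t - v t <= e) ->
    \int[lambda]_(t in `[x, y]) u t - \int[lambda]_(t in `[x, y]) v t <= e * (y - x).
  move=> iu iv uv.
  have iuv : lambda.-integrable `[x, y] (EFin \o (u \- v)) by exact: (integrableB mI iu iv).
  rewrite -(Hc e) -(RintegralB mI iu iv); apply: (le_Rintegral mI iuv (ci e)).
  by move=> t; rewrite /= in_itv/=; exact: uv.
have h1 := H f g fi gi (fun t tab => le_trans (ler_norm _) (fg t tab)).
have h2 : \int[lambda]_(t in `[x, y]) g t - \int[lambda]_(t in `[x, y]) f t <= e * (y - x).
  apply: H => // t tab; apply: le_trans (fg t tab).
  by rewrite distrC; exact: ler_norm.
by rewrite ler_norml h1 andbT lerNl opprB.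
Qed.

Lemma riemann_close s (c : nat -> R) (f : R -> R) (e : R) :
  itv_partition a b s -> lambda.-integrable `[a, b] (EFin \o f) ->
  (forall j t, (j < size s)%N -> node a b s j <= t <= node a b s j.+1 ->
     `|c j - f t| <= e) ->
  `|\sum_(0 <= j < size s) c j * (node a b s j.+1 - node a b s j) -
    \int[lambda]_(t in `[a, b]) f t| <= e * (b - a).
Proof.
move=> abs fi H.
suff K k : (k <= size s)%N ->
  `|\sum_(0 <= j < k) c j * (node a b s j.+1 - node a b s j) -
    \int[lambda]_(t in `[a, node a b s k]) f t| <= e * (node a b s k - a).
  by have := K _ (leqnn _); rewrite node_size.
elim: k => [_|k IH ks].
  by rewrite big_geq// set_itv1 Rintegral_set1 subrr normr0 subrr mulr0.
rewrite big_nat_recr//=.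
set u := node a b s k in IH *; set v := node a b s k.+1.
have uv : u < v := node_ltS abs ks.
have /andP[au ub] := node_itv abs (ltnW ks); rewrite -/u in au ub.
have /andP[av vb] := node_itv abs ks; rewrite -/v in av vb.
have iav : lambda.-integrable `[a, v] (EFin \o f).
  apply: integrableS fi => //; apply: subset_itvl; by rewrite bnd_simp.
have iuv : lambda.-integrable `[u, v] (EFin \o f).
  apply: integrableS fi => // t /=; rewrite !in_itv/= => /andP[? ?].
  by apply/andP; split; lra.
have iuv' : lambda.-integrable `]u, v] (EFin \o f).
  apply: integrableS iuv => // t /=; rewrite !in_itv/= => /andP[? ?].
  by apply/andP; split; lra.
have E : \int[lambda]_(t in `[a, v]) f t =
    \int[lambda]_(t in `[a, u]) f t + \int[lambda]_(t in `[u, v]) f t.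
  have := @Rintegral_itvB _ f (BLeft a) (BRight v) u iav.
  rewrite !bnd_simp => /(_ au (ltW uv)).
  by rewrite (Rintegral_itv_obnd_cbnd iuv'); lra.
have iuc : lambda.-integrable `[u, v] (EFin \o cst (c k)).
  apply: continuous_compact_integrable; first exact: segment_compact.
  by move=> t; exact: cvg_cst.
have Hc : \int[lambda]_(t in `[u, v]) (cst (c k)) t = c k * (v - u).
  have lxy : (lambda `[u, v]%classic = (v - u)%:E)%E.
    by rewrite lebesgue_measure_itv/= lte_fin uv EFinB.
  by rewrite Rintegral_cst//= [X in fine X](_ : _ = (v - u)%:E).
have := Rintegral_close (ltW uv) iuc iuv (fun t tuv => H k t ks tuv).
have := IH (ltnW ks).
rewrite Hc E; set S := \sum_(_ <= _ < _) _.
set I1 := Rintegral _ _ _; set I2 := Rintegral _ _ _ => h1 h2.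
have -> : S + c k * (v - u) - (I1 + I2) = (S - I1) + (c k * (v - u) - I2) by ring.
rewrite (le_trans (ler_normD _ _))//.
have -> : e * (v - a) = e * (u - a) + e * (v - u) by ring.
exact: lerD.
Qed.

End riemann_sums.

Section discrete.
Variables (R : realType) (n : nat) (m c2 : R) (V : 'rV[R]_n -> R) (a b : R).
Hypotheses (ab : a < b) (m0 : 0 < m) (c20 : 0 < c2) (cV : continuous V).
Hypothesis growth : forall z, `|V z| <= c2 * (1 + sqnorm z).
Implicit Types (s : seq R) (g : paths n a b).
Local Notation nd s j := (node a b s j).
Local Notation lambda := (@lebesgue_measure R).

Definition midpoint s g j : 'rV[R]_n :=
  2^-1 *: (pr (nd s j.+1) g + pr (nd s j) g).

(** The midpoint sums are defined for every path; the discrete action is their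
    combination with the energy on the piecewise affine paths. *)
Definition dpotential s g : R :=
  \sum_(0 <= j < size s) V (midpoint s g j) * (nd s j.+1 - nd s j).

Definition daction s g : R := m / 2 * penergy s g - dpotential s g.

Lemma discrete_actionE s g : discrete_action m V s g =
  if `[< piecewise_affine s g >] then (daction s g)%:E else +oo%E.
Proof.
rewrite /discrete_action; case: ifP => // _; congr EFin.
by rewrite /daction /penergy /energy /dpotential mulr_sumr -sumrB.
Qed.

Lemma piecewise_affineP s g : itv_partition a b s ->
  piecewise_affine s g <-> path_interp s g = g.
Proof.
move=> abs; split=> [pa|<- j js].
  apply: pathsP => t tab; rewrite /path_interp pr_mk_path//.
  have [k ks tk] := node_locate abs ab tab.
  rewrite (interp_in abs _ ks tk); have [c [v Hcv]] := pa k ks.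
  have lt := node_ltS abs ks.
  rewrite /slope (Hcv _ tk) Hcv ?lexx ?ltW// Hcv ?lexx ?ltW//.
  rewrite opprD addrACA subrr add0r -scalerBl !scalerA divfK; last first.
    by rewrite subr_eq0 gt_eqF.
  by rewrite -addrA -scalerDl [X in X *: v]addrC subrK.
exists (pr (nd s j) g - nd s j *: slope a b s (fun t => pr t g) j),
  (slope a b s (fun t => pr t g) j) => t tj.
have /andP[aj _] := node_itv abs (ltnW js).
have /andP[_ jb] := node_itv abs js.
case/andP: (tj) => jt tj1.
rewrite pr_mk_path; last by apply/andP; split; lra.
by rewrite (interp_in abs _ js tj) scalerBl -addrA; congr (_ + _); rewrite addrC.
Qed.

Lemma node_bound s g j r : itv_partition a b s -> (j <= size s)%N ->
  sqnorm (pr a g) <= r ->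
  sqnorm (pr (nd s j) g) <= 2 * r + 2 * ((b - a) * penergy s g).
Proof.
move=> abs js gr.
have := node_lip abs (fun t => pr t g) ab (leq0n j) js.
rewrite node0 => h.
have -> : pr (nd s j) g = pr a g + (pr (nd s j) g - pr a g) by rewrite addrC subrK.
rewrite (le_trans (sqnormD_le _ _))// lerD//; first by rewrite ler_wpM2l.
rewrite ler_wpM2l// (le_trans h)// ler_wpM2r ?penergy_ge0//.
by rewrite lerB//; have /andP[] := node_itv abs js.
Qed.

Lemma midpoint_bound s g j r : itv_partition a b s -> (j < size s)%N ->
  sqnorm (pr a g) <= r ->
  sqnorm (midpoint s g j) <= 2 * r + 2 * ((b - a) * penergy s g).
Proof.
move=> abs js gr; rewrite /midpoint sqnormZ.
have h1 := node_bound abs js gr.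
have h2 := node_bound abs (ltnW js) gr.
have := sqnormD_le (pr (nd s j.+1) g) (pr (nd s j) g).
rewrite expr2; lra.
Qed.

Lemma sum_dt_le s (f : nat -> R) (M : R) : itv_partition a b s ->
  (forall j, (j < size s)%N -> `|f j| <= M) ->
  `|\sum_(0 <= j < size s) f j * (nd s j.+1 - nd s j)| <= M * (b - a).
Proof.
move=> abs H; rewrite (le_trans (ler_norm_sum _ _ _))//.
have <- : \sum_(0 <= j < size s) (nd s j.+1 - nd s j) = b - a.
  exact: (node_telescope id).
rewrite mulr_sumr big_nat [leRHS]big_nat; apply: ler_sum => j /andP[_ js].
have d0 : 0 <= nd s j.+1 - nd s j by rewrite subr_ge0 ltW// node_ltS.
by rewrite normrM (ger0_norm d0) ler_wpM2r// H.
Qed.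

Lemma dpotential_bound s g r : itv_partition a b s -> sqnorm (pr a g) <= r ->
  `|dpotential s g| <=
    c2 * (1 + (2 * r + 2 * ((b - a) * penergy s g))) * (b - a).
Proof.
move=> abs gr; apply: sum_dt_le => // j js.
rewrite (le_trans (growth _))// ler_wpM2l ?(ltW c20)// lerD2l.
exact: midpoint_bound.
Qed.

(** For bounded [V] the potential is bounded. Otherwise, by [node_lip], the
    squared distance of the nodes from the starting point is at most (b - a) times
    the energy, so that the potential is at most a constant plus
    2 * c2 * (b - a) ^+ 2 times the energy; the bound on [b - a] makes this factor
    at most m / 16. *)
Lemma daction_coercive r :
  bounded_fun V \/ b - a <= Num.sqrt (m / (32 * c2)) ->
  exists2 C : R, 0 <= C & forall s g, itv_partition a b s ->
    sqnorm (pr a g) <= r -> m / 4 * penergy s g - C <= daction s g.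
Proof.
case=> [[M [_ HM]]|small].
  pose B := Num.max 0 (M + 1).
  have B0 : 0 <= B by rewrite le_max lexx.
  have VB z : `|V z| <= B.
    by rewrite le_max (HM (M + 1)) ?orbT// ltrDl.
  exists (B * (b - a)); first by rewrite mulr_ge0// subr_ge0 ltW.
  move=> s g abs gr; have Q0 := penergy_ge0 g abs.
  have : `|dpotential s g| <= B * (b - a) by apply: sum_dt_le.
  move=> /(le_trans (ler_norm _)) h; rewrite /daction.
  have : 0 <= m * penergy s g by rewrite mulr_ge0// ltW.
  lra.
have sm : c2 * (b - a) ^+ 2 <= m / 32.
  have : (b - a) ^+ 2 <= m / (32 * c2).
    rewrite -[leRHS]sqr_sqrtr; last first.
      by apply: divr_ge0; [exact: ltW|apply: mulr_ge0 => //; exact: ltW].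
    by rewrite lerXn2r ?nnegrE ?subr_ge0 ?sqrtr_ge0// ltW.
  rewrite -(ler_pM2l c20) => /le_trans; apply.
  by rewrite le_eqVlt; apply/orP; left; apply/eqP; field; rewrite gt_eqF.
exists (Num.max 0 (c2 * (1 + 2 * r) * (b - a))); first by rewrite le_max lexx.
move=> s g abs gr; have Q0 := penergy_ge0 g abs.
have := dpotential_bound abs gr => /(le_trans (ler_norm _)) h.
rewrite /daction; set Q := penergy s g in Q0 h *.
have : c2 * (b - a) ^+ 2 * Q <= m / 32 * Q by rewrite ler_wpM2r.
have : c2 * (1 + 2 * r) * (b - a) <= Num.max 0 (c2 * (1 + 2 * r) * (b - a)).
  by rewrite le_max lexx orbT.
have : c2 * (1 + (2 * r + 2 * ((b - a) * Q))) * (b - a) =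
  c2 * (1 + 2 * r) * (b - a) + 2 * (c2 * (b - a) ^+ 2 * Q) by ring.
have : 0 <= m * Q by rewrite mulr_ge0// ltW.
lra.
Qed.

Lemma midpoint_close s g j z (e : R) :
  `|pr (nd s j.+1) g - z| < e -> `|pr (nd s j) g - z| < e ->
  `|midpoint s g j - z| < e.
Proof.
move=> h1 h2; rewrite /midpoint.
have -> : 2^-1 *: (pr (nd s j.+1) g + pr (nd s j) g) - z =
    2^-1 *: ((pr (nd s j.+1) g - z) + (pr (nd s j) g - z)).
  rewrite addrACA -opprD scalerBr; congr (_ - _).
  by rewrite -(mulr2n z) -(scaler_nat 2 z) scalerA mulVf ?scale1r.
rewrite normrZ ger0_norm//.
have := ler_normD (pr (nd s j.+1) g - z) (pr (nd s j) g - z); lra.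
Qed.

(** Only the values at the nodes enter the midpoint sum, so [g] is compared with
    [g0] there and nowhere else. *)
Lemma dpotential_close g0 (e : R) : 0 < e -> exists d eta : R,
  [/\ 0 < d, 0 < eta & forall s g, mesh_lt a b d s ->
   (forall j, (j <= size s)%N -> `|pr (nd s j) g - pr (nd s j) g0| < eta) ->
   `|dpotential s g - potential V g0| <= e].
Proof.
move=> e0; have e'0 : 0 < e / (b - a) by rewrite divr_gt0// subr_gt0.
have [d1 d10 H1] := path_near_unif (ltW ab) g0 cV e'0.
have d20 : 0 < d1 / 2 by rewrite divr_gt0.
have [d2 d2p H2] := path_unif_continuous (ltW ab) g0 d20.
exists d2, (d1 / 2); split => // s g [abs sd] Hg.
have -> : e = e / (b - a) * (b - a) by rewrite divfK// subr_eq0 gt_eqF.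
apply: (riemann_close (c := fun j => V (midpoint s g j)) (f := fun t => V (pr t g0))) => //.
  exact: potential_integrable.
move=> j t js tj.
have jab := node_itv abs (ltnW js); have j1ab := node_itv abs js.
have tab : a <= t <= b.
  by move: jab j1ab tj => /andP[? ?] /andP[? ?] /andP[? ?]; apply/andP; split; lra.
have lt := node_ltS abs js; have ltd := sd j js.
rewrite distrC ltW// H1// distrC; apply: midpoint_close.
  have -> : pr (nd s j.+1) g - pr t g0 = (pr (nd s j.+1) g - pr (nd s j.+1) g0) +
    (pr (nd s j.+1) g0 - pr t g0) by rewrite subrKA.
  rewrite (le_lt_trans (ler_normD _ _))// [d1]splitr ltrD ?Hg// H2//.
  by case/andP: tj => ? ?; rewrite ger0_norm; lra.
have -> : pr (nd s j) g - pr t g0 = (pr (nd s j) g - pr (nd s j) g0) +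
  (pr (nd s j) g0 - pr t g0) by rewrite subrKA.
rewrite (le_lt_trans (ler_normD _ _))// [d1]splitr ltrD ?Hg//; first exact: ltnW.
by rewrite H2//; case/andP: tj => ? ?; rewrite ler0_norm; lra.
Qed.

(** Paths of energy at most [M] are equicontinuous, of Hoelder exponent 1 / 2,
    and stay in a fixed ball, on which [V] is uniformly continuous. *)
Lemma dpotential_close_unif (r M e : R) : 0 <= r -> 0 <= M -> 0 < e ->
  exists2 d : R, 0 < d & forall s g, mesh_lt a b d s ->
   piecewise_affine s g -> sqnorm (pr a g) <= r -> penergy s g <= M ->
   `|dpotential s g - potential V g| <= e.
Proof.
move=> r0 M0 e0; have e'0 : 0 < e / (b - a) by rewrite divr_gt0// subr_gt0.
pose rho := 1 + (2 * r + 2 * ((b - a) * M)).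
have rho1 : 1 <= rho.
  by rewrite lerDl addr_ge0 ?mulr_ge0// subr_ge0 ltW.
have rho0 : 0 <= rho by rewrite (le_trans _ rho1).
have [d1 d10 H1] := heine_cantor (@compact_norm_le R n rho) (fun x _ => @cV x) e'0.
have dp : 0 < (d1 / 2) ^+ 2 / (M + 1) by rewrite divr_gt0 ?exprn_gt0 ?divr_gt0//; lra.
exists ((d1 / 2) ^+ 2 / (M + 1)) => // s g [abs sd] pa gr gM.
have gI : path_interp s g = g by apply/piecewise_affineP.
have prI t : a <= t <= b -> pr t g = interp a b s (fun t => pr t g) t.
  by move=> tab; rewrite -{1}gI /path_interp pr_mk_path.
have lip x y : a <= x -> x <= y -> y <= b ->
    sqnorm (pr y g - pr x g) <= (y - x) * M.
  move=> ax xy yb; rewrite !prI; [|by apply/andP; split; lra..].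
  apply: (le_trans (interp_lip abs _ ab ax xy yb)).
  rewrite ler_wpM2l ?subr_ge0//.
  have c1 := cum_energy_homo a b s (fun t => pr t g) yb.
  have c2' := cum_energy_homo a b s (fun t => pr t g) ax.
  have c3 := cum_energyb abs (fun t => pr t g); rewrite -/(penergy s g) in c3.
  lra.
have -> : e = e / (b - a) * (b - a) by rewrite divfK// subr_eq0 gt_eqF.
apply: (riemann_close (c := fun j => V (midpoint s g j)) (f := fun t => V (pr t g))) => //.
  exact: potential_integrable.
move=> j t js tj.
have /andP[jab jab'] := node_itv abs (ltnW js).
have /andP[j1ab j1ab'] := node_itv abs js.
case/andP: tj => jt tj1.
have lt := node_ltS abs js; have ltd := sd j js.
have close x y : nd s j <= x -> x <= y -> y <= nd s j.+1 -> `|pr y g - pr x g| < d1.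
  move=> jx xy yj; rewrite (@le_lt_trans _ _ (d1 / 2))//; last by lra.
  apply: norm_sqnorm; first by rewrite divr_ge0// ltW.
  apply: (le_trans (lip x y _ xy _)); [lra|lra|].
  apply: (@le_trans _ _ ((d1 / 2) ^+ 2 / (M + 1) * (M + 1))).
    by apply: ler_pM; lra.
  by rewrite divfK// gt_eqF//; lra.
have := H1 (pr t g) (midpoint s g j); rewrite -!ball_normE/= => H.
rewrite distrC ltW// H//.
  apply: norm_sqnorm => //.
  have -> : pr t g = pr a g + (pr t g - pr a g) by rewrite addrC subrK.
  rewrite (le_trans (sqnormD_le _ _))//.
  have := lip a t (lexx _) (le_trans jab jt) (le_trans tj1 j1ab').
  have : (t - a) * M <= (b - a) * M by rewrite ler_wpM2r// lerB//; exact: le_trans tj1 _.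
  have : rho <= rho ^+ 2 by rewrite expr2 ler_peMl.
  rewrite /rho in rho1 *; lra.
rewrite distrC; apply: midpoint_close; first exact: close.
by rewrite distrC; apply: close.
Qed.

Lemma continuous_potential : continuous (potential V : paths n a b -> R).
Proof.
move=> g; apply/continuous_pathsP => e e0.
have e'0 : 0 < e / 2 / (b - a) by rewrite !divr_gt0// subr_gt0.
have [d d0 H] := path_near_unif (ltW ab) g cV e'0.
exists d => // g' Hg'; rewrite /ball/= /potential.
apply: (@le_lt_trans _ _ (e / 2 / (b - a) * (b - a))); last first.
  by rewrite divfK ?subr_eq0 ?gt_eqF//; lra.
apply: (Rintegral_close (ltW ab)).
- exact: potential_integrable.
- exact: potential_integrable.
- by move=> t tab; rewrite ltW// H// Hg'.
Qed.

Lemma continuous_midpoint s j : itv_partition a b s -> (j < size s)%N ->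
  continuous (fun g => midpoint s g j).
Proof.
move=> abs js g; rewrite /midpoint.
have h1 := node_itv abs (ltnW js); have h2 := node_itv abs js.
apply: (@cvgZl_tmp _ _ _ (nbhs g) (nbhs_filter g)).
apply: (@cvgD _ _ _ (nbhs g) (nbhs_filter g)).
  exact: (continuous_pr h2).
exact: (continuous_pr h1).
Qed.

Lemma continuous_dpotential s : itv_partition a b s -> continuous (dpotential s).
Proof.
move=> abs.
rewrite (_ : dpotential s = fun g => \sum_(j < size s)
    V (midpoint s g j) * (nd s j.+1 - nd s j)); last first.
  by apply/funext => g; rewrite /dpotential big_mkord.
move=> g; apply: (cvg_sum_ord (nbhs_filter g)) => j.
apply: cvgMr_tmp.
apply: (@continuous_comp _ _ _ (fun g => midpoint s g j) V); last exact: cV.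
exact: continuous_midpoint.
Qed.

Lemma continuous_daction s : itv_partition a b s -> continuous (daction s).
Proof.
move=> abs g; apply: (@cvgB _ _ _ (nbhs g) (nbhs_filter g)).
  by apply: cvgMl_tmp; exact: continuous_penergy.
exact: continuous_dpotential.
Qed.

End discrete.

(** * Borel sets, weak limits and lower limits *)

Section borel_measurability.
Variables (R : realType).

Lemma open_borel (X : ptopologicalType) (A : set X) :
  open A -> measurable (A : set (borel X)).
Proof. by move=> oA; exact: sub_sigma_algebra. Qed.

Lemma continuous_measurable_borel (X Y : ptopologicalType) (f : X -> Y) :
  continuous f -> measurable_fun [set: borel X] (f : borel X -> borel Y).
Proof.
move=> cf _ B mB; rewrite setTI.
suff H : <<s @open Y >> `<=` [set B | measurable (f @^-1` B : set (borel X))].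
  exact: H.
apply: smallest_sub; last first.
  by move=> U oU; apply: open_borel; apply: open_comp => // x _; exact: cf.
split => [|U mU|F mF] /=.
- by rewrite preimage_set0.
- by rewrite setTD preimage_setC; exact: measurableC.
- by rewrite preimage_bigcup; exact: bigcupT_measurable.
Qed.

Lemma continuous_measurable_real (X : ptopologicalType) (f : X -> R) :
  continuous f -> measurable_fun [set: borel X] (f : borel X -> R).
Proof.
move=> cf; apply: (measurability _ (RGenOInfty.measurableE R)).
move=> _ [_ [x ->] <-]; rewrite setTI; apply: open_borel.
apply: open_comp => [y _|]; first exact: cf.
by rewrite set_itvE; exact: open_gt.
Qed.

Lemma continuous_measurable_EFin (X : ptopologicalType) (f : X -> R) :
  continuous f -> measurable_fun [set: borel X] (fun x : borel X => (f x)%:E).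
Proof. by move=> cf; apply/measurable_EFinP; exact: continuous_measurable_real. Qed.

Lemma bounded_integrable (X : ptopologicalType) (f : X -> R) (M : R)
  (mu : {measure set (borel X) -> \bar R}) : continuous f ->
  (mu setT < +oo)%E -> (forall x, `|f x| <= M) ->
  mu.-integrable setT (fun x : borel X => (f x)%:E).
Proof.
move=> cf fin bf; apply: measurable_bounded_integrable => //.
  exact: continuous_measurable_real.
exists M; split; first exact: num_real.
by move=> x Mx y _; rewrite /= (le_trans (bf y))// ltW.
Qed.

Lemma measurableC_compact n (K : set 'rV[R]_n) :
  compact K -> measurable (~` K : set (borel 'rV[R]_n)).
Proof.
move=> cK; apply: open_borel; apply: closed_openC; apply: compact_closed cK.
exact: (@norm_hausdorff R 'rV[R]_n).
Qed.

Lemma probability_lty d (T : measurableType d) (P : probability T R) :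
  (P setT < +oo)%E.
Proof. by rewrite [X in (X < _)%E](_ : _ = 1%E) ?ltry//; exact: probability_setT. Qed.

End borel_measurability.

Section measure_determined.
Variables (R : realType) (n : nat).
Local Notation X := 'rV[R]_n.

Let dset (U : set X) (x : X) : set R := [set `|x - y| | y in ~` U].

Let dist (U : set X) (x : X) : R := inf (dset U x).

Lemma dist_lip (U : set X) (x y : X) : (~` U) !=set0 ->
  dist U x <= dist U y + `|x - y|.
Proof.
move=> [z0 Uz0]; rewrite -lerBlDr; apply: lb_le_inf; first by exists `|y - z0|, z0.
move=> _ [z Uz <-]; rewrite lerBlDr (@le_trans _ _ `|x - z|)//.
  by apply: ge_inf; [exists 0 => _ [w _ <-]|exists z].
by rewrite [leRHS]addrC -(subrKA y) ler_normD.
Qed.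

Lemma dist_out (U : set X) (x : X) : ~ U x -> dist U x = 0.
Proof.
move=> Ux; apply/eqP; rewrite eq_le; apply/andP; split.
  by apply: ge_inf; [exists 0 => _ [w _ <-]|exists x => //; rewrite subrr normr0].
by apply: lb_le_inf; [exists `|x - x|, x|move=> _ [z _ <-]].
Qed.

Lemma dist_gt0 (U : set X) (x : X) : open U -> (~` U) !=set0 -> U x -> 0 < dist U x.
Proof.
move=> oU [z0 Uz0] Ux.
have /nbhs_ballP[e /= e0 He] := open_nbhs_nbhs (conj oU Ux).
apply: (lt_le_trans e0); apply: lb_le_inf; first by exists `|x - z0|, z0.
move=> _ [z Uz <-]; rewrite leNgt; apply/negP => xz; apply: Uz.
by apply: He; rewrite -ball_normE.
Qed.

(** The indicator of an open set is the limit of the functions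
    [min 1 (k * dist U x)], where [dist U x] is the distance from x to the
    complement of the set, and the open sets generate the Borel sets. *)
Lemma measure_determined (mu nu : {measure set (borel X) -> \bar R}) :
  mu setT = 1%E -> nu setT = 1%E ->
  (forall f : X -> R, continuous f -> bounded_fun f ->
    (\int[mu]_x (f x)%:E = \int[nu]_x (f x)%:E)%E) ->
  forall A : set (borel X), measurable A -> mu A = nu A.
Proof.
move=> mu1 nu1 H A mA.
apply: (@g_sigma_algebra_measure_unique _ R (borel X) (@open X) _ (fun=> setT)) => //.
- by move=> U oU; exact: open_borel.
- by move=> _; exact: openT.
- by apply/seteqP; split => // x _; exists 0%N.
- by move=> U W oU oW; exact: openI.
- move=> U oU.
  have [U0|/set0P nU] := eqVneq (~` U) set0.
    by rewrite -(setCK U) U0 setC0 mu1 nu1.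
  pose f (k : nat) (x : X) : R := Num.min 1 (k%:R * dist U x).
  have d0 x : 0 <= dist U x.
    have [Ux|Ux] := pselect (U x); first exact/ltW/dist_gt0.
    by rewrite dist_out.
  have f01 k x : 0 <= f k x <= 1.
    by rewrite /f le_min ler01 mulr_ge0//= ge_min lexx.
  have cdist : continuous (dist U).
    move=> x W /nbhs_ballP[e /= e0 He]; apply/nbhs_ballP; exists e => //= y.
    rewrite -ball_normE /= => xy; apply: He; rewrite /ball /=.
    apply: le_lt_trans xy.
    rewrite ler_norml; apply/andP; split.
      by have := dist_lip y x nU; rewrite distrC; lra.
    by have := dist_lip x y nU; lra.
  have cf k : continuous (f k).
    move=> x; apply: (@continuous_min _ _ (fun=> 1) (fun x => k%:R * dist U x)).
      exact: cst_continuous.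
    apply: (@cvgMl_tmp _ _ _ (nbhs_filter x)); exact: cdist.
  have lim (la : {measure set (borel X) -> \bar R}) : la setT = 1%E ->
      (\int[la]_x (f k x)%:E)%E @[k --> \oo] --> la U.
    move=> la1.
    have mU : measurable (U : set (borel X)) by exact: open_borel.
    have [| | | | |_ _] := @dominated_convergence _ _ _ la setT measurableT
      (fun k x => (f k x)%:E) (fun x => (\1_U x)%:E) (cst 1%E).
    - by move=> k; exact: continuous_measurable_EFin.
    - by apply/measurable_EFinP; exact: measurable_indic.
    - apply: aeW => x _; apply: cvg_EFin; first exact: nearW.
      apply: (@cvg_near_cst _ (R : topologicalType)).
      have [Ux|Ux] := pselect (U x); rewrite indicE.
        rewrite mem_set//.
        have dx := dist_gt0 oU nU Ux.
        near=> k; rewrite /= /f; apply/min_idPl.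
        rewrite -ler_pdivrMr//; near: k; exact: nbhs_infty_ger.
      by rewrite memNset//; apply: nearW => k /=; rewrite /f dist_out// mulr0 min_r.
    - have := @bounded_integrable R X (fun=> 1) 1 la; apply.
      + exact: cst_continuous.
      + by rewrite la1 ltry.
      + by move=> x; rewrite normr1.
    - apply: aeW => x k _; rewrite lee_fin.
      by have /andP[f0 f1] := f01 k x; rewrite ger0_norm.
    by rewrite integral_indic// setIT.
  have e : (fun k => \int[mu]_x (f k x)%:E)%E = (fun k => \int[nu]_x (f k x)%:E)%E.
    apply/funext => k; apply: H => //; exists 1; split; first exact: num_real.
    move=> M M1 x _; have /andP[f0 f1] := f01 k x.
    by rewrite /= ger0_norm// (le_trans f1)// ltW.
  have l1 := lim mu mu1; have l2 := lim nu nu1; rewrite e in l1.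
  exact: cvg_unique l1 l2.
- by rewrite mu1 ltry.
Unshelve. all: by end_near. Qed.

End measure_determined.

Section limits.
Variable R : realType.

Lemma limn_einf_ge (u : nat -> \bar R) (x : \bar R) :
  (\forall N \near \oo, (x <= u N)%E) -> (x <= limn_einf u)%E.
Proof.
move=> [N0 _ H]; rewrite limn_einf_lim; apply: lime_ge.
  exact: is_cvg_einfs.
exists N0 => // N /= N0N; rewrite /einfs /=; apply: le_ereal_inf_tmp.
by move=> _ [k /= Nk <-]; apply: H => /=; exact: leq_trans Nk.
Qed.

Lemma frequently_subseq (P : nat -> Prop) :
  (forall N, exists2 k, (N <= k)%N & P k) ->
  exists phi : nat -> nat, (forall N, P (phi N)) /\ phi N @[N --> \oo] --> \oo.
Proof.
move=> H; have ex N : exists k, (N <= k)%N /\ P k by have [k] := H N; exists k.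
have [phi Hphi] := choice ex; exists phi; split; first by move=> N; case: (Hphi N).
move=> A [N0 _ HA]; exists N0 => // N /= N0N; apply: HA => /=.
by apply: leq_trans N0N _; case: (Hphi N).
Qed.

End limits.

(** * Measurability of the actions, and continuous minorants *)

Section path_measurability.
Variables (R : realType) (n : nat) (m : R) (V : 'rV[R]_n -> R) (a b : R).
Hypotheses (ab : a < b) (m0 : 0 < m) (cV : continuous V).
Implicit Types (s : seq R) (g : paths n a b).
Local Notation PS := (borel (paths n a b)).

Lemma measurable_pr t : a <= t <= b ->
  measurable_fun [set: PS] (pr t : PS -> borel 'rV[R]_n).
Proof. by move=> tab; apply: continuous_measurable_borel; exact: continuous_pr. Qed.

Lemma measurable_path_energy T : fine_sequence a b T ->
  (forall N, itv_partition a b (T N)) ->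
  measurable_fun [set: PS] (fun g : PS => path_energy g).
Proof.
move=> fT pT.
apply: (@emeasurable_fun_cvg _ _ _ _ (fun N (g : PS) => (penergy (T N) g)%:E)).
  by move=> N; apply: continuous_measurable_EFin; exact: continuous_penergy.
by move=> g _; exact: cvg_penergy.
Qed.

Lemma measurable_potential :
  measurable_fun [set: PS] (fun g : PS => (potential V g)%:E).
Proof. by apply: continuous_measurable_EFin; exact: continuous_potential. Qed.

Lemma measurable_action T : fine_sequence a b T ->
  (forall N, itv_partition a b (T N)) ->
  measurable_fun [set: PS] (fun g : PS => action m V g).
Proof.
move=> fT pT; rewrite (_ : (fun g : PS => _) =
    (fun g : PS => (m / 2)%:E * path_energy g - (potential V g)%:E)%E).
  apply: emeasurable_funB; last exact: measurable_potential.
  by apply: emeasurable_funM => //; exact: measurable_path_energy fT pT.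
by apply/funext => g; rewrite (actionE ab m0 cV fT pT).
Qed.

(** A path is piecewise affine when it agrees with its interpolation at every
    time; for each time this is a closed condition. *)
Lemma measurable_piecewise_affine s : itv_partition a b s ->
  measurable ([set g | piecewise_affine s g] : set PS).
Proof.
move=> abs; rewrite -[X in measurable X]setCK; apply: measurableC.
pose D t (g : paths n a b) : R := `|pr t (path_interp s g) - pr t g|.
have -> : ~` [set g | piecewise_affine s g] =
    \bigcup_(t in `[a, b]%classic) [set g | 0 < D t g].
  apply/seteqP; split=> g /=.
    move=> npa; apply: contrapT => H; apply: npa; apply/piecewise_affineP => //.
    apply: pathsP => t tab; apply/eqP; rewrite -subr_eq0 -normr_le0 leNgt.
    by apply/negP => Dt; apply: H; exists t => //=; rewrite in_itv.
  move=> [t /= tab] Dt; rewrite piecewise_affineP// => gI.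
  by move: Dt; rewrite /D gI subrr normr0 ltxx.
apply: open_borel; apply: bigcup_open => t /=; rewrite in_itv/= => tab.
apply: (@open_comp _ _ (D t) [set x | 0 < x]); last exact: open_gt.
move=> g _; rewrite /D.
rewrite (_ : (fun _ => _) = fun g : paths n a b =>
    `|(pr a g + \sum_(0 <= j < size s) ramp a b s j t *:
       ((node a b s j.+1 - node a b s j)^-1 *:
        (pr (node a b s j.+1) g - pr (node a b s j) g))) - pr t g|); last first.
  by apply/funext => g'; rewrite /path_interp pr_mk_path.
have cpr u : a <= u <= b -> pr u h @[h --> g] --> pr u g.
  by move=> uab; exact: continuous_pr.
have aab : a <= a <= b by rewrite lexx ltW.
apply: (@cvg_norm _ _ _ (nbhs g) (nbhs_filter g)).
apply: (@cvgB _ _ _ (nbhs g) (nbhs_filter g)); last exact: cpr.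
apply: (@cvgD _ _ _ (nbhs g) (nbhs_filter g)); first exact: cpr.
have : forall j, (j < size s)%N -> a <= node a b s j <= b /\ a <= node a b s j.+1 <= b.
  by move=> j js; split; apply: node_itv => //; exact: ltnW.
elim: (size s) => [|k IH] Hk.
  rewrite (_ : (fun _ => _) = cst 0); last by apply/funext => g'; rewrite big_geq.
  by rewrite big_geq//; exact: cst_continuous.
rewrite (_ : (fun _ => _) = fun g : paths n a b =>
  \sum_(0 <= j < k) ramp a b s j t *:
       ((node a b s j.+1 - node a b s j)^-1 *:
        (pr (node a b s j.+1) g - pr (node a b s j) g)) + ramp a b s k t *:
       ((node a b s k.+1 - node a b s k)^-1 *:
        (pr (node a b s k.+1) g - pr (node a b s k) g))); last first.
  by apply/funext => g'; rewrite big_nat_recr.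
rewrite big_nat_recr//=; apply: (@cvgD _ _ _ (nbhs g) (nbhs_filter g)).
  by apply: IH => j jk; apply: Hk; exact: ltnW.
have [h1 h2] := Hk k (ltnSn k).
apply: (@cvgZl_tmp _ _ _ (nbhs g) (nbhs_filter g)).
apply: (@cvgZl_tmp _ _ _ (nbhs g) (nbhs_filter g)).
by apply: (@cvgB _ _ _ (nbhs g) (nbhs_filter g)); exact: cpr.
Qed.

Lemma measurable_discrete_action s : itv_partition a b s ->
  measurable_fun [set: PS] (fun g : PS => discrete_action m V s g).
Proof.
move=> abs; rewrite (_ : (fun g : PS => _) = (fun g : PS =>
    if `[< piecewise_affine s g >] then (daction m V s g)%:E else +oo%E)); last first.
  by apply/funext => g; rewrite discrete_actionE.
apply: measurable_fun_ifT => //.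
  apply: (measurable_fun_bool true); rewrite setTI.
  rewrite (_ : _ @^-1` _ = [set g | piecewise_affine s g]).
    exact: measurable_piecewise_affine.
  by apply/seteqP; split => g /= /asboolP.
by apply: continuous_measurable_EFin; exact: continuous_daction.
Qed.

End path_measurability.

Section lower_bound.
Variables (R : realType) (n : nat) (m c2 : R) (V : 'rV[R]_n -> R) (a b : R).
Hypotheses (ab : a < b) (m0 : 0 < m) (c20 : 0 < c2) (cV : continuous V).
Hypothesis growth : forall z, `|V z| <= c2 * (1 + sqnorm z).
Hypothesis small : bounded_fun V \/ b - a <= Num.sqrt (m / (32 * c2)).
Variable T : nat -> seq R.
Hypotheses (fT : fine_sequence a b T) (pT : forall N, itv_partition a b (T N)).
Variable T' : nat -> seq R.
Hypothesis fT' : fine_sequence a b T'.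
Implicit Types (g : paths n a b).
Local Notation PS := (borel (paths n a b)).

(** Bounded and continuous, unlike the action, which it approaches from below
    up to the truncation at [- C]. *)
Definition minorant (C : R) (k : nat) g : R :=
  Num.max (- C) (Num.min k%:R (m / 2 * penergy (T k) g - potential V g)).

Lemma continuous_minorant C k : continuous (minorant C k).
Proof.
move=> g; apply: (@continuous_max _ _ (fun=> - C)
  (fun g => Num.min k%:R (m / 2 * penergy (T k) g - potential V g))).
  exact: cst_continuous.
apply: (@continuous_min _ _ (fun=> k%:R)
  (fun g => m / 2 * penergy (T k) g - potential V g)).
  exact: cst_continuous.
apply: (@cvgB _ _ _ (nbhs g) (nbhs_filter g)).
  apply: (@cvgMl_tmp _ _ _ (nbhs_filter g)); exact: continuous_penergy.
exact: continuous_potential.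
Qed.

Lemma minorant_bound C k g : 0 <= C -> `|minorant C k g| <= C + k%:R.
Proof.
move=> C0; have k0 : 0 <= k%:R :> R by [].
rewrite /minorant ler_norml le_max ge_max ge_min; apply/andP; split.
  by apply/orP; left; lra.
by apply/andP; split; [lra|apply/orP; left; lra].
Qed.

(** If the energy of [g] is large, coercivity alone puts the discrete action
    above k; otherwise its potential is uniformly close to that of [g], and the
    energy of the piecewise affine path [g] on [T k] is at most that on [T' N]. *)
Lemma minorant_le (C r e : R) (k : nat) : 0 <= C -> 0 <= r ->
  (forall s g, itv_partition a b s -> sqnorm (pr a g) <= r ->
     m / 4 * penergy s g - C <= daction m V s g) -> 0 < e ->
  \forall N \near \oo, forall g, sqnorm (pr a g) <= r ->
    ((minorant C k g - e)%:E <= discrete_action m V (T' N) g)%E.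
Proof.
move=> C0 r0 coer e0.
pose M := (k%:R + C) * (4 / m).
have M0 : 0 <= M by rewrite mulr_ge0 ?addr_ge0// divr_ge0// ltW.
have [d d0 Hd] := dpotential_close_unif ab cV r0 M0 e0.
apply: filterS (fT' d0) => N mN g gr.
rewrite discrete_actionE; case: asboolP => [pa|_]; last by rewrite leey.
rewrite lee_fin.
have Q0 := penergy_ge0 g mN.1.
have c := coer _ g mN.1 gr.
have mQ0 : 0 <= m * penergy (T' N) g by rewrite mulr_ge0// ltW.
have k0 : 0 <= k%:R :> R by [].
have [QM|MQ] := leP (penergy (T' N) g) M; last first.
  have h : k%:R + C <= m / 4 * penergy (T' N) g.
    rewrite mulrC -ler_pdivrMr ?divr_gt0//.
    by rewrite invf_div ltW.
  rewrite lerBlDr /minorant ge_max ge_min.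
  by apply/andP; split; [lra|apply/orP; left; lra].
have cl := Hd _ _ mN pa gr QM.
have gI : path_interp (T' N) g = g by apply/piecewise_affineP => //; exact: mN.1.
have le : penergy (T k) g <= penergy (T' N) g.
  by rewrite -{1}gI; apply: penergy_path_interp => //; exact: mN.1.
have le' : m / 2 * penergy (T k) g <= m / 2 * penergy (T' N) g.
  by rewrite ler_wpM2l// divr_ge0// ltW.
move: cl; rewrite ler_norml => /andP[cl1 cl2].
rewrite /daction in c *.
rewrite lerBlDr /minorant ge_max ge_min.
by apply/andP; split; [lra|apply/orP; right; lra].
Qed.

Lemma minorant_cvg C g :
  ((minorant C k g + C)%:E @[k --> \oo] --> maxe (action m V g + C%:E) 0)%E.
Proof.
rewrite (actionE ab m0 cV fT pT).
have Ek := @cvg_penergy _ _ _ _ ab T g fT.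
have E0 := path_energy_ge0 ab g.
case: (path_energy g) E0 Ek => [r| |] //= r0 Ek.
  have Ek' : penergy (T k) g @[k --> \oo] --> r.
    by have /fine_cvgP[_ h] := Ek; exact: h.
  pose A := m / 2 * r - potential V g.
  have -> : maxe ((m / 2)%:E * r%:E - (potential V g)%:E + C%:E)%E 0%E =
      (Num.max (- C) A + C)%:E.
    rewrite -EFinM -EFinB -EFinD -EFin_max; congr EFin.
    by rewrite addr_maxl addNr maxC.
  apply: cvg_EFin; first exact: nearW.
  apply: cvgD; last exact: cvg_cst.
  have cA : (m / 2 * penergy (T k) g - potential V g) @[k --> \oo] --> A.
    by apply: cvgB; [exact: cvgMl_tmp|exact: cvg_cst].
  apply: (@cvg_trans _ ((Num.max (- C) (m / 2 * penergy (T k) g - potential V g))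
      @[k --> \oo])).
    apply: near_eq_cvg; near=> k; rewrite /= /minorant min_r//.
    apply: (@le_trans _ _ (A + 1)).
      by near: k; move/cvgr_le : cA; apply; rewrite ltrDl.
    by near: k; exact: nbhs_infty_ger.
  apply: (@cvg_comp _ _ _ (fun k => m / 2 * penergy (T k) g - potential V g)
    (fun x => Num.max (- C) x) _ (nbhs A)) => //.
  apply: (@continuous_max _ _ (fun=> - C) id); first exact: cst_continuous.
  exact: cvg_id.
have -> : maxe ((m / 2)%:E * +oo - (potential V g)%:E + C%:E)%E 0%E = +oo%E.
  by rewrite mulry gtr0_sg ?divr_gt0// mul1e addye//.
apply/cvgeyPge => A.
have QN : \forall k \near \oo, (A - C + potential V g) * (2 / m) <= penergy (T k) g.
  move/cvgeyPge : Ek => /(_ ((A - C + potential V g) * (2 / m))).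
  by apply: filterS => k; rewrite lee_fin.
near=> k; rewrite lee_fin.
have Ak : (A - C <= k%:R) by near: k; exact: nbhs_infty_ger.
have Qk : (A - C + potential V g) * (2 / m) <= penergy (T k) g by near: k; exact: QN.
have : A - C + potential V g <= m / 2 * penergy (T k) g.
  by rewrite mulrC -ler_pdivrMr ?divr_gt0// invf_div.
move=> h; rewrite -lerBlDr /minorant le_max le_min.
by apply/orP; right; apply/andP; split => //; lra.
Unshelve. all: by end_near. Qed.

End lower_bound.

(** * The lower bound *)

Section pushforward_facts.
Context d d' (T1 : measurableType d) (T2 : measurableType d') (R : realType).
Variables (mu : {measure set T1 -> \bar R}) (f : T1 -> T2).
Hypothesis mf : measurable_fun [set: T1] f.

Definition pushforward_measure : {measure set T2 -> \bar R}.
Proof. by refine (pushforward mu f : {measure set T2 -> \bar R}); exact: mf. Defined.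

Lemma pushforward_measureE A : pushforward_measure A = pushforward mu f A.
Proof. by []. Qed.

End pushforward_facts.

Lemma integral_constant d (T : measurableType d) (R : realType)
  (P : probability T R) (c : R) : (\int[P]_x c%:E = c%:E)%E.
Proof.
have -> := integral_cst P measurableT c%:E.
by rewrite [X in (_ * X)%E](_ : _ = 1%E) ?mule1//; exact: probability_setT.
Qed.

Section marginals.
Variables (R : realType) (n : nat) (a b : R).
Local Notation X := 'rV[R]_n.
Local Notation PS := (borel (paths n a b)).

Definition has_marginal (t : R) (pi : {measure set PS -> \bar R})
    (nu : {measure set (borel X) -> \bar R}) := forall B : set (borel X),
  measurable B -> pushforward pi (pr t : PS -> borel X) B = nu B.

Lemma integral_marginal t (pi : {measure set PS -> \bar R}) nu (f : X -> R) :
  a <= t <= b -> has_marginal t pi nu -> continuous f -> bounded_fun f ->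
  (nu setT < +oo)%E ->
  (\int[pi]_g (f (pr t g))%:E = \int[nu]_x (f x)%:E)%E.
Proof.
move=> tab hm cf [M [_ HM]] fin.
have bf z : `|f z| <= M + 1 by apply: HM => //; rewrite ltrDl.
have mp := @measurable_pr R n a b t tab.
have -> : (\int[nu]_x (f x)%:E = \int[pushforward_measure pi mp]_x (f x)%:E)%E.
  by apply: eq_measure_integral => B mB _; rewrite -(hm B mB).
rewrite /pushforward_measure (@integral_pushforward _ _ _ _ _ _ mp)//.
  exact: continuous_measurable_EFin.
rewrite preimage_setT; apply: (@bounded_integrable _ _ _ (M + 1) pi).
- by move=> g; apply: (@continuous_comp _ _ _ (pr t) f); [exact: continuous_pr|exact: cf].
- by have := hm setT measurableT; rewrite /pushforward preimage_setT => ->.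
- by move=> g; exact: bf.
Qed.

(** Along a subsequence on which the marginals are prescribed, integrals of
    bounded continuous functions converge both to those of the marginal of [pi]
    and to those of [nu], and such integrals determine the measure. *)
Lemma marginal_limit t (pi_ : nat -> {measure set PS -> \bar R})
    (pi : {measure set PS -> \bar R})
    (nu_ : nat -> {measure set (borel X) -> \bar R})
    (nu : {measure set (borel X) -> \bar R}) : a <= t <= b ->
  weak_cvg pi_ pi -> weak_cvg nu_ nu -> pi setT = 1%E -> nu setT = 1%E ->
  (forall N, pi_ N setT = 1%E) ->
  (forall N, exists2 k, (N <= k)%N & has_marginal t (pi_ k) (nu_ k)) ->
  has_marginal t pi nu.
Proof.
move=> tab wpi wnu pi1 nu1 pi_1 /frequently_subseq[phi [Hphi phioo]].
have mp := @measurable_pr R n a b t tab.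
move=> B mB; rewrite -(pushforward_measureE pi mp).
apply: measure_determined => //.
move=> f cf bf.
have bfp : bounded_fun (fun g : paths n a b => f (pr t g)).
  case: bf => M [Mr HM]; exists M; split => // x Mx g _.
  exact: HM.
have cfp : continuous (fun g : paths n a b => f (pr t g)).
  by move=> g; apply: (@continuous_comp _ _ _ (pr t) f); [exact: continuous_pr|exact: cf].
have l1 := wpi _ cfp bfp; have l2 := wnu _ cf bf.
have l1' := cvg_comp _ _ phioo l1; have l2' := cvg_comp _ _ phioo l2.
have e : ((fun N => (\int[pi_ N]_g (f (pr t g))%:E)%E) \o phi) =
    ((fun N => (\int[nu_ N]_x (f x)%:E)%E) \o phi).
  apply/funext => N /=; apply: integral_marginal => //.
  have := Hphi N setT measurableT; rewrite /pushforward preimage_setT => <-.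
  by rewrite pi_1 ltry.
rewrite e in l1'.
have <- := cvg_unique (@ereal_hausdorff R) l1' l2'.
symmetry; apply: integral_marginal => //; first last.
  have -> : pushforward_measure pi mp setT = pi setT by [].
  by rewrite pi1 ltry.
Qed.

End marginals.

Section liminf_inequality.
Variables (R : realType) (n : nat) (m c2 : R) (V : 'rV[R]_n -> R) (a b : R).
Hypotheses (ab : a < b) (m0 : 0 < m) (c20 : 0 < c2) (cV : continuous V).
Hypothesis growth : forall z, `|V z| <= c2 * (1 + sqnorm z).
Hypothesis small : bounded_fun V \/ b - a <= Num.sqrt (m / (32 * c2)).
Variable T : nat -> seq R.
Hypotheses (fT : fine_sequence a b T) (pT : forall N, itv_partition a b (T N)).
Variable T' : nat -> seq R.
Hypothesis fT' : fine_sequence a b T'.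
Local Notation X := 'rV[R]_n.
Local Notation PS := (borel (paths n a b)).

Variables (nu_a nu_b : nat -> {measure set (borel X) -> \bar R}).
Variables (mu_a mu_b : {measure set (borel X) -> \bar R}).
Hypotheses (mua1 : mu_a setT = 1%E) (mub1 : mu_b setT = 1%E).
Hypotheses (wa : weak_cvg nu_a mu_a) (wb : weak_cvg nu_b mu_b).
Hypothesis supp : exists2 K : set X, compact K &
  forall N, (0 < N)%N -> nu_a N (~` K) = 0%E.

Let aab : a <= a <= b. Proof. by rewrite lexx ltW. Qed.
Let bab : a <= b <= b. Proof. by rewrite lexx ltW. Qed.

Variables (pi_ : nat -> probability PS R) (pi : probability PS R).
Hypothesis wpi : weak_cvg (fun N => pi_ N) pi.

Let A_N N := constrained_mean (discrete_action m V (T' N)) (nu_a N) (nu_b N) (pi_ N).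

(** If the constraints fail in the limit, they fail eventually, and both sides
    are +oo. Otherwise the mean of [minorant k] under [pi] is a lower bound for
    every k, and Fatou's lemma lets k tend to infinity. *)
Lemma lower_bound_constrained : (constrained_mean (action m V) mu_a mu_b pi <= limn_einf A_N)%E.
Proof.
have [K cK HK] := supp.
have [r r0 Hr] := compact_sqnorm_bounded cK.
have [C C0 coer] := daction_coercive ab m0 c20 growth r small.
pose phi k (g : paths n a b) := minorant m V T C k g.
have cphi k : continuous (phi k) by exact: continuous_minorant.
have bphi k g : `|phi k g| <= C + k%:R by exact: minorant_bound.
have iphi k (P : probability PS R) : P.-integrable setT (fun g : PS => (phi k g)%:E).
  apply: (bounded_integrable (cphi k) _ (bphi k)).
  exact: probability_lty.
pose ok N := has_marginal a (pi_ N) (nu_a N) /\ has_marginal b (pi_ N) (nu_b N).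
have A_N_oo N : ~ ok N -> A_N N = +oo%E.
  move=> nok; rewrite /A_N /constrained_mean; case: asboolP => // H.
  by case: nok; split => B mB; have [] := H B mB.
have A_N_ok N : ok N -> A_N N = (\int[pi_ N]_g discrete_action m V (T' N) g)%E.
  move=> [oka okb]; rewrite /A_N /constrained_mean; case: asboolP => // -[].
  by move=> B mB; split; [exact: oka|exact: okb].
have lower k e : 0 < e -> \forall N \near \oo,
    (\int[pi_ N]_g (phi k g)%:E - e%:E <= A_N N)%E.
  move=> e0; have mle := minorant_le ab m0 cV pT fT' k C0 r0 coer e0.
  near=> N.
  have mleN : forall g, sqnorm (pr a g) <= r ->
      ((phi k g - e)%:E <= discrete_action m V (T' N) g)%E by near: N; exact: mle.
  have [okN|nok] := pselect (ok N); last by rewrite A_N_oo ?leey.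
  rewrite A_N_ok//.
  have mN : mesh_lt a b 1 (T' N) by near: N; exact: fT'.
  have N0 : (0 < N)%N by near: N; exact: nbhs_infty_gt.
  have -> : (\int[pi_ N]_g (phi k g)%:E - e%:E = \int[pi_ N]_g (phi k g - e)%:E)%E.
    rewrite (@integralB_EFin _ _ _ (pi_ N) setT (phi k) (cst e) measurableT)//.
      by rewrite integral_constant.
      exact: iphi.
    exact: finite_measure_integrable_cst.
  apply: le_integral_ae => //.
  - apply: continuous_measurable_EFin => g.
    apply: (@cvgB _ _ _ (nbhs g) (nbhs_filter g)); first exact: cphi.
    exact: cst_continuous.
  - exact: measurable_discrete_action mN.1.
  - have mK : measurable (~` K : set (borel X)).
      exact: measurableC_compact.
    have mp := @measurable_pr R n a b a aab.
    exists (pr a @^-1` (~` K)); split.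
    + by rewrite -[X in measurable X]setTI; exact: mp.
    + by rewrite -(HK N N0); exact: okN.1.
    + move=> g /= ng Kg; apply: ng => _.
      by apply: mleN; exact: Hr.
have phile k : (\int[pi]_g (phi k g)%:E <= limn_einf A_N)%E.
  have fin : (\int[pi]_g (phi k g)%:E)%E \is a fin_num by apply: integrable_fin_num => //; exact: iphi.
  apply/lee_addgt0Pr => e e0; rewrite -leeBlDr//.
  apply: limn_einf_ge.
  have bnd : bounded_fun (phi k).
    by exists (C + k%:R); split => [|M CM g _]; [exact: num_real|
      rewrite /= (le_trans (bphi k g))// ltW].
  have cv := wpi (cphi k) bnd.
  have e20 : 0 < e / 2 by rewrite divr_gt0.
  have near2 : \forall N \near \oo,
     (\int[pi]_g (phi k g)%:E - (e / 2)%:E < \int[pi_ N]_g (phi k g)%:E)%E.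
    move: cv; rewrite -(fineK fin) => /fine_cvgP[fN cv].
    have := cv => /cvgr_gt/(_ (fine (\int[pi]_g (phi k g)%:E)%E - e / 2)).
    rewrite ltrBlDr ltrDl e20 => /(_ isT) H.
    apply: filterS2 fN H => N f1 f2.
    by rewrite -EFinB -(fineK f1) lte_fin.
  apply: filterS2 near2 (lower k _ e20) => N h1 h2.
  apply: le_trans h2; rewrite leeBrDr//; apply: le_trans (ltW h1).
  rewrite -(fineK fin) -!EFinB -EFinD lee_fin; lra.
case: (pselect (has_marginal a pi mu_a /\ has_marginal b pi mu_b)) => [[ma mb]|nm]; last first.
  rewrite [leLHS](_ : _ = +oo%E); last first.
    rewrite /constrained_mean; case: asboolP => // H; exfalso; apply: nm.
    by split => B mB; have [] := H B mB.
  apply: limn_einf_ge.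
  have [N0 HN0] : exists N0, forall N, (N0 <= N)%N -> ~ ok N.
    apply: contrapT => H; apply: nm.
    have fr N : exists2 k, (N <= k)%N & ok k.
      apply: contrapT => H'; apply: H; exists N => k Nk okk; apply: H'; by exists k.
    split.
      apply: (marginal_limit aab wpi wa) => //; [exact: probability_setT|
        by move=> N; exact: probability_setT|].
      by move=> N; have [k Nk [oka _]] := fr N; exists k.
    apply: (marginal_limit bab wpi wb) => //; [exact: probability_setT|
      by move=> N; exact: probability_setT|].
    by move=> N; have [k Nk [_ okb]] := fr N; exists k.
  by exists N0 => // N /= NN; rewrite A_N_oo//; exact: HN0.
have -> : constrained_mean (action m V) mu_a mu_b pi = (\int[pi]_g action m V g)%E.
  rewrite /constrained_mean; case: asboolP => // -[].
  by move=> B mB; split; [exact: ma|exact: mb].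
have mact := measurable_action ab m0 cV fT pT.
pose F (g : PS) := maxe (action m V g + C%:E)%E 0%E.
have mF : measurable_fun setT F.
  apply: measurable_maxe; last exact: measurable_cst.
  by apply: emeasurable_funD => //; exact: measurable_cst.
have F0 g : (0 <= F g)%E by rewrite /F le_max lexx orbT.
have FL : (\int[pi]_g F g <= limn_einf A_N + C%:E)%E.
  have Fl g : F g = limn_einf (fun k => (phi k g + C)%:E).
    have /cvg_limn_einf_sup[-> _//] :
      (minorant m V T C k g + C)%:E @[k --> \oo] --> F g.
    exact: (minorant_cvg ab m0 cV fT pT).
  have -> : (\int[pi]_g F g =
      \int[pi]_g limn_einf (fun k => (phi k g + C)%:E))%E.
    by apply: eq_integral => g _; exact: Fl.
  apply: (le_trans (@fatou _ _ _ pi setT measurableT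
    (fun k (g : PS) => (phi k g + C)%:E) _ _)).
  - move=> k; apply: continuous_measurable_EFin => g.
    apply: (@cvgD _ _ _ (nbhs g) (nbhs_filter g)); first exact: cphi.
    exact: cst_continuous.
  - move=> k g _; rewrite lee_fin /phi /minorant -lerBlDr sub0r le_max lexx//.
  have E k : (\int[pi]_g (phi k g + C)%:E = \int[pi]_g (phi k g)%:E + C%:E)%E.
    rewrite (@integralD_EFin _ _ _ pi setT measurableT (phi k) (cst C))//.
      by rewrite integral_constant.
      exact: iphi.
    exact: finite_measure_integrable_cst.
  rewrite limn_einf_lim; apply: lime_le; first exact: is_cvg_einfs.
  apply: nearW => k; apply: ge_ereal_inf; exists (\int[pi]_g (phi k g + C)%:E)%E.
    by exists k => //=.
  by rewrite E leeD2r.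
have Ci : pi.-integrable setT (fun g : PS => (- C)%:E).
  exact: finite_measure_integrable_cst.
apply: (@le_trans _ _ (\int[pi]_g (F g + (- C)%:E))%E).
  apply: le_integral_ae => //.
    by apply: emeasurable_funD => //; exact: measurable_cst.
  apply: aeW => g _; rewrite EFinN leeBrDr// /F le_max lexx//.
rewrite integralD_ge0_integrable//.
rewrite integral_constant EFinN leeBlDr//.
Unshelve. all: by end_near. Qed.

End liminf_inequality.

(** * Continuous weights concentrated near sample points *)

Lemma continuous_sum_seq (R : realType) n (s : seq 'rV[R]_n)
    (f : 'rV[R]_n -> 'rV[R]_n -> R) : (forall z, continuous (f z)) ->
  continuous (fun x => \sum_(z <- s) f z x).
Proof.
move=> cf x; elim: s => [|z s IH].
  rewrite (_ : (fun _ => _) = fun=> 0); first exact: cst_continuous.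
  by apply/funext => y; rewrite big_nil.
rewrite (_ : (fun _ => _) = (fun y => f z y + \sum_(z' <- s) f z' y)).
  by apply: (@cvgD _ _ _ (nbhs x) (nbhs_filter x)) => //; exact: cf.
by apply/funext => y; rewrite big_cons.
Qed.

Section bumps.
Variables (R : realType) (n : nat) (rho : R).
Hypothesis rho0 : 0 < rho.
Local Notation X := 'rV[R]_n.

Definition hat (z x : X) : R := Num.max 0 (2 - 2 * (`|x - z| / rho)).

(** The maximum with 1 keeps the quotients continuous everywhere; they add up to
    1 where the sum of the hats is at least 1. *)
Definition bump (zs : seq X) (z x : X) : R :=
  hat z x / Num.max 1 (\sum_(z' <- zs) hat z' x).

Lemma hat_ge0 z x : 0 <= hat z x.
Proof. by rewrite /hat le_max lexx. Qed.

Lemma hat_near z x : hat z x != 0 -> `|x - z| < rho.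
Proof.
apply: contraNT; rewrite -leNgt => h; rewrite /hat; apply/eqP/max_l.
have : 1 <= `|x - z| / rho by rewrite ler_pdivlMr ?mul1r.
lra.
Qed.

Lemma hat_ge1 z x : `|x - z| < rho / 2 -> 1 <= hat z x.
Proof.
move=> h; rewrite /hat le_max; apply/orP; right.
have : `|x - z| / rho < 2^-1 by rewrite ltr_pdivrMr// mulrC.
lra.
Qed.

Lemma continuous_hat z : continuous (hat z).
Proof.
move=> x; apply: (@continuous_max R X (fun=> 0) (fun x => 2 - 2 * (`|x - z| / rho)) x).
  exact: cst_continuous.
apply: (@cvgB _ _ _ (nbhs x) (nbhs_filter x)); first exact: cst_continuous.
apply: (@cvgMl_tmp _ _ _ (nbhs_filter x)).
apply: (@cvgMr_tmp _ _ _ (nbhs_filter x)).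
apply: (@cvg_norm _ _ _ (nbhs x) (nbhs_filter x)).
apply: (@cvgB _ _ _ (nbhs x) (nbhs_filter x)); first exact: cvg_id.
exact: cst_continuous.
Qed.

Let den_gt0 zs x : 0 < Num.max 1 (\sum_(z' <- zs) hat z' x).
Proof. by rewrite lt_max ltr01. Qed.

Lemma bump_ge0 zs z x : 0 <= bump zs z x.
Proof. by rewrite /bump divr_ge0 ?hat_ge0// ltW. Qed.

Lemma bump_near zs z x : bump zs z x != 0 -> `|x - z| < rho.
Proof. by move=> h; apply: hat_near; apply: contraNneq h => h; rewrite /bump h mul0r. Qed.

Lemma sum_bump_le1 zs x : \sum_(z <- zs) bump zs z x <= 1.
Proof. by rewrite -mulr_suml ler_pdivrMr// mul1r le_max lexx orbT. Qed.

Lemma bump_le1 zs z x : z \in zs -> bump zs z x <= 1.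
Proof.
move=> zzs; apply: le_trans (sum_bump_le1 zs x).
rewrite (big_rem z)//= lerDl; apply: sumr_ge0 => z' _; exact: bump_ge0.
Qed.

Lemma sum_bump1 zs x : (exists2 z, z \in zs & `|x - z| < rho / 2) ->
  \sum_(z <- zs) bump zs z x = 1.
Proof.
move=> [z zzs xz]; have h : 1 <= \sum_(z' <- zs) hat z' x.
  rewrite (big_rem z)//= (le_trans (hat_ge1 xz))// lerDl.
  by apply: sumr_ge0 => z' _; exact: hat_ge0.
by rewrite -mulr_suml max_r// divff// gt_eqF// (lt_le_trans ltr01).
Qed.

Lemma continuous_bump zs z : continuous (bump zs z).
Proof.
move=> x; apply: (@cvgM _ _ (nbhs x) (nbhs_filter x)); first exact: continuous_hat.
apply: (@cvgV _ _ (nbhs x) (nbhs_filter x)); first by rewrite gt_eqF.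
apply: (@continuous_max _ _ (fun=> 1) (fun x => \sum_(z' <- zs) hat z' x)).
  exact: cst_continuous.
by apply: continuous_sum_seq => z'; exact: continuous_hat.
Qed.

Lemma finite_net (K : set X) : compact K ->
  exists zs : seq X, forall x, K x -> exists2 z, z \in zs & `|x - z| < rho / 2.
Proof.
rewrite compact_cover => cK.
have [|x Kx|D _ HD] := cK X setT (fun z => [set x | `|x - z| < rho / 2]).
- move=> z _; rewrite (_ : [set x | _] = ball z (rho / 2)).
    by apply: ball_open; rewrite divr_gt0.
  by apply/seteqP; split => x /=; rewrite -ball_normE /= distrC.
- by exists x => //=; rewrite subrr normr0 divr_gt0.
by exists (finmap.enum_fset D) => x /HD[z zD xz]; exists z.
Qed.

End bumps.

Section weights.
Variables (R : realType) (n : nat).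
Local Notation X := 'rV[R]_n.
Local Notation BX := (borel X).

Lemma integral_empirical N (x : nat -> X) (f : X -> R) : continuous f ->
  (forall z, 0 <= f z) ->
  (\int[empirical N x]_z (f z)%:E = (N%:R^-1 * \sum_(i < N) f (x i))%:E)%E.
Proof.
move=> cf f0; have mf := continuous_measurable_EFin cf.
have -> := ge0_integral_mscale (msum (fun i => \d_(x i : borel 'rV[R]_n)) N)
  measurableT (N%:R^-1)%:nng mf (fun z _ => f0 z).
rewrite /= ge0_integral_measure_sum//.
rewrite EFinM -sumEFin; congr (_ * _)%E; apply: eq_bigr => i _.
by rewrite integral_dirac// diracT mul1e.
by move=> z _; rewrite lee_fin.
Qed.

Variables (mu : probability BX R) (K : set X).
Hypotheses (cK : compact K) (muK : mu (~` K) = 0%E).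

Lemma integral_affine_bumps (rho : R) zs ws (A : X -> R) (D : R) : 0 < rho ->
  {subset ws <= zs} ->
  (\int[mu]_x (\sum_(z <- ws) A z * bump rho zs z x + D)%:E =
   (\sum_(z <- ws) A z * fine (\int[mu]_x (bump rho zs z x)%:E) + D)%:E)%E.
Proof.
move=> rho0; elim: ws => [|z ws IH] ss.
  by under eq_integral do rewrite big_nil add0r; rewrite big_nil add0r integral_constant.
have ss' : {subset ws <= zs} by move=> y yws; apply: ss; rewrite inE yws orbT.
have cb z' : continuous (bump rho zs z') by exact: continuous_bump.
have fin : (mu setT < +oo)%E.
  exact: probability_lty.
have ib z' : z' \in zs -> mu.-integrable setT (EFin \o bump rho zs z').
  move=> zz; apply: (bounded_integrable (cb z') fin (M := 1)) => x.
  by rewrite ger0_norm ?bump_ge0// bump_le1.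
have zzs : z \in zs by apply: ss; rewrite inE eqxx.
have isum : mu.-integrable setT
    (fun x : BX => (\sum_(z <- ws) A z * bump rho zs z x + D)%:E).
  elim: (ws) ss' => [_|y l IHl ssl].
    by under eq_fun do rewrite big_nil add0r; exact: finite_measure_integrable_cst.
  under eq_fun do rewrite big_cons -addrA EFinD EFinM.
  apply: integrableD => //.
    by apply: integrableZl => //; apply: ib; apply: ssl; rewrite inE eqxx.
  by apply: IHl => w wl; apply: ssl; rewrite inE wl orbT.
rewrite big_cons -addrA EFinD -IH//.
under eq_integral do rewrite big_cons -addrA EFinD EFinM.
rewrite integralD//; last by apply: integrableZl => //; exact: ib.
rewrite integralZl//; last exact: ib.
by rewrite EFinM fineK//; apply: integrable_fin_num => //; exact: ib.
Qed.

Variable x : nat -> nat -> X.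
Hypothesis wx : weak_cvg (fun N => empirical N (x N)) mu.

(** The weights disintegrate a coupling of [mu] with the empirical measure of
    [x N]: the mass of [mu] at z is distributed over the sample points in the
    proportions [w i z], and only a fraction [e] of it travels further than [e]. *)
Definition good_weights (N : nat) (e : R) (w : nat -> X -> R) :=
  [/\ forall i, continuous (w i), forall i z, 0 <= w i z,
      forall i, (\int[mu]_z (w i z)%:E = (N%:R^-1)%:E)%E &
      {ae mu, forall z : BX, \sum_(i < N) w i z = 1 /\
         \sum_(i < N | e <= `|x N i - z|) w i z <= e}].

(** Let p and q be the means of a bump under [mu] and under the empirical
    measure. A point z first picks a bump, with probability 1 - e times the value
    of the bump at z, and then a sample point in proportion to the values of that
    bump at the sample points, normalized by q. Since q tends to p, this uses no
    more than the available mass of any sample point. The mass that is left over,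
    about e of the total, is coupled as a product measure. *)
Lemma good_weights_ex (e : R) : 0 < e < 1 ->
  \forall N \near \oo, exists w, good_weights N e w.
Proof.
move=> /andP[e0 e1]; pose rho := e / 2.
have rho0 : 0 < rho by rewrite divr_gt0.
have [zs Hzs] := finite_net rho0 cK.
pose phi := bump rho zs.
have cphi z : continuous (phi z) by exact: continuous_bump.
have phi0 z y : 0 <= phi z y by exact: bump_ge0.
pose p z := fine (\int[mu]_y (phi z y)%:E)%E.
pose q N z := N%:R^-1 * \sum_(i < N) phi z (x N i).
(* The share of each bump that is coupled locally; the rest is coupled freely. *)
pose th := 1 - e.
have th0 : 0 < th by rewrite /th subr_gt0.
have th0' := ltW th0.
have fin : (mu setT < +oo)%E.
  exact: probability_lty.
have iphi z : z \in zs -> mu.-integrable setT (EFin \o phi z).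
  move=> zz; apply: (bounded_integrable (cphi z) fin (M := 1)) => y.
  by rewrite ger0_norm// bump_le1.
have pE z : z \in zs -> (\int[mu]_y (phi z y)%:E = (p z)%:E)%E.
  by move=> zz; rewrite /p fineK//; apply: integrable_fin_num => //; exact: iphi.
have p0 z : 0 <= p z.
  by apply: fine_ge0; apply: integral_ge0 => y _; rewrite lee_fin.
have q0 N z : 0 <= q N z.
  by apply: mulr_ge0; [rewrite invr_ge0|apply: sumr_ge0 => i _].
have qcv z : z \in zs -> q N z @[N --> \oo] --> p z.
  move=> zz; have bb : bounded_fun (phi z).
    exists 1; split => // M M1 y _; rewrite /= ger0_norm// (le_trans (bump_le1 rho y zz))//.
    exact: ltW.
  have := wx (cphi z) bb; rewrite (pE z)//.
  by under eq_fun do rewrite integral_empirical//; move=> /fine_cvgP[].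
have near_q : \forall N \near \oo, forall z, z \in zs -> th * p z <= q N z.
  elim: (zs) (qcv) => [|z l IH] H; first exact: nearW.
  have Hz : \forall N \near \oo, th * p z <= q N z.
    have [pz0|pz0] := eqVneq (p z) 0; first by apply: nearW => N; rewrite pz0 mulr0.
    have := H z (mem_head _ _) => /cvgr_ge; apply.
    by rewrite gtr_pMl ?lt_neqAle 1?eq_sym ?pz0 ?p0// /th; lra.
  have Hl : \forall N \near \oo, forall y, y \in l -> th * p y <= q N y.
    by apply: IH => y yl; apply: H; rewrite inE yl orbT.
  by apply: filterS2 Hz Hl => N h1 h2 y; rewrite inE => /predU1P[->//|]; exact: h2.
near=> N.
have N0 : (0 < N)%N by near: N; exact: nbhs_infty_gt.
have Nr : N%:R != 0 :> R by rewrite pnatr_eq0 -lt0n.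
have qp : forall z, z \in zs -> th * p z <= q N z by near: N; exact: near_q.
pose res y := 1 - th * \sum_(z <- zs) phi z y.
pose resN y := 1 - th * \sum_(z <- zs) p z / q N z * phi z y.
pose r := 1 - th * \sum_(z <- zs) p z.
have sp : \sum_(z <- zs) p z <= 1.
  have := @integral_affine_bumps rho zs zs (fun=> 1) 0 rho0 (fun _ h => h).
  under eq_integral do under eq_bigr do rewrite mul1r.
  under [in RHS]eq_bigr do rewrite mul1r.
  under eq_integral do rewrite addr0.
  rewrite addr0 => E; rewrite -lee_fin -[leLHS]E.
  rewrite -[leRHS](integral_constant mu 1); apply: ge0_le_integral => //.
  - by move=> y _; rewrite lee_fin; apply: sumr_ge0 => z _; exact: phi0.
  - by apply: continuous_measurable_EFin; apply: continuous_sum_seq.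
  - by move=> y _; rewrite lee_fin sum_bump_le1.
have r0 : 0 < r.
  have : th * \sum_(z <- zs) p z <= th by rewrite ler_piMr.
  by rewrite /r /th; lra.
have res0 y : 0 <= res y.
  have : th * \sum_(z <- zs) phi z y <= th by rewrite ler_piMr// sum_bump_le1.
  by rewrite /res /th; lra.
have pq1 z : z \in zs -> th * (p z / q N z) <= 1.
  move=> zz; have [->|qz] := eqVneq (q N z) 0; first by rewrite invr0 !mulr0.
  by rewrite mulrA ler_pdivrMr ?mul1r ?qp// lt_neqAle eq_sym qz q0.
have resN0 y : 0 <= resN y.
  rewrite /resN subr_ge0 mulr_sumr (le_trans _ (sum_bump_le1 rho zs y))//.
  rewrite big_seq [leRHS]big_seq; apply: ler_sum => z zz.
  by rewrite mulrA ler_piMl// pq1.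
pose w i y := N%:R^-1 * (th * (\sum_(z <- zs) phi z y * (phi z (x N i) / q N z))
  + res y * (resN (x N i) / r)).
pose D i := N%:R^-1 * (resN (x N i) / r).
pose A i z := N%:R^-1 * th * (phi z (x N i) / q N z) - th * D i.
have wE i y : w i y = \sum_(z <- zs) A i z * phi z y + D i.
  have -> : \sum_(z <- zs) A i z * phi z y = N%:R^-1 * (th *
     \sum_(z <- zs) phi z y * (phi z (x N i) / q N z)) -
     th * D i * \sum_(z <- zs) phi z y.
    by rewrite !mulr_sumr -sumrB; apply: eq_bigr => z _; rewrite /A; ring.
  by rewrite /w /D /res; ring.
exists w; split.
- move=> i y; rewrite (_ : w i = (fun y => \sum_(z <- zs) A i z * phi z y + D i)).
    apply: (@cvgD _ _ _ (nbhs y) (nbhs_filter y)); last exact: cst_continuous.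
    apply: (@continuous_sum_seq _ _ zs (fun z y => A i z * phi z y)) => z {}y.
    apply: (@cvgMl_tmp _ _ _ (nbhs_filter y)); exact: cphi.
  by apply/funext => ?; exact: wE.
- move=> i y; rewrite /w mulr_ge0 ?invr_ge0// addr_ge0//.
    apply: mulr_ge0 => //; apply: sumr_ge0 => z _.
    by rewrite mulr_ge0// divr_ge0.
  by rewrite mulr_ge0// divr_ge0// ltW.
- move=> i; under eq_integral do rewrite wE.
  rewrite integral_affine_bumps//; congr EFin.
  have -> : \sum_(z <- zs) A i z * fine (\int[mu]_y (bump rho zs z y)%:E)%E =
      N%:R^-1 * (th * \sum_(z <- zs) p z / q N z * phi z (x N i)) -
      th * D i * \sum_(z <- zs) p z.
    by rewrite !mulr_sumr -sumrB; apply: eq_bigr => z _; rewrite /A -/(p z); ring.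
  have -> : th * D i * \sum_(z <- zs) p z = D i * (1 - r) by rewrite /r; ring.
  have -> : th * \sum_(z <- zs) p z / q N z * phi z (x N i) = 1 - resN (x N i).
    by rewrite /resN; ring.
  rewrite /D; field.
  by rewrite Nr gt_eqF.
have sumq z : N%:R^-1 * \sum_(i < N) phi z (x N i) / q N z = q N z / q N z.
  by rewrite -mulr_suml mulrA.
have aeK : {ae mu, forall y : BX, K y}.
  exists (~` K); split => //; exact: measurableC_compact.
have aep : {ae mu, forall y : BX, forall k, (k < size zs)%N ->
    p (nth 0 zs k) = 0 -> phi (nth 0 zs k) y = 0}.
  apply: ae_foralln => k.
  have [kz|kz] := ltnP k (size zs); last by apply: aeW.
  have [pk|pk] := eqVneq (p (nth 0 zs k)) 0; last by apply: aeW => y _ /eqP; rewrite (negbTE pk).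
  have zz : nth 0 zs k \in zs by exact: mem_nth.
  have := (ae_eq_integral_abs mu measurableT
    (continuous_measurable_EFin (cphi (nth 0 zs k)))).1.
  have -> : (\int[mu]_(y in setT) `|(phi (nth 0 zs k) y)%:E| = 0)%E.
    by under eq_integral do rewrite gee0_abs ?lee_fin//; rewrite pE// pk.
  move=> /(_ erefl); apply: filterS => y /(_ I) [] hy _ _; exact: hy.
apply: (@filterS2 _ _ (ae_filter_ringOfSetsType mu) _ _ _ _ aeK aep) => y Ky Hy.
have S1 : \sum_(z <- zs) phi z y = 1 by apply: sum_bump1 => //; exact: Hzs.
have Hy' z : z \in zs -> p z = 0 -> phi z y = 0.
  move=> zz pz; have := Hy (index z zs); rewrite index_mem zz nth_index//.
  by apply.
have qq z : z \in zs -> phi z y * (q N z / q N z) = phi z y.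
  move=> zz; have [qz|qz] := eqVneq (q N z) 0; last by rewrite divff// mulr1.
  rewrite Hy' ?mul0r//; apply/eqP; rewrite eq_le p0 andbT.
  by rewrite -(@pmulr_rle0 _ th)// -qz qp.
have resy : res y = e by rewrite /res S1 /th; ring.
have sumD (P : pred 'I_N) : \sum_(i < N | P i) w i y =
    th * (\sum_(z <- zs) phi z y * (N%:R^-1 * \sum_(i < N | P i) phi z (x N i) / q N z))
    + e * (N%:R^-1 * \sum_(i < N | P i) resN (x N i) / r).
  rewrite /w -mulr_sumr big_split/= mulrDr resy -!mulr_sumr exchange_big/=.
  congr (_ + _); last by ring.
  rewrite mulrCA; congr (_ * _); rewrite mulr_sumr; apply: eq_bigr => z _.
  by rewrite -mulr_sumr mulrCA.
have sumR : N%:R^-1 * \sum_(i < N) resN (x N i) / r = 1.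
  rewrite -mulr_suml mulrA; apply: (canLR (mulfK _)); rewrite ?gt_eqF// mul1r.
  rewrite /resN sumrB sumr_const card_ord mulrBr -[1 *+ N]mulr_natl mulr1 mulVf//.
  rewrite /r -mulr_sumr exchange_big/=; congr (_ - _).
  rewrite mulrCA; congr (_ * _); rewrite mulr_sumr.
  rewrite big_seq [RHS]big_seq; apply: eq_bigr => z zz.
  rewrite -mulr_sumr mulrCA -/(q N z).
  have [qz|qz] := eqVneq (q N z) 0; last by rewrite divfK.
  rewrite qz mulr0; apply/esym/eqP; rewrite eq_le p0 andbT.
  by rewrite -(@pmulr_rle0 _ th)// -qz qp.
split.
  rewrite (sumD xpredT) sumR mulr1.
  have -> : \sum_(z <- zs) phi z y * (N%:R^-1 * \sum_(i < N) phi z (x N i) / q N z) = 1.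
    rewrite -[RHS]S1 big_seq [RHS]big_seq; apply: eq_bigr => z zz.
    by rewrite sumq qq.
  by rewrite /th; ring.
rewrite sumD big1 ?mulr0 ?add0r => [|z _].
  rewrite -[leRHS]mulr1 ler_pM2l// -[leRHS]sumR ler_pM2l ?invr_gt0 ?ltr0n//.
  rewrite [leRHS](bigID (fun i : 'I_N => e <= `|x N i - y|))/= lerDl.
  by apply: sumr_ge0 => i _; rewrite divr_ge0// ltW.
have [->|pz] := eqVneq (phi z y) 0; first by rewrite mul0r.
rewrite [X in _ * X](_ : _ = 0) ?mulr0// [X in _ * X](_ : _ = 0) ?mulr0//.
apply: big1 => i ei; have [->|pi] := eqVneq (phi z (x N i)) 0; first by rewrite mul0r.
have h1 := bump_near rho0 pz; have h2 := bump_near rho0 pi.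
have := ler_distD z (x N i) y; rewrite leNgt => /negP; case.
rewrite (lt_le_trans _ ei)// (distrC z) [e](splitr e); exact: ltrD.
Unshelve. all: by end_near. Qed.

End weights.

(** * Mixtures of measures *)

Section mixture.
Context d1 d2 (T1 : measurableType d1) (T2 : measurableType d2) (R : realType).
Variables (mu : {measure set T1 -> \bar R}) (k : T1 -> {measure set T2 -> \bar R}).
Hypothesis mk : forall A, measurable A -> measurable_fun setT (k ^~ A).
Local Open Scope ereal_scope.

Definition mixture (A : set T2) : \bar R := \int[mu]_x k x A.

Let mixture0 : mixture set0 = 0.
Proof. by rewrite /mixture integral0_eq. Qed.

Let mixture_ge0 A : 0 <= mixture A.
Proof. exact: integral_ge0. Qed.

Let mixture_sigma_additive : semi_sigma_additive mixture.
Proof.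
move=> F mF tF mUF; rewrite [X in _ --> X](_ : _ =
    \int[mu]_x \sum_(0 <= j <oo) k x (F j)); last first.
  by apply: eq_integral => x _; apply/esym/cvg_lim => //; exact: measure_sigma_additive.
rewrite [X in X @ _](_ : _ = (fun N => \int[mu]_x \sum_(0 <= j < N) k x (F j))).
  apply: cvg_monotone_convergence => //.
  - by move=> N; apply: emeasurable_sum => j; exact: mk.
  - by move=> N x _; rewrite sume_ge0.
  - by move=> x _ p q pq; exact: ereal_nondecreasing_series.
by apply/funext => N; rewrite -ge0_integral_sum// => j; exact: mk.
Qed.

HB.instance Definition _ := isMeasure.Build _ _ _ mixture
  mixture0 mixture_ge0 mixture_sigma_additive.

Definition mixture_measure : {measure set T2 -> \bar R} := mixture.

Import HBNNSimple.

Let integral_mixture_nnsfun (h : {nnsfun T2 >-> R}) :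
  \int[mixture]_y (h y)%:E = \int[mu]_x \int[k x]_y (h y)%:E.
Proof.
rewrite integralT_nnsfun sintegralE.
under [RHS]eq_integral do rewrite integralT_nnsfun sintegralE.
have mh r : measurable (h @^-1` [set r]) by [].
rewrite ge0_integral_fsum//; last 2 first.
  by move=> r; apply: measurable_funeM; exact: mk.
  by move=> r x _; exact: nnsfun_mulemu_ge0.
apply: eq_fsbigr => r _; have [r0|r0] := leP 0%R r.
  by rewrite ge0_integralZl//; exact: mk.
rewrite preimage_nnfun0// measure0 mule0 integral0_eq// => x _.
by rewrite measure0 mule0.
Qed.

Let mint (h : {nnsfun T2 >-> R}) :
  measurable_fun setT (fun x => \int[k x]_y (h y)%:E).
Proof.
under eq_fun do rewrite integralT_nnsfun sintegralE.
apply: emeasurable_fsum => // r.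
by apply: measurable_funeM; exact: mk.
Qed.

Lemma ge0_integral_mixture (f : T2 -> \bar R) : measurable_fun setT f ->
  (forall y, 0 <= f y) -> \int[mixture_measure]_y f y = \int[mu]_x \int[k x]_y f y.
Proof.
move=> mf f0; pose h := nnsfun_approx measurableT mf.
have mh n : measurable_fun setT (EFin \o h n) by exact/measurable_EFinP.
have h0 n y : 0 <= (EFin \o h n) y by rewrite lee_fin.
have nd y : {homo (fun n => (EFin \o h n) y) : p q / (p <= q)%N >-> p <= q}.
  by move=> p q pq; rewrite lee_fin; exact/lefP/nd_nnsfun_approx.
have lim_h (nu : {measure set T2 -> \bar R}) :
    \int[nu]_y f y = limn (fun n => \int[nu]_y (EFin \o h n) y).
  rewrite -monotone_convergence//; apply: eq_integral => y _.
  by apply/esym/cvg_lim => //; exact: cvg_nnsfun_approx.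
rewrite lim_h; under [RHS]eq_integral do rewrite lim_h.
rewrite monotone_convergence//.
- by congr (limn _); apply/funext => n; exact: integral_mixture_nnsfun.
- by move=> n; exact: mint.
- by move=> n x _; exact: integral_ge0.
- move=> x _ p q pq; by apply: ge0_le_integral => // z _; exact: nd.
Qed.

End mixture.

Section unit_mass.
Context d (T : measurableType d) (R : realType) (mu : {measure set T -> \bar R}).
Hypothesis mu1 : mu setT = 1%E.

(** A copy of [mu] that carries the structure of a probability measure. *)
Definition unit_mass (A : set T) : \bar R := mu A.

HB.instance Definition _ := isMeasure.Build _ _ _ unit_mass
  (measure0 mu) (measure_ge0 mu) (@measure_semi_sigma_additive _ _ _ mu).

HB.instance Definition _ := Measure_isProbability.Build _ _ _ unit_mass mu1.

Lemma unit_mass_probability : exists P : probability T R, forall A, P A = mu A.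
Proof. by exists unit_mass. Qed.

End unit_mass.

Section weighted_mixture.
Context d1 d2 (T1 : measurableType d1) (T2 : measurableType d2) (R : realType).
Variables (mu : {measure set T1 -> \bar R}) (N : nat).
Variables (w u : nat -> T1 -> R) (f : nat -> nat -> T1 -> T2).
Hypotheses (w0 : forall i x, 0 <= w i x) (u0 : forall j x, 0 <= u j x).
Hypotheses (mw : forall i, measurable_fun setT (w i))
  (mu_ : forall j, measurable_fun setT (u j)).
Hypothesis mf : forall i j, measurable_fun setT (f i j).
Hypothesis mu1 : mu setT = 1%E.
Hypothesis w1 : {ae mu, forall x, \sum_(i < N) w i x = 1}.
Hypothesis u1 : {ae mu, forall x, \sum_(j < N) u j x = 1}.

Definition weighted_kernel (x : T1) : {measure set T2 -> \bar R} :=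
  msum (fun i => mscale (NngNum (w0 i x))
    (msum (fun j => mscale (NngNum (u0 j x)) \d_(f i j x)) N)) N.

Lemma measurable_weighted_kernel A : measurable A ->
  measurable_fun setT (weighted_kernel ^~ A).
Proof.
move=> mA; rewrite (_ : (fun x => _) = fun x =>
  (\sum_(i < N) (w i x)%:E * \sum_(j < N) (u j x)%:E * \d_(f i j x) A)%E)//.
apply: emeasurable_sum => i; apply: emeasurable_funM.
  exact/measurable_EFinP.
apply: emeasurable_sum => j; apply: emeasurable_funM.
  exact/measurable_EFinP.
rewrite (_ : (fun x => _) = (fun x => (\1_(f i j @^-1` A) x)%:E)); last first.
  by apply/funext => x; rewrite diracE.
apply/measurable_EFinP; apply: measurable_indic.
by rewrite -[X in measurable X]setTI; exact: mf.
Qed.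

Lemma ge0_integral_weighted_kernel x (F : T2 -> \bar R) : measurable_fun setT F ->
  (forall y, (0 <= F y)%E) -> (\int[weighted_kernel x]_y F y =
  \sum_(i < N) \sum_(j < N) (w i x * u j x)%:E * F (f i j x))%E.
Proof.
move=> mF F0; rewrite /weighted_kernel ge0_integral_measure_sum//.
apply: eq_bigr => i _; rewrite ge0_integral_mscale//= ge0_integral_measure_sum//.
rewrite ge0_sume_distrr => [|j _]; last exact: integral_ge0.
apply: eq_bigr => j _; rewrite ge0_integral_mscale//= integral_dirac// diracT.
by rewrite mul1e muleA EFinM.
Qed.

(** A point x is sent to [f i j x] with probability [w i x * u j x]. *)
Lemma weighted_mixture : exists rho : probability T2 R,
  forall F : T2 -> \bar R, measurable_fun setT F -> (forall y, (0 <= F y)%E) ->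
  (\int[rho]_y F y =
   \int[mu]_x \sum_(i < N) \sum_(j < N) (w i x * u j x)%:E * F (f i j x))%E.
Proof.
pose rho := mixture_measure mu measurable_weighted_kernel.
have rhoE (F : T2 -> \bar R) : measurable_fun setT F -> (forall y, (0 <= F y)%E) ->
    (\int[rho]_y F y =
     \int[mu]_x \sum_(i < N) \sum_(j < N) (w i x * u j x)%:E * F (f i j x))%E.
  move=> mF F0; rewrite ge0_integral_mixture//.
  by apply: eq_integral => x _; exact: ge0_integral_weighted_kernel.
have rho1 : rho setT = 1%E.
  have := rhoE (cst 1%E) (measurable_cst _) (fun=> @lee01 R).
  rewrite integral_cst// mul1e => ->.
  have ae1 : {ae mu, forall x, (\sum_(i < N) \sum_(j < N) (w i x * u j x)%:E * 1)%E = 1%E}.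
    apply: (@filterS2 _ _ (ae_filter_ringOfSetsType mu) _ _ _ _ w1 u1) => x wx ux.
    under eq_bigr do under eq_bigr do rewrite mule1.
    under eq_bigr do rewrite sumEFin -mulr_sumr ux mulr1.
    by rewrite sumEFin wx.
  rewrite -[RHS]mu1 -[RHS]mul1e -[RHS](integral_cst _ measurableT); apply: ae_eq_integral => //.
    apply: emeasurable_sum => i; apply: emeasurable_sum => j.
    apply: emeasurable_funM => //; apply/measurable_EFinP.
    exact: measurable_funM.
  by apply: filterS ae1 => x + _; exact.
have [P PE] := unit_mass_probability rho1.
exists P => F mF F0; rewrite -rhoE//; apply: eq_measure_integral => A mA _.
exact: PE.
Qed.

End weighted_mixture.

(** * Moving the end points of an interpolated path *)

Section relink.
Variables (R : realType) (n : nat) (a b : R).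
Hypothesis ab : a < b.
Local Notation P := (paths n a b).
Local Notation nd s j := (node a b s j).
Implicit Types (s : seq R) (x y : 'rV[R]_n) (g : P).

Let leab : a <= b := ltW ab.
Let ba0 : b - a != 0. Proof. by rewrite subr_eq0 gt_eqF. Qed.

(** [shift] and [tilt] are the coefficients of the affine path which moves the
    end points of [g] to x and y. *)
Definition tilt x y g : 'rV[R]_n := (b - a)^-1 *: ((y - pr b g) - (x - pr a g)).

Definition shift x y g : 'rV[R]_n := x - pr a g - a *: tilt x y g.

Let relinked s x y g t : 'rV[R]_n :=
  interp a b s (fun t => pr t g) t + (shift x y g + t *: tilt x y g).

Let continuous_relinked s x y g : continuous (relinked s x y g).
Proof.
move=> t; apply: cvgD; first exact: continuous_interp.
apply: cvgD; first exact: cvg_cst.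
by apply: cvgZr_tmp; exact: cvg_id.
Qed.

Definition relink s x y g : P := mk_path a b (@continuous_relinked s x y g).

Lemma pr_relink s x y g t : a <= t <= b -> pr t (relink s x y g) =
  pr t (path_interp s g) + (shift x y g + t *: tilt x y g).
Proof. by move=> tab; rewrite /relink /path_interp !pr_mk_path. Qed.

Lemma pr_relink_node s x y g j : itv_partition a b s -> (j <= size s)%N ->
  pr (nd s j) (relink s x y g) =
  pr (nd s j) g + (shift x y g + nd s j *: tilt x y g).
Proof.
move=> abs js; rewrite pr_relink; last exact: node_itv.
by rewrite /path_interp pr_mk_path ?interp_node//; exact: node_itv.
Qed.

(** At time t the correction is the convex combination of the displacements of
    the two end points. *)
Lemma correctionE x y g t : shift x y g + t *: tilt x y g =
  (1 - (t - a) / (b - a)) *: (x - pr a g) + ((t - a) / (b - a)) *: (y - pr b g).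
Proof.
rewrite /shift /tilt; set X := x - pr a g; set Y := y - pr b g.
apply/rowP => i; rewrite !mxE; field; exact: ba0.
Qed.

Lemma relink_a s x y g : itv_partition a b s -> pr a (relink s x y g) = x.
Proof.
move=> abs; have := @pr_relink_node s x y g 0 abs isT; rewrite node0 => ->.
by rewrite correctionE subrr mul0r scale0r addr0 subr0 scale1r subrKC.
Qed.

Lemma relink_b s x y g : itv_partition a b s -> pr b (relink s x y g) = y.
Proof.
move=> abs; have := @pr_relink_node s x y g (size s) abs (leqnn _).
rewrite node_size// => ->.
by rewrite correctionE divff// subrr scale0r add0r scale1r subrKC.
Qed.

Lemma piecewise_affine_relink s x y g : itv_partition a b s ->
  piecewise_affine s (relink s x y g).
Proof.
move=> abs j js; set q := fun t => pr t g.
exists (q (nd s j) - nd s j *: slope a b s q j + shift x y g),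
  (slope a b s q j + tilt x y g) => t tj.
have tab : a <= t <= b.
  have /andP[h1 _] := node_itv abs (ltnW js).
  have /andP[_ h2] := node_itv abs js.
  by case/andP: tj => h3 h4; rewrite (le_trans h1)//= (le_trans h4).
rewrite pr_relink// /path_interp pr_mk_path// (interp_in abs _ js tj).
by apply/rowP => i; rewrite !mxE; ring.
Qed.

Lemma penergy_relink s x y g : itv_partition a b s ->
  penergy s (relink s x y g) = penergy s g +
    2 * dotp (pr b g - pr a g) (tilt x y g) + (b - a) * sqnorm (tilt x y g).
Proof.
move=> abs; rewrite /penergy -(energyD_affine abs _ (shift x y g)).
by apply: eq_energy => j js; exact: pr_relink_node.
Qed.

Lemma correction_le x y g t : a <= t <= b ->
  `|shift x y g + t *: tilt x y g| <= `|x - pr a g| + `|y - pr b g|.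
Proof.
move=> /andP[at_ tb]; rewrite correctionE.
have l0 : 0 <= (t - a) / (b - a) by rewrite divr_ge0 ?subr_ge0.
have l1 : (t - a) / (b - a) <= 1 by rewrite ler_pdivrMr ?subr_gt0// mul1r; lra.
move: l0 l1; move: ((t - a) / (b - a)) => l l0 l1.
rewrite (le_trans (ler_normD _ _))// !normrZ.
by apply: lerD; apply: ler_piMl => //; rewrite ger0_norm ?subr_ge0//; lra.
Qed.

Lemma relink_close s x y g t : a <= t <= b ->
  `|pr t (relink s x y g) - pr t (path_interp s g)| <=
  `|x - pr a g| + `|y - pr b g|.
Proof.
by move=> tab; rewrite pr_relink// addrAC subrr add0r; exact: correction_le.
Qed.

Lemma path_interp_nonexpansive s g g' (e : R) t : itv_partition a b s ->
  (forall t, a <= t <= b -> `|pr t g - pr t g'| <= e) -> a <= t <= b ->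
  `|pr t (path_interp s g) - pr t (path_interp s g')| <= e.
Proof.
move=> abs H tab; rewrite /path_interp !pr_mk_path//.
have [k ks tk] := node_locate abs ab tab; rewrite !(interp_in abs _ ks)//.
have lt := node_ltS abs ks; set l := (t - nd s k) / (nd s k.+1 - nd s k).
case/andP: tk => kt tk.
have l0 : 0 <= l by rewrite divr_ge0 ?subr_ge0// ltW.
have l1 : l <= 1 by rewrite ler_pdivrMr ?subr_gt0// mul1r; lra.
rewrite [X in `|X|](_ : _ = (1 - l) *: (pr (nd s k) g - pr (nd s k) g') +
    l *: (pr (nd s k.+1) g - pr (nd s k.+1) g')); last first.
  apply/rowP => i; rewrite !mxE /l; field.
  by rewrite subr_eq0 gt_eqF.
clearbody l; have l1' : 0 <= 1 - l by rewrite subr_ge0.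
rewrite (le_trans (ler_normD _ _))// !normrZ !ger0_norm//.
have h1 := H _ (node_itv abs (ltnW ks)); have h2 := H _ (node_itv abs ks).
have -> : e = (1 - l) * e + l * e by ring.
by apply: lerD; apply: ler_wpM2l.
Qed.

Lemma continuous_relink s x y : itv_partition a b s -> continuous (relink s x y).
Proof.
move=> abs g; apply/continuous_pathsP => e e0.
exists (e / 4) => [|g' H]; first by rewrite divr_gt0.
have aab : a <= a <= b by rewrite lexx.
have bab : a <= b <= b by rewrite lexx andbT.
apply/paths_ballP => t tab; rewrite -ball_normE /= !pr_relink// !correctionE.
set l := (t - a) / (b - a).
case/andP: (tab) => at_ tb.
have l0 : 0 <= l by rewrite divr_ge0 ?subr_ge0.
have l1 : l <= 1 by rewrite ler_pdivrMr ?subr_gt0// mul1r; lra.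
rewrite [X in `|X|](_ : _ = (pr t (path_interp s g) - pr t (path_interp s g')) -
    ((1 - l) *: (pr a g - pr a g') + l *: (pr b g - pr b g'))); last first.
  by apply/rowP => i; rewrite !mxE; ring.
have h0 : `|pr t (path_interp s g) - pr t (path_interp s g')| <= e / 4.
  by apply: path_interp_nonexpansive => // u uab; exact/ltW/H.
have h1 : `|(1 - l) *: (pr a g - pr a g')| <= e / 4.
  rewrite normrZ ger0_norm ?subr_ge0// -[leRHS]mul1r.
  by apply: ler_pM => //; [lra|lra|exact/ltW/H].
have h2 : `|l *: (pr b g - pr b g')| <= e / 4.
  rewrite normrZ ger0_norm// -[leRHS]mul1r.
  by apply: ler_pM => //; exact/ltW/H.
have := ler_normB (pr t (path_interp s g) - pr t (path_interp s g'))
  ((1 - l) *: (pr a g - pr a g') + l *: (pr b g - pr b g')).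
have := ler_normD ((1 - l) *: (pr a g - pr a g')) (l *: (pr b g - pr b g')).
lra.
Qed.

Lemma sqnorm_tilt_le x y g r : sqnorm x <= r -> sqnorm y <= r ->
  sqnorm (pr a g) <= r -> sqnorm (pr b g) <= r ->
  sqnorm (tilt x y g) <= (b - a)^-1 ^+ 2 * (16 * r).
Proof.
move=> xr yr ar br; rewrite /tilt sqnormZ ler_wpM2l ?sqr_ge0//.
have := sqnormD_le (y - pr b g) (- (x - pr a g)); rewrite sqnormN.
have := sqnormD_le y (- pr b g); have := sqnormD_le x (- pr a g).
by rewrite !sqnormN; lra.
Qed.

(** The energy increases by a quadratic function of the four end points, which
    are bounded. *)
Lemma penergy_relink_close r : 0 <= r -> exists2 K : R, 0 <= K &
  forall s x y g, itv_partition a b s -> sqnorm x <= r -> sqnorm y <= r ->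
  sqnorm (pr a g) <= r -> sqnorm (pr b g) <= r ->
  penergy s (relink s x y g) <= penergy s g + K.
Proof.
move=> r0; pose K0 := (b - a)^-1 ^+ 2 * (16 * r).
have K00 : 0 <= K0 by rewrite mulr_ge0 ?sqr_ge0// mulr_ge0.
have ba : 0 < b - a by rewrite subr_gt0.
exists (4 * r + K0 + (b - a) * K0).
  have ba' := ltW ba; apply: addr_ge0; last exact: mulr_ge0.
  by apply: addr_ge0 => //; exact: mulr_ge0.
move=> s x y g abs xr yr ar br; rewrite penergy_relink//.
have tK := sqnorm_tilt_le xr yr ar br; rewrite -/K0 in tK.
have := dotp_le (pr b g - pr a g) (tilt x y g); rewrite ler_norml => /andP[_].
have := sqnormD_le (pr b g) (- pr a g); rewrite sqnormN.
have : (b - a) * sqnorm (tilt x y g) <= (b - a) * K0 by rewrite ler_pM2l.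
move: xr yr ar br tK; move: (sqnorm (pr b g - pr a g)) (sqnorm (pr a g)) (sqnorm (pr b g)).
move: ((b - a) * sqnorm (tilt x y g)) ((b - a) * K0) (sqnorm (tilt x y g)).
by move: (dotp _ _) (penergy s g) => *; lra.
Qed.

End relink.

(** * Weighted averages and diagonal sequences *)

Section averaging.
Variable R : realType.

(** The weight of the pairs for which i or j is exceptional is at most [2 * e],
    and there the deviation is at most [M]. *)
Lemma weighted_average_close (N : nat) (w u : 'I_N -> R) (A : 'I_N -> 'I_N -> R)
    (p q : pred 'I_N) (L d M e : R) :
  (forall i, 0 <= w i) -> (forall j, 0 <= u j) ->
  \sum_i w i = 1 -> \sum_j u j = 1 ->
  \sum_(i | p i) w i <= e -> \sum_(j | q j) u j <= e -> 0 <= d ->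
  (forall i j, `|A i j - L| <= M) ->
  (forall i j, ~~ p i -> ~~ q j -> `|A i j - L| <= d) -> 0 <= M ->
  `|\sum_i \sum_j w i * u j * A i j - L| <= d + 2 * M * e.
Proof.
move=> w0 u0 w1 u1 pe qe d0 HM Hd M0.
have sum1 : \sum_i \sum_j w i * u j = 1.
  by under eq_bigr do rewrite -mulr_sumr u1 mulr1.
have -> : \sum_i \sum_j w i * u j * A i j - L =
    \sum_i \sum_j w i * u j * (A i j - L).
  under [RHS]eq_bigr do under eq_bigr do rewrite mulrBr.
  under [RHS]eq_bigr do rewrite sumrB.
  rewrite sumrB; congr (_ - _); under eq_bigr do rewrite -mulr_suml.
  by rewrite -mulr_suml sum1 mul1r.
have bound i j : `|w i * u j * (A i j - L)| <=
    w i * u j * d + M * (w i * (p i)%:R * u j) + M * (w i * (u j * (q j)%:R)).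
  have wu : 0 <= w i * u j by exact: mulr_ge0.
  rewrite normrM (ger0_norm wu).
  have -> : w i * u j * d + M * (w i * (p i)%:R * u j) + M * (w i * (u j * (q j)%:R))
    = w i * u j * (d + M * (p i)%:R + M * (q j)%:R) by ring.
  apply: ler_wpM2l => //; have [pi|npi] := boolP (p i).
    rewrite (le_trans (HM i j))//= mulr1 -addrA (addrCA d) lerDl.
    by rewrite addr_ge0// mulr_ge0.
  have [qj|nqj] := boolP (q j).
    by rewrite (le_trans (HM i j))//= mulr1 mulr0 addr0 lerDr.
  by rewrite /= !mulr0 !addr0 Hd.
have sp : \sum_i w i * (p i)%:R <= e.
  apply: le_trans pe; rewrite [leRHS]big_mkcond; apply: ler_sum => i _.
  by case: (p i); rewrite ?mulr1 ?mulr0.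
have sq : \sum_i u i * (q i)%:R <= e.
  apply: le_trans qe; rewrite [leRHS]big_mkcond; apply: ler_sum => i _.
  by case: (q i); rewrite ?mulr1 ?mulr0.
apply: (@le_trans _ _ (\sum_i \sum_j (w i * u j * d + M * (w i * (p i)%:R * u j)
   + M * (w i * (u j * (q j)%:R))))).
  rewrite (le_trans (ler_norm_sum _ _ _))//; apply: ler_sum => i _.
  by rewrite (le_trans (ler_norm_sum _ _ _))//; apply: ler_sum => j _.
rewrite (eq_bigr (fun i => w i * (d + M * \sum_j u j * (q j)%:R)
    + M * (w i * (p i)%:R))) => [|i _]; last first.
  rewrite 2!big_split/= -mulr_suml -!mulr_sumr u1; ring.
rewrite big_split/= -mulr_suml w1 mul1r -mulr_sumr.
rewrite -addrA lerD2l -mulrDr (mulrC 2) -mulrA ler_wpM2l//.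
by rewrite mulr_natl mulr2n lerD.
Qed.

(** At N the scale is 1 / (k + 2) for the largest k up to N such that the
    property at that scale holds from N on. *)
Lemma diagonal_choice (P : nat -> R -> Prop) :
  (forall e, 0 < e < 1 -> \forall N \near \oo, P N e) ->
  exists2 e : nat -> R, e N @[N --> \oo] --> 0 &
    \forall N \near \oo, P N (e N).
Proof.
move=> H; have ex k : exists N0, forall N, (N0 <= N)%N -> P N (k.+2%:R^-1).
  have [|N0 _ HN0] := H (k.+2%:R^-1).
    by rewrite invr_gt0 ltr0n/= invf_lt1 ?ltr0n// ltr1n.
  by exists N0 => N N0N; exact: HN0.
have [N0 HN0] := choice ex.
pose kappa N := (\max_(k < N.+1 | (N0 k <= N)%N) k)%N.
exists (fun N => (kappa N).+2%:R^-1).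
  apply/cvgrPdist_lt => e e0.
  have [k kE] : exists k : nat, k.+1%:R^-1 < e.
    have [k _ Hk] := near_infty_natSinv_lt (PosNum e0).
    by exists k; apply: Hk => /=.
  near=> N.
  have kN : (k < N.+1)%N by rewrite ltnS; near: N; exact: nbhs_infty_ge.
  have N0N : (N0 k <= N)%N by near: N; exact: nbhs_infty_ge.
  have kk : (k <= kappa N)%N.
    exact: (@leq_bigmax_cond _ (fun i : 'I_N.+1 => (N0 i <= N)%N)
      (fun i : 'I_N.+1 => i : nat) (Ordinal kN) N0N).
  rewrite sub0r normrN ger0_norm ?invr_ge0//; apply: le_lt_trans kE.
  by rewrite lef_pV2 ?posrE ?ltr0n// ler_nat; exact: leq_trans kk _.
near=> N.
have N0N : (N0 0%N <= N)%N by near: N; exact: nbhs_infty_ge.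
have card : (0 < #|[pred i : 'I_N.+1 | (N0 i <= N)%N]|)%N.
  by apply/card_gt0P; exists ord0; rewrite inE.
have [i iN kE] := eq_bigmax_cond (fun i : 'I_N.+1 => i : nat) card.
have -> : kappa N = i by rewrite -kE /kappa.
exact: HN0.
Unshelve. all: by end_near. Qed.

End averaging.

(** * Limits of averages over relinked paths *)

Section relinked_averages.
Variables (R : realType) (n : nat) (a b : R).
Hypothesis ab : a < b.
Local Notation X := 'rV[R]_n.
Local Notation P := (paths n a b).
Local Notation PS := (borel P).
Variables (mu_a mu_b : probability (borel X) R) (pi : probability PS R).
Hypotheses (ma : has_marginal a pi mu_a) (mb : has_marginal b pi mu_b).
Variables (x y : nat -> nat -> X) (w u : nat -> nat -> X -> R) (e : nat -> R).
Variable T : nat -> seq R.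
Hypothesis e0 : e N @[N --> \oo] --> 0.

Let aab : a <= a <= b. Proof. by rewrite lexx ltW. Qed.
Let bab : a <= b <= b. Proof. by rewrite lexx ltW. Qed.

Definition good N := [/\ good_weights mu_a x N (e N) (w N),
  good_weights mu_b y N (e N) (u N), (0 < N)%N & itv_partition a b (T N)].

Definition average N (A : nat -> nat -> R) (g : P) : R :=
  \sum_(i < N) \sum_(j < N) w N i (pr a g) * u N j (pr b g) * A i j.

Lemma ae_marginal t (nu : {measure set (borel X) -> \bar R}) (Q : X -> Prop) :
  a <= t <= b -> has_marginal t pi nu ->
  {ae nu, forall z : borel X, Q z} -> {ae pi, forall g : PS, Q (pr t g)}.
Proof.
move=> tab mt [A [mA A0 AQ]]; exists (pr t @^-1` A); split.
- by rewrite -[X in measurable X]setTI; apply: measurable_pr.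
- by rewrite -A0 -(mt A mA).
- by move=> g /= nQ; apply: AQ.
Qed.

Lemma ge0_integral_marginal t (nu : {measure set (borel X) -> \bar R}) (f : X -> R) :
  a <= t <= b -> has_marginal t pi nu -> continuous f -> (forall z, 0 <= f z) ->
  (\int[pi]_g (f (pr t g))%:E = \int[nu]_z (f z)%:E)%E.
Proof.
move=> tab mt cf f0; have mp := @measurable_pr R n a b t tab.
have -> : (\int[nu]_z (f z)%:E = \int[pushforward_measure pi mp]_z (f z)%:E)%E.
  by apply: eq_measure_integral => B mB _; rewrite -(mt B mB).
rewrite /pushforward_measure (@ge0_integral_pushforward _ _ _ _ _ _ mp)//.
- exact: continuous_measurable_EFin.
- by move=> z _; rewrite lee_fin.
Qed.

Lemma ae_good : {ae pi, forall g : PS, forall N, good N ->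
  [/\ \sum_(i < N) w N i (pr a g) = 1, \sum_(j < N) u N j (pr b g) = 1,
   \sum_(i < N | e N <= `|x N i - pr a g|) w N i (pr a g) <= e N &
   \sum_(j < N | e N <= `|y N j - pr b g|) u N j (pr b g) <= e N]}.
Proof.
apply: ae_foralln => N.
have [[[_ _ _ wN] [_ _ _ uN] _ _]|ng] := pselect (good N); last by apply: aeW.
have := ae_marginal bab mb uN; have := ae_marginal aab ma wN.
apply: filterS2 => g [? ?] [? ?] _; by split.
Qed.

Lemma measurable_average N (A : P -> nat -> nat -> R) : good N ->
  (forall i j, measurable_fun [set: PS] (fun g : PS => A g i j)) ->
  measurable_fun [set: PS] (fun g : PS => average N (A g) g).
Proof.
move=> [[cw _ _ _] [cu _ _ _] _ _] mA.
apply: measurable_sum => i; apply: measurable_sum => j.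
apply: measurable_funM => //; apply: measurable_funM.
  by apply: continuous_measurable_real => g;
    apply: (@continuous_comp _ _ _ (pr a) (w N i)); [exact: continuous_pr|exact: cw].
by apply: continuous_measurable_real => g;
    apply: (@continuous_comp _ _ _ (pr b) (u N j)); [exact: continuous_pr|exact: cu].
Qed.

(** For almost every path the weights concentrate near its end points, where
    the values are close to the limit, and the exceptional pairs have vanishing
    weight and bounded values; the integrals converge by domination. *)
Lemma averages_cvg (A : nat -> P -> nat -> nat -> R) (L B : P -> R) :
  (\forall N \near \oo, good N) ->
  (forall N i j, good N -> measurable_fun [set: PS] (fun g : PS => A N g i j)) ->
  measurable_fun [set: PS] (L : PS -> R) ->
  pi.-integrable setT (fun g : PS => (B g)%:E) ->
  {ae pi, forall g : PS, `|L g| <= B g} ->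
  {ae pi, forall g : PS, forall N i j, good N -> (i < N)%N -> (j < N)%N ->
     `|A N g i j| <= B g} ->
  {ae pi, forall g : PS, forall d, 0 < d -> exists2 eta : R, 0 < eta &
     \forall N \near \oo, forall i j, (i < N)%N -> (j < N)%N ->
     `|x N i - pr a g| < eta -> `|y N j - pr b g| < eta ->
     `|A N g i j - L g| <= d} ->
  pi.-integrable setT (fun g : PS => (L g)%:E) /\
  (\int[pi]_g (average N (A N g) g)%:E)%E @[N --> \oo] -->
  (\int[pi]_g (L g)%:E)%E.
Proof.
move=> ng mA mL iB LB AB AL.
pose h N (g : PS) : \bar R := (if `[< good N >] then average N (A N g) g else L g)%:E.
suff [iL H] : pi.-integrable setT (fun g : PS => (L g)%:E) /\
    (\int[pi]_g (h N g))%E @[N --> \oo] --> (\int[pi]_g (L g)%:E)%E.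
  split => //; apply: cvg_trans H; apply: near_eq_cvg; apply: filterS ng => N gN.
  by apply: eq_integral => g _; rewrite /h asboolT.
have w0 N i z : good N -> 0 <= w N i z by case=> -[_ + _ _] _ _ _; apply.
have u0 N i z : good N -> 0 <= u N i z by case=> _ [_ + _ _] _ _; apply.
have AE : {ae pi, forall g : PS, [/\ forall N, good N ->
  [/\ \sum_(i < N) w N i (pr a g) = 1, \sum_(j < N) u N j (pr b g) = 1,
   \sum_(i < N | e N <= `|x N i - pr a g|) w N i (pr a g) <= e N &
   \sum_(j < N | e N <= `|y N j - pr b g|) u N j (pr b g) <= e N],
   `|L g| <= B g, forall N i j, good N -> (i < N)%N -> (j < N)%N ->
     `|A N g i j| <= B g & forall d, 0 < d -> exists2 eta : R, 0 < eta &
     \forall N \near \oo, forall i j, (i < N)%N -> (j < N)%N ->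
     `|x N i - pr a g| < eta -> `|y N j - pr b g| < eta ->
     `|A N g i j - L g| <= d]}.
  have LAB : {ae pi, forall g : PS, `|L g| <= B g /\ forall N i j, good N ->
      (i < N)%N -> (j < N)%N -> `|A N g i j| <= B g}.
    exact: (@filterI _ _ (ae_filter_ringOfSetsType pi) _ _ LB AB).
  apply: (@filterS3 _ _ (ae_filter_ringOfSetsType pi) _ _ _ _ _ ae_good LAB AL).
  by move=> g ? [? ?] ?; split.
have close N g d : good N -> 0 <= d -> `|L g| <= B g ->
    [/\ \sum_(i < N) w N i (pr a g) = 1, \sum_(j < N) u N j (pr b g) = 1,
     \sum_(i < N | e N <= `|x N i - pr a g|) w N i (pr a g) <= e N &
     \sum_(j < N | e N <= `|y N j - pr b g|) u N j (pr b g) <= e N] ->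
    (forall i j, (i < N)%N -> (j < N)%N -> `|A N g i j| <= B g) ->
    (forall i j, (i < N)%N -> (j < N)%N ->
     `|x N i - pr a g| < e N -> `|y N j - pr b g| < e N ->
     `|A N g i j - L g| <= d) ->
    `|average N (A N g) g - L g| <= d + 2 * (2 * B g) * e N.
  move=> gN d0 Lg [w1 u1 we ue] Ag Ad.
  have B0 : 0 <= B g by rewrite (le_trans _ Lg).
  apply: (@weighted_average_close _ N (fun i => w N i (pr a g))
    (fun j => u N j (pr b g)) (fun i j => A N g i j)
    (fun i : 'I_N => e N <= `|x N i - pr a g|)
    (fun j : 'I_N => e N <= `|y N j - pr b g|)) => //.
  - by move=> i; exact: w0.
  - by move=> j; exact: u0.
  - move=> i j; rewrite (le_trans (ler_normB _ _))// mulr_natl mulr2n.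
    by rewrite lerD// Ag.
  - by move=> i j; rewrite -!ltNge => xi yj; exact: Ad.
  - exact: mulr_ge0.
have [||||iL _ ?] // := @dominated_convergence _ _ _ pi setT measurableT h
  (fun g => (L g)%:E) (fun g => (B g)%:E) _ _ _ iB _.
- move=> N; apply/measurable_EFinP; rewrite /h; case: asboolP => // gN.
  by apply: measurable_average => // i j; exact: mA.
- exact/measurable_EFinP.
- apply: (@filterS _ _ (ae_filter_ringOfSetsType pi) _ _ _ AE).
  move=> g [wu Lg Ag Ad] _; rewrite /h.
  apply: cvg_EFin; first exact: nearW.
  apply/cvgrPdist_le => d d0.
  have d20 : 0 < d / 2 by rewrite divr_gt0.
  have [eta eta0 near_eta] := Ad _ d20.
  have Be : 2 * (2 * B g) * e N @[N --> \oo] --> 2 * (2 * B g) * 0.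
    exact: cvgMl_tmp.
  have near_e : \forall N \near \oo, e N < eta.
    by move/cvgr_lt : e0; apply.
  have near_B : \forall N \near \oo, 2 * (2 * B g) * e N < d / 2.
    by move/cvgr_lt : Be; apply; rewrite mulr0.
  near=> N; rewrite /= distrC asboolT; last by near: N; exact: ng.
  have gN : good N by near: N; exact: ng.
  have eN : e N < eta by near: N; exact: near_e.
  have BN : 2 * (2 * B g) * e N < d / 2 by near: N; exact: near_B.
  have AN : forall i j, (i < N)%N -> (j < N)%N ->
     `|x N i - pr a g| < eta -> `|y N j - pr b g| < eta ->
     `|A N g i j - L g| <= d / 2 by near: N; exact: near_eta.
  rewrite (le_trans (@close N g (d / 2) gN (ltW d20) Lg (wu N gN) _ _))//.
  + by move=> i j iN jN; exact: Ag.
  + by move=> i j iN jN xi yj; apply: AN => //; exact: lt_trans eN.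
  + lra.
- apply: (@filterS _ _ (ae_filter_ringOfSetsType pi) _ _ _ AE).
  move=> g [wu Lg Ag _] N _; rewrite /h lee_fin; case: asboolP => // gN.
  have [w1 u1 _ _] := wu N gN.
  have -> : B g = \sum_(i < N) \sum_(j < N) w N i (pr a g) * u N j (pr b g) * B g.
    under eq_bigr do rewrite -mulr_suml -mulr_sumr u1 mulr1.
    by rewrite -mulr_suml w1 mul1r.
  rewrite /average (le_trans (ler_norm_sum _ _ _))//; apply: ler_sum => i _.
  rewrite (le_trans (ler_norm_sum _ _ _))//; apply: ler_sum => j _.
  rewrite normrM ger0_norm ?mulr_ge0 ?w0 ?u0// ler_wpM2l//.
    by rewrite mulr_ge0 ?w0 ?u0.
  exact: Ag.
Unshelve. all: by end_near. Qed.

End relinked_averages.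

(** * Integrability of the energy *)

Section finite_support.
Variables (R : realType) (n : nat).
Local Notation X := 'rV[R]_n.

Lemma empiricalE N (x : nat -> X) (B : set (borel X)) :
  empirical N x B = (N%:R^-1 * \sum_(i < N) \1_B (x i))%:E.
Proof.
rewrite EFinM -sumEFin; congr (_ * _)%E; exact: eq_bigr.
Qed.

Lemma empirical_support N (x : nat -> X) (K : set X) i :
  empirical N x (~` K) = 0%E -> (i < N)%N -> K (x i).
Proof.
rewrite empiricalE => /eqP; rewrite eqe mulf_eq0 invr_eq0 pnatr_eq0 => /orP[/eqP->//|].
rewrite psumr_eq0 => [|j _]; last by rewrite indicE.
move=> /allP H iN; have := H (Ordinal iN) (mem_index_enum _).
rewrite /= indicE pnatr_eq0 eqb0 => /negP; apply: contra_notP => nK.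
by rewrite inE.
Qed.

End finite_support.

Section recovery.
Variables (R : realType) (n : nat) (m c2 : R) (V : 'rV[R]_n -> R) (a b : R).
Hypotheses (ab : a < b) (m0 : 0 < m) (c20 : 0 < c2) (cV : continuous V).
Hypothesis growth : forall z, `|V z| <= c2 * (1 + sqnorm z).
Hypothesis small : bounded_fun V \/ b - a <= Num.sqrt (m / (32 * c2)).
Variable T : nat -> seq R.
Hypotheses (fT : fine_sequence a b T) (pT : forall N, itv_partition a b (T N)).
Variable T' : nat -> seq R.
Hypothesis fT' : fine_sequence a b T'.
Local Notation X := 'rV[R]_n.
Local Notation P := (paths n a b).
Local Notation PS := (borel P).

Let aab : a <= a <= b. Proof. by rewrite lexx ltW. Qed.
Let bab : a <= b <= b. Proof. by rewrite lexx ltW. Qed.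
Let ba0 : 0 < b - a. Proof. by rewrite subr_gt0. Qed.

Definition potential_majorant (r M : R) : R :=
  c2 * (1 + (2 * r + 2 * ((b - a) * M))) * (b - a) + 1.

Lemma potential_bound r M (g : P) : sqnorm (pr a g) <= r ->
  (path_energy g <= M%:E)%E -> `|potential V g| <= potential_majorant r M.
Proof.
move=> gr gM; have [d [eta [d0 eta0 H]]] := dpotential_close ab cV g ltr01.
have [N mN] : exists N, mesh_lt a b d (T N).
  by have [N _ HN] := fT d0; exists N; apply: HN => /=.
have := H (T N) g mN; rewrite /potential_majorant.
move=> /(_ _)/le_trans h; have {h} : `|dpotential V (T N) g - potential V g| <= 1.
  by apply: H => // j _; rewrite subrr normr0.
have := dpotential_bound ab c20 growth (pT N) gr.
have pM : penergy (T N) g <= M by rewrite -lee_fin (le_trans _ gM)// penergy_le.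
have : c2 * (1 + (2 * r + 2 * ((b - a) * penergy (T N) g))) * (b - a) <=
    c2 * (1 + (2 * r + 2 * ((b - a) * M))) * (b - a).
  by rewrite ler_wpM2r ?(ltW ba0)// ler_wpM2l ?(ltW c20)// !lerD2l ler_wpM2l// ler_wpM2l// ltW.
have := ler_distD (dpotential V (T N) g) (potential V g) 0; rewrite !subr0 distrC.
lra.
Qed.

(** The limit of the coercivity estimate for fine partitions. *)
Lemma energy_le_action r C (g : P) : 
  (forall s (g : P), itv_partition a b s -> sqnorm (pr a g) <= r ->
     m / 4 * penergy s g - C <= daction m V s g) ->
  sqnorm (pr a g) <= r ->
  ((m / 4)%:E * path_energy g <= action m V g + (C + 1)%:E)%E.
Proof.
move=> coer gr; have [d [eta [d0 eta0 H]]] := dpotential_close ab cV g ltr01.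
have m40 : 0 < m / 4 by rewrite divr_gt0.
suff : ((potential V g)%:E <= (m / 4)%:E * path_energy g + (C + 1)%:E)%E.
  rewrite (actionE ab m0 cV fT pT) => h.
  case: (path_energy g) (path_energy_ge0 ab g) h => [E|_ _|]//.
    by rewrite -!EFinM -EFinB -!EFinD !lee_fin => _ h; nra.
  by rewrite !gt0_muley ?lte_fin ?divr_gt0// addye// addye.
have [N mN] : exists N, mesh_lt a b d (T N).
  by have [N _ HN] := fT d0; exists N; apply: HN => /=.
have : `|dpotential V (T N) g - potential V g| <= 1.
  by apply: H => // j _; rewrite subrr normr0.
rewrite ler_distl => /andP[h _].
have := coer (T N) g (pT N) gr; rewrite /daction => h2.
apply: (@le_trans _ _ ((m / 4 * penergy (T N) g) + (C + 1))%:E).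
  by rewrite lee_fin; lra.
by rewrite EFinD EFinM leeD2r// lee_wpmul2l ?lee_fin ?(ltW m40)// penergy_le.
Qed.

Variables (mu_a mu_b : probability (borel X) R) (pi : probability PS R).
Hypotheses (ma : has_marginal a pi mu_a) (mb : has_marginal b pi mu_b).
Variables (x y : nat -> nat -> X) (r : R).
Hypothesis r0 : 0 <= r.
Hypotheses (ar : {ae pi, forall g : PS, sqnorm (pr a g) <= r})
  (br : {ae pi, forall g : PS, sqnorm (pr b g) <= r}).
Hypothesis xr : forall N i, (i < N)%N -> sqnorm (x N i) <= r.
Hypothesis yr : forall N j, (j < N)%N -> sqnorm (y N j) <= r.

Lemma energy_integrable C : 0 <= C ->
  (forall s (g : P), itv_partition a b s -> sqnorm (pr a g) <= r ->
     m / 4 * penergy s g - C <= daction m V s g) ->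
  (\int[pi]_g action m V g < +oo)%E ->
  pi.-integrable setT (fun g : PS => path_energy g).
Proof.
move=> C0 coer fin; have mE := measurable_path_energy ab fT pT (n := n).
have mact := measurable_action ab m0 cV fT pT.
apply/integrableP; split => //.
pose F (g : PS) := maxe (action m V g + (C + 1)%:E)%E 0%E.
have mF : measurable_fun setT F.
  apply: measurable_maxe; last exact: measurable_cst.
  by apply: emeasurable_funD => //; exact: measurable_cst.
have F0 g : (0 <= F g)%E by rewrite /F le_max lexx orbT.
have EF : {ae pi, forall g : PS, ((m / 4)%:E * path_energy g <= F g)%E}.
  apply: (@filterS _ _ (ae_filter_ringOfSetsType pi) _ _ _ ar) => g gr.
  by rewrite /F le_max (energy_le_action coer gr).
have FE : (\int[pi]_g (F g + (- (C + 1))%:E) <= \int[pi]_g action m V g)%E.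
  apply: le_integral_ae => //.
    by apply: emeasurable_funD => //; exact: measurable_cst.
  apply: (@filterS _ _ (ae_filter_ringOfSetsType pi) _ _ _ ar) => g gr _.
  rewrite EFinN leeBlDr// /F ge_max lexx/=.
  rewrite (le_trans _ (energy_le_action coer gr))// mule_ge0 ?path_energy_ge0//.
  by rewrite lee_fin divr_ge0// ltW.
have Fi : (\int[pi]_g F g < +oo)%E.
  have := le_lt_trans FE fin; rewrite integralD_ge0_integrable//.
    by rewrite integral_constant; case: (\int[pi]_g F g)%E => // z _; rewrite ltry.
  exact: finite_measure_integrable_cst.
have : (\int[pi]_g ((m / 4)%:E * path_energy g) <= \int[pi]_g F g)%E.
  apply: le_integral_ae => //; first exact: measurable_funeM.
  by apply: (@filterS _ _ (ae_filter_ringOfSetsType pi) _ _ _ EF) => g + _.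
rewrite ge0_integralZl//; [|by move=> g _; exact: path_energy_ge0|
  by rewrite lee_fin divr_ge0// ltW].
move=> /le_lt_trans/(_ Fi) h.
under eq_integral do rewrite gee0_abs ?path_energy_ge0//.
move: h; have : (0 <= \int[pi]_g path_energy g)%E.
  by apply: integral_ge0 => g _; exact: path_energy_ge0.
case: (\int[pi]_g path_energy g)%E => [E _ _||//]; first by rewrite ltry.
by move=> _; rewrite gt0_muley// lte_fin divr_gt0.
Qed.

End recovery.

(** * Relinked paths near a path of finite energy *)

Section relinked_action.
Variables (R : realType) (n : nat) (m c2 : R) (V : 'rV[R]_n -> R) (a b : R).
Hypotheses (ab : a < b) (m0 : 0 < m) (c20 : 0 < c2) (cV : continuous V).
Hypothesis growth : forall z, `|V z| <= c2 * (1 + sqnorm z).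
Variable T : nat -> seq R.
Hypotheses (fT : fine_sequence a b T) (pT : forall N, itv_partition a b (T N)).
Variable T' : nat -> seq R.
Hypothesis fT' : fine_sequence a b T'.
Local Notation X := 'rV[R]_n.
Local Notation P := (paths n a b).

Let leab : a <= b := ltW ab.
Let ba0 : 0 < b - a. Proof. by rewrite subr_gt0. Qed.

Lemma relink_cvg (f : P -> R) (g : P) (d : R) : continuous f -> 0 < d ->
  exists2 eta : R, 0 < eta & \forall N \near \oo, forall x y,
    `|x - pr a g| < eta -> `|y - pr b g| < eta ->
    `|f (relink (T' N) x y g) - f g| <= d.
Proof.
move=> cf d0; have /continuous_pathsP/(_ d d0)[e e0 H] := cf g.
have e30 : 0 < e / 3 by rewrite divr_gt0.
exists (e / 3) => //; have [k k0 Hk] := path_interp_close ab g e30.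
apply: filterS (fT' k0) => N mN x y xg yg.
have := H (relink (T' N) x y g); rewrite -ball_normE /= distrC.
move=> h; apply/ltW/h => t tab.
have := relink_close ab (T' N) x y g tab; have := Hk _ mN t tab.
have := ler_distD (pr t (path_interp (T' N) g)) (pr t g) (pr t (relink (T' N) x y g)).
rewrite (distrC (pr t (path_interp _ _)) (pr t (relink _ _ _ _))).
lra.
Qed.

(** By [penergy_relink] this is the change of the energy, which vanishes for
    displacement 0 and is continuous. *)
Lemma tilt_perturbation (g : P) (d : R) : 0 < d -> exists2 eta : R, 0 < eta &
  forall x y, `|x - pr a g| < eta -> `|y - pr b g| < eta ->
  `|2 * dotp (pr b g - pr a g) (tilt x y g) + (b - a) * sqnorm (tilt x y g)| <= d.
Proof.
move=> d0; set v := pr b g - pr a g.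
(* Polarization turns the scalar product into squared norms, which are known to
   be continuous. *)
pose phi (z : X) := sqnorm (v + z) - sqnorm v - sqnorm z + (b - a) * sqnorm z.
have phiE z : 2 * dotp v z + (b - a) * sqnorm z = phi z.
  by rewrite /phi sqnormD; ring.
have cphi : continuous phi.
  move=> z0; rewrite /phi.
  apply: (@cvgD _ _ _ (nbhs z0) (nbhs_filter z0)).
    apply: (@cvgB _ _ _ (nbhs z0) (nbhs_filter z0)); last exact: continuous_sqnorm.
    apply: (@cvgB _ _ _ (nbhs z0) (nbhs_filter z0)); last exact: cst_continuous.
    apply: (@continuous_comp _ _ _ (fun z : X => v + z) (@sqnorm R n) z0); last first.
      exact: continuous_sqnorm.
    apply: (@cvgD _ _ _ (nbhs z0) (nbhs_filter z0)); first exact: cst_continuous.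
    exact: cvg_id.
  by apply: (@cvgMl_tmp _ _ _ (nbhs_filter z0)); exact: continuous_sqnorm.
have phi0 : phi 0 = 0 by rewrite /phi addr0 sqnorm0; ring.
have := cphi 0 => /cvgrPdist_le/(_ _ d0)/nbhs_ballP[e /= e0 He].
have eta0 : 0 < (b - a) * e / 2 by rewrite divr_gt0// mulr_gt0.
exists ((b - a) * e / 2) => // x y xg yg.
have := He (tilt x y g); rewrite /= phi0 sub0r normrN phiE; apply.
rewrite -ball_normE /= sub0r normrN /tilt normrZ gtr0_norm ?invr_gt0//.
rewrite mulrC ltr_pdivrMr// (le_lt_trans (ler_normB _ _))//.
by rewrite mulrC; lra.
Qed.

Lemma daction_relink_cvg (g : P) (d : R) : (path_energy g < +oo)%E -> 0 < d ->
  exists2 eta : R, 0 < eta & \forall N \near \oo, forall x y,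
    `|x - pr a g| < eta -> `|y - pr b g| < eta ->
    `|daction m V (T' N) (relink (T' N) x y g) - fine (action m V g)| <= d.
Proof.
move=> Efin d0.
have d40 : 0 < d / 4 by rewrite divr_gt0.
have dm0 : 0 < d / (2 * m) by rewrite divr_gt0// mulr_gt0.
have [eta1 eta10 H1] := tilt_perturbation g dm0.
have [k [eta2 [k0 eta20 H2]]] := dpotential_close ab cV g d40.
have Ef : path_energy g \is a fin_num by rewrite ge0_fin_numE ?path_energy_ge0.
have H3 : \forall N \near \oo, `|fine (path_energy g) - penergy (T' N) g| <= d / (2 * m).
  have : (penergy (T' N) g)%:E @[N --> \oo] --> (fine (path_energy g))%:E.
    by rewrite fineK//; exact: (@cvg_penergy _ _ _ _ ab T' g fT').
  by move=> /fine_cvgP[_ /cvgrPdist_le/(_ _ dm0)].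
exists (Num.min eta1 (eta2 / 2)); first by rewrite lt_min eta10 divr_gt0.
apply: filterS2 (fT' k0) H3 => N mN eN x y; rewrite !lt_min => /andP[x1 x2] /andP[y1 y2].
rewrite (actionE ab m0 cV fT pT) -(fineK Ef) /= /daction.
rewrite (penergy_relink _ _ _ mN.1).
have h1 := H1 x y x1 y1.
have h2 : `|dpotential V (T' N) (relink (T' N) x y g) - potential V g| <= d / 4.
  apply: H2 => // j js; rewrite (pr_relink_node _ _ _ mN.1 js) addrAC subrr add0r.
  rewrite (le_lt_trans (correction_le ab _ _ _ (node_itv mN.1 js)))//.
  by rewrite (splitr eta2) ltrD.
move: h1 h2 eN; set E := fine _; set Q := penergy _ g; set D := dpotential _ _ _.
set W := 2 * _ + _; set U := potential _ _ => h1 h2 h3.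
have -> : m / 2 * (Q + 2 * dotp (pr b g - pr a g) (tilt x y g) +
    (b - a) * sqnorm (tilt x y g)) - D - (m / 2 * E - U) =
    m / 2 * W - (D - U) - m / 2 * (E - Q).
  by rewrite /W; ring.
have m20 : 0 < m / 2 by rewrite divr_gt0.
have k1 : `|m / 2 * W| <= d / 4.
  rewrite normrM gtr0_norm// (le_trans (ler_wpM2l (ltW m20) h1))//.
  by rewrite le_eqVlt; apply/orP; left; apply/eqP; field; rewrite gt_eqF.
have k3 : `|m / 2 * (E - Q)| <= d / 4.
  rewrite normrM gtr0_norm// (le_trans (ler_wpM2l (ltW m20) h3))//.
  by rewrite le_eqVlt; apply/orP; left; apply/eqP; field; rewrite gt_eqF.
have := ler_normB (m / 2 * W - (D - U)) (m / 2 * (E - Q)).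
have := ler_normB (m / 2 * W) (D - U).
lra.
Qed.

Lemma daction_relink_bound r : 0 <= r -> exists A B : R,
  [/\ 0 <= A, 0 <= B & forall (g : P), (path_energy g < +oo)%E ->
   sqnorm (pr a g) <= r -> sqnorm (pr b g) <= r ->
   `|fine (action m V g)| <= A * fine (path_energy g) + B /\
   forall s x y, itv_partition a b s -> sqnorm x <= r -> sqnorm y <= r ->
   `|daction m V s (relink s x y g)| <= A * fine (path_energy g) + B].
Proof.
move=> r0; have [K K0 HK] := penergy_relink_close n ab r0.
pose M E := m / 2 * (E + K) + potential_majorant c2 a b r (E + K).
pose A := m / 2 + c2 * (2 * (b - a)) * (b - a).
pose B := M 0.
have m20 : 0 < m / 2 by rewrite divr_gt0.
have ba0' := ltW ba0; have c20' := ltW c20.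
have ME E : M E = A * E + B.
  by rewrite /B /M /A /potential_majorant; ring.
have maj E E' : E <= E' -> potential_majorant c2 a b r E <= potential_majorant c2 a b r E'.
  move=> EE; rewrite /potential_majorant lerD2r ler_wpM2r// ler_wpM2l// !lerD2l.
  by rewrite ler_wpM2l// ler_wpM2l.
exists A, B; split.
- by rewrite addr_ge0 ?(ltW m20)// !mulr_ge0.
- have h : 0 <= (b - a) * K by exact: mulr_ge0.
  have h' : 0 <= c2 * (1 + (2 * r + 2 * ((b - a) * K))) * (b - a).
    by apply: mulr_ge0 => //; apply: mulr_ge0 => //; lra.
  rewrite /B /M add0r /potential_majorant; have := mulr_ge0 (ltW m20) K0; lra.
move=> g Efin ga gb.
have Ef : path_energy g \is a fin_num by rewrite ge0_fin_numE ?path_energy_ge0.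
have E0 : 0 <= fine (path_energy g) by rewrite fine_ge0// path_energy_ge0.
split.
  rewrite -ME (actionE ab m0 cV fT pT) -{1}(fineK Ef) /=.
  rewrite (le_trans (ler_normB _ _))// lerD//.
    rewrite (ger0_norm (mulr_ge0 (ltW m20) E0)).
    by apply: ler_wpM2l; [exact: ltW|rewrite lerDl].
  rewrite (le_trans (potential_bound ab c20 cV growth fT pT ga (M := fine (path_energy g)) _))//.
    by rewrite fineK.
  by apply: maj; rewrite lerDl.
move=> s x y abs xr yr; rewrite -ME /daction.
have pE : penergy s (relink s x y g) <= fine (path_energy g) + K.
  rewrite (le_trans (HK s x y g abs xr yr ga gb))// lerD2r.
  by rewrite -lee_fin fineK// penergy_le.
rewrite (le_trans (ler_normB _ _))// lerD//.
  rewrite ger0_norm; last by apply: mulr_ge0; [exact: ltW|exact: penergy_ge0].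
  by apply: ler_wpM2l => //; exact: ltW.
have ra : sqnorm (pr a (relink s x y g)) <= r by rewrite relink_a.
rewrite (le_trans (dpotential_bound ab c20 growth abs ra))//.
rewrite (le_trans _ (maj _ _ pE))// /potential_majorant lerDl//.
Qed.

End relinked_action.

(** * The mixtures of relinked paths *)

Section recovery_sequence.
Variables (R : realType) (n : nat) (a b : R).
Hypothesis ab : a < b.
Local Notation X := 'rV[R]_n.
Local Notation P := (paths n a b).
Local Notation PS := (borel P).
Variables (mu_a mu_b : probability (borel X) R) (pi : probability PS R).
Hypotheses (ma : has_marginal a pi mu_a) (mb : has_marginal b pi mu_b).
Variables (x y : nat -> nat -> X) (T : nat -> seq R).

Let aab : a <= a <= b. Proof. by rewrite lexx ltW. Qed.
Let bab : a <= b <= b. Proof. by rewrite lexx ltW. Qed.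

(** A diagonal sequence lets the scale of the weights tend to 0 with N. *)
Lemma good_sequences (Ka Kb : set X) : compact Ka -> mu_a (~` Ka) = 0%E ->
  compact Kb -> mu_b (~` Kb) = 0%E ->
  weak_cvg (fun N => empirical N (x N)) mu_a ->
  weak_cvg (fun N => empirical N (y N)) mu_b -> fine_sequence a b T ->
  exists w u e, e N @[N --> \oo] --> (0 : R) /\
    \forall N \near \oo, good a b mu_a mu_b x y w u e T N.
Proof.
move=> cKa Ka0 cKb Kb0 wx wy fT.
pose Q N (d : R) (wu : (nat -> X -> R) * (nat -> X -> R)) :=
  good_weights mu_a x N d wu.1 /\ good_weights mu_b y N d wu.2.
have [|e e0 He] := @diagonal_choice R (fun N d => exists wu, Q N d wu).
  move=> d d01.
  apply: filterS2 (good_weights_ex cKa Ka0 wx d01) (good_weights_ex cKb Kb0 wy d01).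
  by move=> N [w gw] [u gu]; exists (w, u).
have ex N : exists v', (exists v, Q N (e N) v) -> Q N (e N) v'.
  have [[v Qv]|nQ] := pselect (exists v, Q N (e N) v); first by exists v.
  by exists (fun _ _ => 0, fun _ _ => 0).
have [wu Hwu] := choice ex.
exists (fun N => (wu N).1), (fun N => (wu N).2), e; split => //.
near=> N; have [h1 h2] : Q N (e N) (wu N) by apply: Hwu; near: N.
split => //; first by near: N; exact: nbhs_infty_gt.
suff : mesh_lt a b 1 (T N) by case.
by near: N; exact: fT.
Unshelve. all: by end_near. Qed.

Variables (w u : nat -> nat -> X -> R) (e : nat -> R).
Local Notation good := (good a b mu_a mu_b x y w u e T).
Local Notation link N i j g := (relink (T N) (x N i) (y N j) g).
Local Notation weight N i j g := (w N i (pr a g) * u N j (pr b g)).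

(** The law of the path obtained from a random path [g] by moving its end points
    to [x N i] and [y N j] with probability [weight N i j g]. *)
Definition is_mixture N (rho : probability PS R) :=
  forall F : PS -> \bar R, measurable_fun setT F -> (forall g, (0 <= F g)%E) ->
  (\int[rho]_g F g = \int[pi]_g
     \sum_(i < N) \sum_(j < N) (weight N i j g)%:E * F (link N i j g))%E.

Lemma mixture_ex N : good N -> exists rho, is_mixture N rho.
Proof.
move=> gN; have [[cw w0 _ _] [cu u0 _ _] _ abs] := gN.
have ae := @ae_good _ _ _ _ ab _ _ _ ma mb x y w u e T.
have mp t : a <= t <= b -> forall f : X -> R, continuous f ->
    measurable_fun [set: PS] (fun g : PS => f (pr t g)).
  move=> tab f cf; apply: continuous_measurable_real => g.
  by apply: (@continuous_comp _ _ _ (pr t) f); [exact: continuous_pr|exact: cf].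
have [||||||rho Hrho] // := @weighted_mixture _ _ PS PS R pi N
  (fun i g => w N i (pr a g)) (fun j g => u N j (pr b g))
  (fun i j (g : PS) => link N i j g : PS) (fun i g => w0 i _) (fun j g => u0 j _).
- by move=> i; exact: mp.
- by move=> j; exact: mp.
- by move=> i j; apply: continuous_measurable_borel; exact: continuous_relink.
- exact: probability_setT.
- by apply: (@filterS _ _ (ae_filter_ringOfSetsType pi) _ _ _ ae) => g /(_ _ gN)[].
- by apply: (@filterS _ _ (ae_filter_ringOfSetsType pi) _ _ _ ae) => g /(_ _ gN)[].
by exists rho.
Qed.

Lemma mixture_integral N rho (F : PS -> R) (c : R) : good N -> is_mixture N rho ->
  measurable_fun setT F -> (forall g, 0 <= F g + c) ->
  (\int[rho]_g (F g + c)%:E = \int[pi]_g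
     (average w u N (fun i j => F (link N i j g) + c) g)%:E)%E.
Proof.
move=> gN mix mF F0; rewrite mix//.
- apply: eq_integral => g _; rewrite /average -sumEFin; apply: eq_bigr => i _.
  by rewrite -sumEFin; apply: eq_bigr.
- by apply/measurable_EFinP; apply: measurable_funD.
Qed.

Let measurable_weight t (f : X -> R) : a <= t <= b -> continuous f ->
  measurable_fun [set: PS] (fun g : PS => f (pr t g)).
Proof.
move=> tab cf; apply: continuous_measurable_real => g.
by apply: (@continuous_comp _ _ _ (pr t) f); [exact: continuous_pr|exact: cf].
Qed.

Let integral_sum_weights N t (nu : probability (borel X) R) (v : nat -> X -> R)
    (h : nat -> R) : a <= t <= b -> has_marginal t pi nu ->
  (forall i, continuous (v i)) -> (forall i z, 0 <= v i z) ->
  (forall i, (\int[nu]_z (v i z)%:E = (N%:R^-1)%:E)%E) -> (forall i, 0 <= h i) ->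
  (\int[pi]_g (\sum_(i < N) v i (pr t g) * h i)%:E =
   (N%:R^-1 * \sum_(i < N) h i)%:E)%E.
Proof.
move=> tab mt cv v0 vI h0.
under eq_integral do rewrite -sumEFin.
rewrite ge0_integral_sum//; last 2 first.
- by move=> i; apply/measurable_EFinP; apply: measurable_funM => //;
    exact: measurable_weight.
- by move=> i g _; rewrite lee_fin mulr_ge0.
rewrite mulr_sumr -sumEFin; apply: eq_bigr => i _.
under eq_integral do rewrite EFinM muleC.
rewrite ge0_integralZl//.
- by rewrite (ge0_integral_marginal tab mt (cv i) (v0 i)) vI -EFinM mulrC.
- by apply/measurable_EFinP; exact: measurable_weight.
- by move=> g _; rewrite lee_fin.
- by rewrite lee_fin.
Qed.

Lemma integral_average_a N (h : nat -> R) : good N -> (forall i, 0 <= h i) ->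
  (\int[pi]_g (average w u N (fun i _ => h i) g)%:E =
   (N%:R^-1 * \sum_(i < N) h i)%:E)%E.
Proof.
move=> gN h0; have [[cw w0 wI _] _ _ _] := gN.
rewrite -(integral_sum_weights (h := h) aab ma cw w0 wI)//.
have ae := @ae_good _ _ _ _ ab _ _ _ ma mb x y w u e T.
apply: ae_eq_integral => //.
- by apply/measurable_EFinP; apply: (@measurable_average _ _ _ _ ab _ _ x y w u e T N (fun _ i _ => h i) gN).
- apply/measurable_EFinP; apply: measurable_sum => i.
  by apply: measurable_funM => //; exact: measurable_weight.
apply: (@filterS _ _ (ae_filter_ringOfSetsType pi) _ _ _ ae) => g.
move=> /(_ _ gN)[_ u1 _ _] _; congr EFin; apply: eq_bigr => i _.
by rewrite -mulr_suml -mulr_sumr u1 mulr1.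
Qed.

Lemma integral_average_b N (h : nat -> R) : good N -> (forall j, 0 <= h j) ->
  (\int[pi]_g (average w u N (fun _ j => h j) g)%:E =
   (N%:R^-1 * \sum_(j < N) h j)%:E)%E.
Proof.
move=> gN h0; have [_ [cu u0 uI _] _ _] := gN.
rewrite -(integral_sum_weights (h := h) bab mb cu u0 uI)//.
have ae := @ae_good _ _ _ _ ab _ _ _ ma mb x y w u e T.
apply: ae_eq_integral => //.
- by apply/measurable_EFinP; apply: (@measurable_average _ _ _ _ ab _ _ x y w u e T N (fun _ _ j => h j) gN).
- apply/measurable_EFinP; apply: measurable_sum => i.
  by apply: measurable_funM => //; exact: measurable_weight.
apply: (@filterS _ _ (ae_filter_ringOfSetsType pi) _ _ _ ae) => g.
move=> /(_ _ gN)[w1 _ _ _] _; congr EFin; rewrite /average exchange_big/=.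
by apply: eq_bigr => j _; rewrite -2!mulr_suml w1 mul1r.
Qed.

(** The starting point of a relinked path is exactly [x N i], which is chosen
    with total probability 1 / N. *)
Lemma mixture_marginals N rho : good N -> is_mixture N rho ->
  has_marginal a rho (empirical N (x N)) /\ has_marginal b rho (empirical N (y N)).
Proof.
move=> gN mix; have [_ _ _ abs] := gN.
have main t (z : nat -> nat -> X) (B : set (borel X)) : a <= t <= b ->
    measurable B -> pushforward rho (pr t : PS -> borel X) B =
    (\int[pi]_g (average w u N (fun i j => \1_B (pr t (link N i j g))) g)%:E)%E.
  move=> tab mB; have mpB : measurable (pr t @^-1` B : set PS).
    by rewrite -[X in measurable X]setTI; apply: (measurable_pr tab).
  transitivity (\int[rho]_g (\1_(pr t @^-1` B) g)%:E)%E.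
    by rewrite integral_indic// setIT.
  rewrite mix//; last first.
    by apply/measurable_EFinP; exact: measurable_indic.
  apply: eq_integral => g _; rewrite /average -sumEFin; apply: eq_bigr => i _.
  by rewrite -sumEFin; apply: eq_bigr => j _; rewrite EFinM.
split => B mB; rewrite main// empiricalE.
- rewrite -(integral_average_a (h := fun i => \1_B (x N i)) gN)//.
  apply: eq_integral => g _; congr EFin; apply: eq_bigr => i _.
  by apply: eq_bigr => j _; rewrite relink_a.
- rewrite -(integral_average_b (h := fun j => \1_B (y N j)) gN)//.
  apply: eq_integral => g _; congr EFin; apply: eq_bigr => i _.
  by apply: eq_bigr => j _; rewrite relink_b.
Qed.

End recovery_sequence.

(** * The recovery sequence *)

Lemma integral_shift d (T : measurableType d) (R : realType)
    (P : probability T R) (f : T -> R) (c : R) :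
  P.-integrable setT (fun t => (f t)%:E) ->
  (\int[P]_t (f t + c)%:E = \int[P]_t (f t)%:E + c%:E)%E.
Proof.
move=> fi; under eq_integral do rewrite EFinD.
rewrite (@integralD_EFin _ _ _ P setT measurableT f (cst c))//.
  by rewrite integral_constant.
exact: finite_measure_integrable_cst.
Qed.

Section recovery.
Variables (R : realType) (n : nat) (m c2 : R) (V : 'rV[R]_n -> R) (a b : R).
Hypotheses (ab : a < b) (m0 : 0 < m) (c20 : 0 < c2) (cV : continuous V).
Hypothesis growth : forall z, `|V z| <= c2 * (1 + sqnorm z).
Hypothesis small : bounded_fun V \/ b - a <= Num.sqrt (m / (32 * c2)).
Variable T : nat -> seq R.
Hypotheses (fT : fine_sequence a b T) (pT : forall N, itv_partition a b (T N)).
Variable T' : nat -> seq R.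
Hypothesis fT' : fine_sequence a b T'.
Local Notation X := 'rV[R]_n.
Local Notation P := (paths n a b).
Local Notation PS := (borel P).
Variables (mu_a mu_b : probability (borel X) R) (pi : probability PS R).
Hypotheses (ma : has_marginal a pi mu_a) (mb : has_marginal b pi mu_b).
Variables (x y : nat -> nat -> X) (Ka Kb K : set X).
Hypotheses (cKa : compact Ka) (Ka0 : mu_a (~` Ka) = 0%E).
Hypotheses (cKb : compact Kb) (Kb0 : mu_b (~` Kb) = 0%E).
Hypothesis cK : compact K.
Hypothesis supp : forall N, (0 < N)%N ->
  empirical N (x N) (~` K) = 0%E /\ empirical N (y N) (~` K) = 0%E.
Hypotheses (wx : weak_cvg (fun N => empirical N (x N)) mu_a)
  (wy : weak_cvg (fun N => empirical N (y N)) mu_b).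

Let aab : a <= a <= b. Proof. by rewrite lexx ltW. Qed.
Let bab : a <= b <= b. Proof. by rewrite lexx ltW. Qed.

Let compact_null (nu : probability (borel X) R) (Q : set X) r : compact Q ->
  nu (~` Q) = 0%E -> (forall z, Q z -> sqnorm z <= r) ->
  {ae nu, forall z : borel X, sqnorm z <= r}.
Proof.
move=> cQ Q0 Qr; exists (~` Q); split => //.
- exact: measurableC_compact.
- by move=> z /= nr Qz; apply: nr; exact: Qr.
Qed.

(** Both convergences are instances of [averages_cvg], for a test function and
    for the discrete action. The constant [C] makes the discrete action
    nonnegative on paths that start in the support, as the formula for mixtures
    demands; the majorant is an affine function of the energy. *)
Lemma recovery_sequence : (\int[pi]_g action m V g < +oo)%E ->
  exists pi_ : nat -> probability PS R, weak_cvg (fun N => pi_ N) pi /\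
   constrained_mean (discrete_action m V (T' N))
      (empirical N (x N)) (empirical N (y N)) (pi_ N) @[N --> \oo] -->
   (\int[pi]_g action m V g)%E.
Proof.
move=> fin.
have [ra ra0 Hra] := compact_sqnorm_bounded cKa.
have [rb rb0 Hrb] := compact_sqnorm_bounded cKb.
have [rx rx0 Hrx] := compact_sqnorm_bounded cK.
pose r := ra + rb + rx.
have r0 : 0 <= r by rewrite /r !addr_ge0.
have ar : {ae pi, forall g : PS, sqnorm (pr a g) <= r}.
  apply: (ae_marginal (Q := fun z => sqnorm z <= r) aab ma).
  by apply: (compact_null cKa Ka0) => z /Hra; rewrite /r; lra.
have br : {ae pi, forall g : PS, sqnorm (pr b g) <= r}.
  apply: (ae_marginal (Q := fun z => sqnorm z <= r) bab mb).
  by apply: (compact_null cKb Kb0) => z /Hrb; rewrite /r; lra.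
have xr N i : (i < N)%N -> sqnorm (x N i) <= r.
  move=> iN; have N0 : (0 < N)%N by exact: leq_ltn_trans iN.
  by have := Hrx _ (empirical_support (supp N0).1 iN); rewrite /r; lra.
have yr N i : (i < N)%N -> sqnorm (y N i) <= r.
  move=> iN; have N0 : (0 < N)%N by exact: leq_ltn_trans iN.
  by have := Hrx _ (empirical_support (supp N0).2 iN); rewrite /r; lra.
have [w [u [e [e0 ng]]]] := good_sequences cKa Ka0 cKb Kb0 wx wy fT'.
pose gd := good a b mu_a mu_b x y w u e T'.
pose link N i j (g : P) := relink (T' N) (x N i) (y N j) g.
have ex N : exists rho, gd N -> is_mixture pi x y T' w u N rho.
  have [gN|ngN] := pselect (gd N); last by exists pi.
  by have [rho Hrho] := mixture_ex ab ma mb gN; exists rho.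
have [rho Hrho] := choice ex.
have clink N i j : gd N -> continuous (link N i j).
  by move=> [_ _ _ abs]; exact: continuous_relink.
exists rho; split.
  move=> f cf [M0 [_ HM0]]; pose M := `|M0| + 1.
  have M_ge0 : 0 <= M by rewrite /M addr_ge0.
  have fM g : `|f g| <= M.
    by apply: (HM0 M) => //; rewrite /M (le_lt_trans (ler_norm M0))// ltrDl.
  have fM0 g : 0 <= f g + M by have := fM g; rewrite ler_norml => /andP[? _]; lra.
  have fi (Q : probability PS R) : Q.-integrable setT (fun g : PS => (f g)%:E).
    apply: (bounded_integrable cf _ fM).
    exact: probability_lty.
  have flink N i j : gd N ->
      measurable_fun [set: PS] (fun g : PS => f (link N i j g) + M).
    move=> gN; apply: measurable_funD => //; apply: continuous_measurable_real => g.
    by apply: (@continuous_comp _ _ _ (link N i j) f); [exact: clink|exact: cf].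
  have [||||||_ H] := averages_cvg ab ma mb e0
    (A := fun N g i j => f (link N i j g) + M) (L := fun g => f g + M)
    (B := fun=> 2 * M) ng.
  - by move=> N i j; exact: flink.
  - by apply: measurable_funD => //; exact: continuous_measurable_real.
  - exact: finite_measure_integrable_cst.
  - by apply: aeW => g; rewrite ger0_norm//; have := fM g; rewrite ler_norml => /andP[_ ?]; lra.
  - apply: aeW => g N i j _ _ _; rewrite ger0_norm//.
    by have := fM (link N i j g); rewrite ler_norml => /andP[_ ?]; lra.
  - apply: aeW => g d d0; have [eta eta0 He] := relink_cvg ab fT' g cf d0.
    exists eta => //; apply: filterS He => N HN i j _ _ xg yg.
    by rewrite opprD addrACA subrr addr0; exact: HN.
  have E (Q : probability PS R) :
      (\int[Q]_g (f g)%:E = \int[Q]_g (f g + M)%:E - M%:E)%E.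
    by rewrite integral_shift// addeK.
  rewrite (E pi); apply: cvg_trans (cvgeB _ H (cvg_cst _)); last first.
    exact: fin_num_adde_defl.
  apply: near_eq_cvg; apply: filterS ng => N gN; rewrite (E (rho N)).
  by rewrite (mixture_integral gN (Hrho N gN))//; exact: continuous_measurable_real.
have [C C0 coer] := daction_coercive ab m0 c20 growth r small.
have iE := energy_integrable ab m0 cV fT pT ar C0 coer fin.
have Efin : {ae pi, forall g : PS, (path_energy g < +oo)%E}.
  apply: (@filterS _ _ (ae_filter_ringOfSetsType pi) _ _ _ (integrable_ae measurableT iE)).
  by move=> g /(_ I); rewrite ge0_fin_numE ?path_energy_ge0.
have [A [B [A0 B0 HAB]]] := daction_relink_bound ab m0 c20 cV growth fT pT r0.
have good_g : {ae pi, forall g : PS, [/\ (path_energy g < +oo)%E,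
    sqnorm (pr a g) <= r & sqnorm (pr b g) <= r]}.
  by apply: (@filterS3 _ _ (ae_filter_ringOfSetsType pi) _ _ _ _ _ Efin ar br).
pose L (g : P) := fine (action m V g) + C.
have mact := measurable_action ab m0 cV fT pT.
have coer0 s (g : P) : itv_partition a b s -> sqnorm (pr a g) <= r ->
    0 <= daction m V s g + C.
  move=> abs gr; have := coer s g abs gr; have := penergy_ge0 g abs.
  move=> h; have : 0 <= m / 4 * penergy s g by rewrite mulr_ge0// divr_ge0// ltW.
  lra.
have [||||||iL H] := averages_cvg ab ma mb e0
    (A := fun N g i j => daction m V (T' N) (link N i j g) + C) (L := L)
    (B := fun g => A * fine (path_energy g) + (B + C)) ng.
- move=> N i j gN; have [_ _ _ abs] := gN.
  apply: measurable_funD => //; apply: continuous_measurable_real => g.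
  apply: (@continuous_comp _ _ _ (link N i j) (daction m V (T' N))); first exact: clink.
  exact: continuous_daction.
- by apply: measurable_funD => //; apply: measurableT_comp => //.
- under eq_fun do rewrite EFinD EFinM.
  apply: integrableD => //; last exact: finite_measure_integrable_cst.
  apply: integrableZl => //; apply: (le_integrable measurableT _ _ iE) => /=.
    apply/measurable_EFinP; apply: measurableT_comp => //.
    exact: (measurable_path_energy ab fT pT).
  by move=> g _; case: (path_energy g) => //= *; rewrite normr0 leey.
- apply: (@filterS _ _ (ae_filter_ringOfSetsType pi) _ _ _ good_g) => g [Eg ga gb].
  have [h _] := HAB g Eg ga gb; rewrite (le_trans (ler_normD _ _))// addrA lerD//.
  by rewrite ger0_norm.
- apply: (@filterS _ _ (ae_filter_ringOfSetsType pi) _ _ _ good_g) => g [Eg ga gb].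
  move=> N i j [_ _ _ abs] iN jN.
  have [_ h] := HAB g Eg ga gb; rewrite (le_trans (ler_normD _ _))// addrA lerD//.
    by apply: h => //; [exact: xr|exact: yr].
  by rewrite ger0_norm.
- apply: (@filterS _ _ (ae_filter_ringOfSetsType pi) _ _ _ good_g) => g [Eg ga gb] d d0.
  have [eta eta0 He] := daction_relink_cvg ab m0 cV fT pT fT' Eg d0.
  exists eta => //; apply: filterS He => N HN i j _ _ xg yg.
  by rewrite /L opprD addrACA subrr addr0; exact: HN.
have -> : (\int[pi]_g action m V g = \int[pi]_g (L g)%:E - C%:E)%E.
  rewrite -EFinN -integral_shift//; apply: ae_eq_integral => //.
    apply/measurable_EFinP; do 2 apply: measurable_funD => //.
    exact: measurableT_comp.
  apply: (@filterS _ _ (ae_filter_ringOfSetsType pi) _ _ _ Efin) => g Eg _.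
  rewrite /L addrK fineK//.
  have : path_energy g \is a fin_num by rewrite ge0_fin_numE ?path_energy_ge0.
  by rewrite (actionE ab m0 cV fT pT); case: (path_energy g).
apply: cvg_trans (cvgeB _ H (cvg_cst _)); last exact: fin_num_adde_defl.
apply: near_eq_cvg; apply: filterS ng => N gN.
have [_ _ N0 abs] := gN.
have [hma hmb] := mixture_marginals ab ma mb gN (Hrho N gN).
rewrite /constrained_mean asboolT; last first.
  by move=> Q mQ; split; [exact: hma|exact: hmb].
(* The truncation makes the discrete action nonnegative everywhere, as the
   formula for mixtures demands; it changes nothing on paths that start in K. *)
pose F (g : PS) := maxe (discrete_action m V (T' N) g + C%:E)%E 0%E.
have mF : measurable_fun setT F.
  apply: measurable_maxe; last exact: measurable_cst.
  apply: emeasurable_funD; last exact: measurable_cst.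
  exact: measurable_discrete_action.
have F0 g : (0 <= F g)%E by rewrite /F le_max lexx orbT.
have Flink i j g : (i < N)%N -> F (link N i j g) = (daction m V (T' N) (link N i j g) + C)%:E.
  move=> iN; rewrite /F discrete_actionE asboolT; last exact: piecewise_affine_relink.
  rewrite -EFinD -EFin_max max_l//; apply: coer0 => //.
  by rewrite relink_a//; exact: xr.
have mK : measurable (~` K : set (borel X)).
  exact: measurableC_compact.
have -> : (\int[rho N]_g discrete_action m V (T' N) g =
    \int[rho N]_g (F g + (- C)%:E))%E.
  have eqF := @integral_eq_off_null _ PS R (rho N) setT (pr a @^-1` (~` K) : set PS)
    (fun g : PS => discrete_action m V (T' N) g) (fun g : PS => F g + (- C)%:E)%E.
  apply: eqF.
  - by rewrite -[X in measurable X]setTI; apply: (measurable_pr aab).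
  - by rewrite -(supp N0).1; exact: hma.
  move=> g _ /= /contrapT Kg.
  have gr : sqnorm (pr a g) <= r by have := Hrx _ Kg; rewrite /r; lra.
  rewrite /F discrete_actionE; case: asboolP => _; last by rewrite addye// max_l// leey.
  by rewrite -EFinD -EFin_max max_l ?coer0// -EFinD addrK.
rewrite integralD_ge0_integrable//; last exact: finite_measure_integrable_cst.
rewrite integral_constant EFinN (Hrho N gN)//; congr (_ - _)%E.
apply: eq_integral => g _; rewrite /average -sumEFin; apply: eq_bigr => i _.
by rewrite -sumEFin; apply: eq_bigr => j _; rewrite Flink// EFinM.
Qed.

End recovery.

(** * Gamma-convergence *)

Lemma limn_einf_pinfty (R : realType) (v : nat -> \bar R) :
  limn_einf v = +oo%E -> v N @[N --> \oo] --> +oo%E.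
Proof.
rewrite limn_einf_lim => v_oo.
have : einfs v N @[N --> \oo] --> +oo%E by rewrite -v_oo; exact: is_cvg_einfs.
move=> /cvgeyPge H; apply/cvgeyPge => A; apply: filterS (H A) => N /le_trans; apply.
by apply: ge_ereal_inf; exists (v N) => //; exists N => /=.
Qed.

Lemma triangulation_fine (R : realType) (a b : R) (tri : R -> seq R) (h : nat -> R) :
  (forall r, 0 < r -> triangulation a b r (tri r)) ->
  (forall N, (0 < N)%N -> 0 < h N) -> h N @[N --> \oo] --> (0 : R) ->
  fine_sequence a b (fun N => tri (h N)).
Proof.
move=> Htri h0 hcv d d0; near=> N.
have N0 : (0 < N)%N by near: N; exact: nbhs_infty_gt.
have hd : h N < d by near: N; move/cvgr_lt : hcv; apply.
have [part mesh] := Htri _ (h0 N N0); split => // j js.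
exact: le_lt_trans (mesh j js) hd.
Unshelve. all: by end_near. Qed.
Theorem theorem5p1 (R : realType) (n : nat) (m c2 : R) (V : 'rV[R]_n -> R)
  (a b : R) (tri : R -> seq R) (h : nat -> R)
  (mu_a mu_b : probability (borel 'rV[R]_n) R)
  (x y : nat -> nat -> 'rV[R]_n) :
  0 < m -> smooth V ->
  0 < c2 -> (forall z, `|V z| <= c2 * (1 + sqnorm z)) ->
  a < b ->
  (forall r, 0 < r -> triangulation a b r (tri r)) ->
  bounded_fun V \/ b - a <= Num.sqrt (m / (32 * c2)) ->
  (forall N, (0 < N)%N -> 0 < h N) -> h N @[N --> \oo] --> (0 : R) ->
  (exists2 K : set 'rV[R]_n, compact K & mu_a (~` K) = 0%E) ->
  (exists2 K : set 'rV[R]_n, compact K & mu_b (~` K) = 0%E) ->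
  mu_a `<< @lebesgue_outer R n -> mu_b `<< @lebesgue_outer R n ->
  (forall N i j, (i < N)%N -> (j < N)%N -> i != j -> x N i != x N j) ->
  (exists2 K : set 'rV[R]_n, compact K & forall N, (0 < N)%N ->
     empirical N (x N) (~` K) = 0%E /\ empirical N (y N) (~` K) = 0%E) ->
  weak_cvg (fun N => empirical N (x N)) mu_a ->
  weak_cvg (fun N => empirical N (y N)) mu_b ->
  let A_N (N : nat) (pi : probability (borel (paths n a b)) R) :=
    constrained_mean (discrete_action m V (tri (h N)))
      (empirical N (x N)) (empirical N (y N)) pi in
  let A (pi : probability (borel (paths n a b)) R) :=
    constrained_mean (action m V) mu_a mu_b pi in
  (forall (pi_ : nat -> probability (borel (paths n a b)) R)
          (pi : probability (borel (paths n a b)) R),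
     weak_cvg (fun N => pi_ N) pi ->
     (A pi <= limn_einf (fun N => A_N N (pi_ N)))%E) /\
  (forall pi : probability (borel (paths n a b)) R,
     exists pi_ : nat -> probability (borel (paths n a b)) R,
       weak_cvg (fun N => pi_ N) pi /\
       A_N N (pi_ N) @[N --> \oo] --> A pi).

Proof.
move=> m0 sV c20 growth ab Htri small h0 hcv [Ka cKa Ka0] [Kb cKb Kb0] _ _ _.
move=> [K cK supp] wx wy A_N A.
have cV : continuous V := (sV [::]).1.
pose T N := tri (N.+1%:R^-1 : R).
have pT N : itv_partition a b (T N).
  by have [] := Htri (N.+1%:R^-1); rewrite ?invr_gt0 ?ltr0n.
have fT : fine_sequence a b T.
  by apply: triangulation_fine => //; exact: cvg_harmonic.
have fT' := triangulation_fine Htri h0 hcv.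
have liminf (pi_ : nat -> probability (borel (paths n a b)) R)
    (pi : probability (borel (paths n a b)) R) : weak_cvg (fun N => pi_ N) pi ->
    (A pi <= limn_einf (fun N => A_N N (pi_ N)))%E.
  move=> wpi; apply: (lower_bound_constrained ab m0 c20 cV growth small fT pT fT') => //.
  - exact: probability_setT.
  - exact: probability_setT.
  - by exists K => // N /supp[].
split => [//|pi]; have [Apoo|Afin] := eqVneq (A pi) +oo%E.
  exists (fun=> pi); split; first by move=> f _ _; exact: cvg_cst.
  rewrite Apoo; apply: limn_einf_pinfty; apply/eqP; rewrite -leye_eq -Apoo.
  by apply: liminf => f _ _; exact: cvg_cst.
move: Afin; rewrite /A /constrained_mean; case: asboolP => [H|]; last by rewrite eqxx.
rewrite -ltey => fin.
have ma : has_marginal a pi mu_a by move=> B mB; have [] := H B mB.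
have mb : has_marginal b pi mu_b by move=> B mB; have [] := H B mB.
have [pi_ [wpi Api]] := recovery_sequence ab m0 c20 cV growth small fT pT fT'
  ma mb cKa Ka0 cKb Kb0 cK supp wx wy fin.
by exists pi_.
Qed.
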